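(* Type checking and type reconstruction are decidable for $\Delta^{CD}_{\equiv}$, $\Delta^{CDV}_{\equiv}$, $\Delta^{CDS}_{\equiv}$, $\Delta^{BCD}_{\equiv}$, $\Delta^{CD}_{=_\beta}$, $\Delta^{CDV}_{=_\beta}$ and $\Delta^{CDV}_{=_{\beta\eta}}$, and are undecidable for $\Delta^{CDS}_{=_\beta}$, $\Delta^{BCD}_{=_\beta}$ and $\Delta^{BCD}_{=_{\beta\eta}}$.
   Context: Type atoms: a set $\mathbb{A}$ of symbols; $\omega$ denotes a distinguished atom (the universal type). $\mathbb{A}_\infty=\{\mathtt a_i\mid i\in\mathbb N\}$ with each $\mathtt a_i\neq\omega$, and $\mathbb{A}^\omega_\infty=\mathbb{A}_\infty\cup\{\omega\}$. Intersection types over $\mathbb A$: $\sigma::= a\mid\sigma\to\sigma\mid\sigma\cap\sigma$ ($a\in\mathbb A$). An intersection type theory $\mathcal T$ over $\mathbb A$ is a set of inequalities $\sigma\le\tau$ (written $\sigma\le_{\mathcal T}\tau$) closed under (refl) $\sigma\le\sigma$; (incl) $\sigma\cap\tau\le\sigma$ and $\sigma\cap\tau\le\tau$; (glb) $\rho\le\sigma$ and $\rho\le\tau$ imply $\rho\le\sigma\cap\tau$; (trans) $\sigma\le\tau$ and $\tau\le\rho$ imply $\sigma\le\rho$. Additional axioms/rules: $(\omega_{top})$ $\sigma\le\omega$; $(\omega_{\to})$ $\omega\le\sigma\to\omega$; $(\to\cap)$ $(\sigma\to\tau)\cap(\sigma\to\rho)\le\sigma\to(\tau\cap\rho)$; $(\to)$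 $\sigma_2\le\sigma_1$ and $\tau_1\le\tau_2$ imply $\sigma_1\to\tau_1\le\sigma_2\to\tau_2$. $\mathcal T_{CD}$ = smallest type theory over $\mathbb A_\infty$; $\mathcal T_{CDS}$ = smallest over $\mathbb A^\omega_\infty$ containing $(\omega_{top})$; $\mathcal T_{CDV}$ = smallest over $\mathbb A_\infty$ closed under $(\to)$ and $(\to\cap)$; $\mathcal T_{BCD}$ = smallest over $\mathbb A^\omega_\infty$ closed under $(\to),(\to\cap),(\omega_{top}),(\omega_\to)$. We abbreviate these as CD, CDS, CDV, BCD. $\Delta$-terms: $\Delta::=u_\Delta\mid x\mid\lambda x{:}\sigma.\Delta\mid\Delta\,\Delta\mid\langle\Delta,\Delta\rangle\mid pr_1\Delta\mid pr_2\Delta\mid\Delta^\sigma$, where for every (not necessarily typable) $\Delta$-term $\Delta$ there is a constant $u_\Delta$. The essence $\|\Delta\|$ is the pure $\lambda$-term defined by $\|x\|=x$, $\|u_\Delta\|=\|\Delta\|$, $\|\Delta^\sigma\|=\|\Delta\|$, $\|\lambda x{:}\sigma.\Delta\|=\lambda x.\|\Delta\|$, $\|\Delta_1\Delta_2\|=\|\Delta_1\|\,\|\Delta_2\|$, $\|\langle\Delta_1,\Delta_2\rangle\|=\|\Delta_1\|$, $\|pr_i\Delta\|=\|\Delta\|$. Let $\mathcal R$ be one of $\equiv$ (syntactic identity up to $\alpha$), $=_\beta$, $=_{\beta\eta}$ on pure $\lambda$-terms. A basis $B$ is a finite set of declarations $x{:}\sigma$ with distinct variables. The typed system $\Delta^{\mathcal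 T}_{\mathcal R}$ derives $B\vdash^{\mathcal T}_{\mathcal R}\Delta:\sigma$ by: (top) $B\vdash u_\Delta:\omega$ if $\omega\in\mathbb A$; (ax) $B\vdash x:\sigma$ if $x{:}\sigma\in B$; ($\to$I) from $B,x{:}\sigma\vdash\Delta:\tau$ infer $B\vdash\lambda x{:}\sigma.\Delta:\sigma\to\tau$; ($\to$E) from $B\vdash\Delta_1:\sigma\to\tau$ and $B\vdash\Delta_2:\sigma$ infer $B\vdash\Delta_1\Delta_2:\tau$; ($\cap$I) from $B\vdash\Delta_1:\sigma$, $B\vdash\Delta_2:\tau$ and $\|\Delta_1\|\mathrel{\mathcal R}\|\Delta_2\|$ infer $B\vdash\langle\Delta_1,\Delta_2\rangle:\sigma\cap\tau$; ($\cap$E$_1$) from $B\vdash\Delta:\sigma\cap\tau$ infer $B\vdash pr_1\Delta:\sigma$; ($\cap$E$_2$) from $B\vdash\Delta:\sigma\cap\tau$ infer $B\vdash pr_2\Delta:\tau$; ($\le_{\mathcal T}$) from $B\vdash\Delta:\sigma$ and $\sigma\le_{\mathcal T}\tau$ infer $B\vdash\Delta^\tau:\tau$. We write $\Delta^{CD}_{\mathcal R}$ for $\Delta^{\mathcal T_{CD}}_{\mathcal R}$, etc. Type checking for a system: the problem, given $B$, $\Delta$, $\sigma$, of deciding whether $B\vdash^{\mathcal T}_{\mathcal R}\Delta:\sigma$. Type reconstruction: the problem, given $B$ and $\Delta$, of deciding whether some $\sigma$ with $B\vdash^{\mathcal T}_{\mathcal R}\Delta:\sigma$ exists and, if so, computing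 it. *)

(* Defs.v *)
From Stdlib Require Import List Arith Relations.
Import ListNotations.

Inductive ty : Type :=
| TAtom : nat -> ty
| TOm : ty
| TArr : ty -> ty -> ty
| TCap : ty -> ty -> ty.

(* The four type theories: th_om = "omega is an atom and (omega_top) holds";
   th_arr = "closed under (->) and (->cap)"; (omega_->) holds iff both. *)
Record theory := Theory { th_om : bool; th_arr : bool }.
Definition CD  := Theory false false.
Definition CDS := Theory true false.
Definition CDV := Theory false true.
Definition BCD := Theory true true.

Fixpoint wf_ty (th : theory) (s : ty) : Prop :=
  match s with
  | TAtom _ => True
  | TOm => th_om th = true
  | TArr a b => wf_ty th a /\ wf_ty th b
  | TCap a b => wf_ty th a /\ wf_ty th b
  end.

Inductive leT (th : theory) : ty -> ty -> Prop :=
| le_refl s : wf_ty th s -> leT th s s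
| le_incl1 s t : wf_ty th s -> wf_ty th t -> leT th (TCap s t) s
| le_incl2 s t : wf_ty th s -> wf_ty th t -> leT th (TCap s t) t
| le_glb r s t : leT th r s -> leT th r t -> leT th r (TCap s t)
| le_trans s t r : leT th s t -> leT th t r -> leT th s r
| le_omtop s : th_om th = true -> wf_ty th s -> leT th s TOm
| le_omarr s : th_om th = true -> th_arr th = true -> wf_ty th s ->
    leT th TOm (TArr s TOm)
| le_arrcap s t r : th_arr th = true -> wf_ty th s -> wf_ty th t -> wf_ty th r ->
    leT th (TCap (TArr s t) (TArr s r)) (TArr s (TCap t r))
| le_arr s1 s2 t1 t2 : th_arr th = true -> leT th s2 s1 -> leT th t1 t2 ->
    leT th (TArr s1 t1) (TArr s2 t2).

(* Delta-terms; variables are natural numbers.  U d is the constant    *)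
(* u_d (one for every Delta-term d).                                   *)
Inductive dterm : Type :=
| U : dterm -> dterm
| Var : nat -> dterm
| Lam : nat -> ty -> dterm -> dterm
| App : dterm -> dterm -> dterm
| Pair : dterm -> dterm -> dterm
| Pr1 : dterm -> dterm
| Pr2 : dterm -> dterm
| Coe : dterm -> ty -> dterm.

Fixpoint wf_term (th : theory) (d : dterm) : Prop :=
  match d with
  | U d => wf_term th d
  | Var _ => True
  | Lam _ s d => wf_ty th s /\ wf_term th d
  | App a b => wf_term th a /\ wf_term th b
  | Pair a b => wf_term th a /\ wf_term th b
  | Pr1 a => wf_term th a
  | Pr2 a => wf_term th a
  | Coe a s => wf_term th a /\ wf_ty th s
  end.

(* Pure lambda-terms in de Bruijn notation (so that syntactic identity *)
(* up to alpha is Leibniz equality).                                   *)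
Inductive lterm : Type :=
| LV : nat -> lterm
| LLam : lterm -> lterm
| LApp : lterm -> lterm -> lterm.

Fixpoint liftn (n k : nat) (t : lterm) : lterm :=
  match t with
  | LV i => if i <? k then LV i else LV (i + n)
  | LLam b => LLam (liftn n (S k) b)
  | LApp a b => LApp (liftn n k a) (liftn n k b)
  end.

Fixpoint subst (k : nat) (u : lterm) (t : lterm) : lterm :=
  match t with
  | LV i => if i <? k then LV i
            else if i =? k then liftn k 0 u else LV (pred i)
  | LLam b => LLam (subst (S k) u b)
  | LApp a b => LApp (subst k u a) (subst k u b)
  end.

Inductive beta_step : lterm -> lterm -> Prop :=
| b_red b u : beta_step (LApp (LLam b) u) (subst 0 u b)
| b_lam a a' : beta_step a a' -> beta_step (LLam a) (LLam a')
| b_appl a a' b : beta_step a a' -> beta_step (LApp a b) (LApp a' b)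
| b_appr a b b' : beta_step b b' -> beta_step (LApp a b) (LApp a b').

Inductive betaeta_step : lterm -> lterm -> Prop :=
| be_red b u : betaeta_step (LApp (LLam b) u) (subst 0 u b)
| be_eta t : betaeta_step (LLam (LApp (liftn 1 0 t) (LV 0))) t
| be_lam a a' : betaeta_step a a' -> betaeta_step (LLam a) (LLam a')
| be_appl a a' b : betaeta_step a a' -> betaeta_step (LApp a b) (LApp a' b)
| be_appr a b b' : betaeta_step b b' -> betaeta_step (LApp a b) (LApp a b').

Inductive eqkind := Syn | Beta | BetaEta.

Definition convR (R : eqkind) : lterm -> lterm -> Prop :=
  match R with
  | Syn => fun a b => a = b
  | Beta => clos_refl_sym_trans lterm beta_step
  | BetaEta => clos_refl_sym_trans lterm betaeta_step
  end.

Fixpoint find_idx (x : nat) (ctx : list nat) : option nat :=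
  match ctx with
  | [] => None
  | y :: c => if x =? y then Some 0 else option_map S (find_idx x c)
  end.

(* essence, translated to de Bruijn: a free variable x at binder depth n
   is represented by index n + x *)
Fixpoint ess (ctx : list nat) (d : dterm) : lterm :=
  match d with
  | U d => ess ctx d
  | Var x => match find_idx x ctx with
             | Some i => LV i
             | None => LV (length ctx + x)
             end
  | Lam x _ d => LLam (ess (x :: ctx) d)
  | App a b => LApp (ess ctx a) (ess ctx b)
  | Pair a _ => ess ctx a
  | Pr1 a => ess ctx a
  | Pr2 a => ess ctx a
  | Coe a _ => ess ctx a
  end.

Definition essence (d : dterm) : lterm := ess [] d.

Definition basis := list (nat * ty).

Definition wf_basis (th : theory) (B : basis) : Prop :=
  NoDup (map fst B) /\ Forall (fun p => wf_ty th (snd p)) B.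

Definition ext (B : basis) (x : nat) (s : ty) : basis :=
  (x, s) :: filter (fun p => negb (fst p =? x)) B.

Inductive typ (th : theory) (R : eqkind) : basis -> dterm -> ty -> Prop :=
| t_top B d : th_om th = true -> typ th R B (U d) TOm
| t_ax B x s : In (x, s) B -> typ th R B (Var x) s
| t_lam B x s d t : typ th R (ext B x s) d t -> typ th R B (Lam x s d) (TArr s t)
| t_app B d1 d2 s t : typ th R B d1 (TArr s t) -> typ th R B d2 s ->
    typ th R B (App d1 d2) t
| t_pair B d1 d2 s t : typ th R B d1 s -> typ th R B d2 t ->
    convR R (essence d1) (essence d2) -> typ th R B (Pair d1 d2) (TCap s t)
| t_pr1 B d s t : typ th R B d (TCap s t) -> typ th R B (Pr1 d) s
| t_pr2 B d s t : typ th R B d (TCap s t) -> typ th R B (Pr2 d) t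
| t_coe B d s t : typ th R B d s -> leT th s t -> typ th R B (Coe d t) t.

Inductive mu : Type :=
| MZero : mu
| MSucc : mu
| MProj : nat -> mu
| MComp : mu -> list mu -> mu
| MPrimRec : mu -> mu -> mu
| MMin : mu -> mu.

Inductive eval : mu -> list nat -> nat -> Prop :=
| e_zero v : eval MZero v 0
| e_succ x v : eval MSucc (x :: v) (S x)
| e_proj i v y : nth_error v i = Some y -> eval (MProj i) v y
| e_comp f gs v ys y : evals gs v ys -> eval f ys y -> eval (MComp f gs) v y
| e_pr0 f g v y : eval f v y -> eval (MPrimRec f g) (0 :: v) y
| e_prS f g n v r y : eval (MPrimRec f g) (n :: v) r ->
    eval g (n :: r :: v) y -> eval (MPrimRec f g) (S n :: v) y
| e_min f v n : eval f (n :: v) 0 ->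
    (forall m, m < n -> exists k, eval f (m :: v) (S k)) -> eval (MMin f) v n
with evals : list mu -> list nat -> list nat -> Prop :=
| es_nil v : evals [] v []
| es_cons g gs v y ys : eval g v y -> evals gs v ys -> evals (g :: gs) v (y :: ys).

Definition cpair (x y : nat) : nat := (x + y) * (x + y + 1) / 2 + y.

Fixpoint enc_ty (s : ty) : nat :=
  match s with
  | TAtom n => cpair 0 n
  | TOm => cpair 1 0
  | TArr a b => cpair 2 (cpair (enc_ty a) (enc_ty b))
  | TCap a b => cpair 3 (cpair (enc_ty a) (enc_ty b))
  end.

Fixpoint enc_term (d : dterm) : nat :=
  match d with
  | U a => cpair 0 (enc_term a)
  | Var x => cpair 1 x
  | Lam x s a => cpair 2 (cpair x (cpair (enc_ty s) (enc_term a)))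
  | App a b => cpair 3 (cpair (enc_term a) (enc_term b))
  | Pair a b => cpair 4 (cpair (enc_term a) (enc_term b))
  | Pr1 a => cpair 5 (enc_term a)
  | Pr2 a => cpair 6 (enc_term a)
  | Coe a s => cpair 7 (cpair (enc_term a) (enc_ty s))
  end.

Fixpoint enc_basis (B : basis) : nat :=
  match B with
  | [] => 0
  | (x, s) :: B' => S (cpair (cpair x (enc_ty s)) (enc_basis B'))
  end.

Definition TC_decidable (th : theory) (R : eqkind) : Prop :=
  exists f : mu, forall B d s,
    wf_basis th B -> wf_term th d -> wf_ty th s ->
    let c := cpair (enc_basis B) (cpair (enc_term d) (enc_ty s)) in
    (typ th R B d s -> eval f [c] 1) /\ (~ typ th R B d s -> eval f [c] 0).

Definition TR_decidable (th : theory) (R : eqkind) : Prop :=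
  exists f : mu, forall B d,
    wf_basis th B -> wf_term th d ->
    let c := cpair (enc_basis B) (enc_term d) in
    ((forall s, ~ typ th R B d s) -> eval f [c] 0) /\
    ((exists s, typ th R B d s) ->
       exists s, typ th R B d s /\ eval f [c] (S (enc_ty s))).

Definition decidable_sys (th : theory) (R : eqkind) : Prop :=
  TC_decidable th R /\ TR_decidable th R.

Definition undecidable_sys (th : theory) (R : eqkind) : Prop :=
  ~ TC_decidable th R /\ ~ TR_decidable th R.

(* Main.v *)
From Stdlib Require Import List Arith Lia Relations Bool Setoid Morphisms.
Require Import Defs.
Import ListNotations.

(** Decidability. A finite set of Horn clauses over numbers, built from 0, successor and
pairing, has a recursively enumerable least model, so a function whose graph is one of its
predicates is computed by unbounded search for a derivation. Type inference is such a function: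
types are unique, subtyping is decided by inverting [a -> b] (some intersection of the targets
[b'] of arrows [a' -> b'] occurring in the left-hand side with [a <= a'] must lie below [b]),
and convertibility of two essences is read off their normal forms. The essences of typable terms
have normal forms when there is no universal type: interpret types by sets of weakly normalising
terms closed under conversion.

Undecidability. With [omega], the term [<u_M, u_N>] is typable iff the essences of [M] and [N]
are convertible. A decision procedure, being lambda-definable, would yield a term [D] for which
[D n] is convertible to [num 0] iff it is not, where [n] is the code of [D]. *)

(** * Horn clauses and recursive functions *)

(** Decidability is stated with codes of partial recursive functions, so an algorithm given as a
    Rocq function would not do; Horn clauses avoid compiling recursive procedures one by one. Two
    facts per predicate suffice: whatever is derivable is true, and on every admissible input some
    answer is derivable. Since truth fixes the answer, it does not matter which derivation the
    search meets, and nondeterministic clauses are harmless. The price is the absence of negation: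
    tests carry a truth value as an argument, and untypability must itself be derivable. This shapes
    the inference rules: a pair with an untypable component is rejected without comparing essences,
    so that normal forms are needed for typable terms only. Subtyping is decided with a list of
    types on the left; inversion at an arrow replaces it by a list that is no larger, while the
    right-hand side shrinks. Confluence serves both halves: it reduces convertibility to equality of
    normal forms, and it separates the two answers in the diagonal argument. Beta and beta-eta are
    treated together, by a flag for the eta-rule. *)

Fixpoint tri (n : nat) : nat := match n with 0 => 0 | S m => tri m + S m end.

Lemma tri_double n : 2 * tri n = n * (n + 1).
Proof. induction n; simpl in *; lia. Qed.

Lemma cpair_tri x y : cpair x y = tri (x + y) + y.
Proof.
  unfold cpair. rewrite <- tri_double.
  rewrite Nat.mul_comm, Nat.div_mul; lia.
Qed.

(** The largest [s] with [tri s <= c], written by primitive recursion so that unpairing can be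
    programmed in [mu] without minimisation. *)
Fixpoint sroot (c : nat) : nat :=
  match c with
  | 0 => 0
  | S c' => if tri (S (sroot c')) <=? S c' then S (sroot c') else sroot c'
  end.

Definition psnd (c : nat) : nat := c - tri (sroot c).
Definition pfst (c : nat) : nat := sroot c - psnd c.

Lemma sroot_spec c : tri (sroot c) <= c < tri (S (sroot c)).
Proof.
  induction c as [|c IH]; [simpl; lia|].
  cbn [sroot]. destruct (Nat.leb_spec (tri (S (sroot c))) (S c)); [|lia].
  cbn [tri] in *; lia.
Qed.

Lemma tri_mono m n : m <= n -> tri m <= tri n.
Proof. induction 1; simpl; lia. Qed.

Lemma sroot_tri s y : y <= s -> sroot (tri s + y) = s.
Proof.
  intros H. pose proof (sroot_spec (tri s + y)) as [H1 H2].
  set (r := sroot _) in *.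
  destruct (Nat.lt_trichotomy r s) as [L|[L|L]]; [|exact L|].
  - pose proof (tri_mono (S r) s L). lia.
  - pose proof (tri_mono (S s) r L). cbn [tri] in *; lia.
Qed.

Lemma psnd_cpair x y : psnd (cpair x y) = y.
Proof. unfold psnd. rewrite cpair_tri, sroot_tri; lia. Qed.

Lemma pfst_cpair x y : pfst (cpair x y) = x.
Proof. unfold pfst. rewrite psnd_cpair, cpair_tri, sroot_tri; lia. Qed.

Lemma cpair_surj c : cpair (pfst c) (psnd c) = c.
Proof.
  rewrite cpair_tri. unfold pfst, psnd.
  pose proof (sroot_spec c). cbn [tri] in *.
  replace (sroot c - (c - tri (sroot c)) + (c - tri (sroot c))) with (sroot c); lia.
Qed.

Lemma cpair_inj x y x' y' : cpair x y = cpair x' y' -> x = x' /\ y = y'.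
Proof.
  intros H. split.
  - rewrite <- (pfst_cpair x y), H. apply pfst_cpair.
  - rewrite <- (psnd_cpair x y), H. apply psnd_cpair.
Qed.

(** * Arithmetic expressions compiled to recursive functions *)

Inductive exp : Type :=
| EVar : nat -> exp
| EZero : exp
| ESucc : exp -> exp
| EPair : exp -> exp -> exp
| EFst : exp -> exp
| ESnd : exp -> exp
| EIf : exp -> exp -> exp -> exp -> exp
| EIter : exp -> exp -> exp -> exp.

Fixpoint den (e : exp) (v : list nat) : nat :=
  match e with
  | EVar i => nth i v 0
  | EZero => 0
  | ESucc e => S (den e v)
  | EPair a b => cpair (den a v) (den b v)
  | EFst a => pfst (den a v)
  | ESnd a => psnd (den a v)
  | EIf a b c d => if den a v =? den b v then den c v else den d v
  | EIter b n x => Nat.iter (den n v) (fun r => den b [r]) (den x v)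
  end.

(** [MProj i] has no value on a list of length at most [i], whereas [den] returns 0 there;
    compilation is faithful only within these bounds. The body of [EIter] sees the iterated value
    alone. *)
Fixpoint bnd (k : nat) (e : exp) : Prop :=
  match e with
  | EVar i => i < k
  | EZero => True
  | ESucc e => bnd k e
  | EPair a b => bnd k a /\ bnd k b
  | EFst a => bnd k a
  | ESnd a => bnd k a
  | EIf a b c d => bnd k a /\ bnd k b /\ bnd k c /\ bnd k d
  | EIter b n x => bnd 1 b /\ bnd k n /\ bnd k x
  end.

Lemma eval_comp1 f g v a y : eval g v a -> eval f [a] y -> eval (MComp f [g]) v y.
Proof. intros. econstructor; [|eassumption]. repeat (constructor; [assumption|]). constructor. Qed.

Lemma eval_comp2 f g h v a b y :
  eval g v a -> eval h v b -> eval f [a; b] y -> eval (MComp f [g; h]) v y.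
Proof. intros. econstructor; [|eassumption]. repeat (constructor; [assumption|]). constructor. Qed.

Lemma eval_proj i v : i < length v -> eval (MProj i) v (nth i v 0).
Proof. intros. constructor. now apply nth_error_nth'. Qed.

Ltac mproj := match goal with |- eval (MProj ?i) ?v _ => apply (eval_proj i v); simpl; lia end.

Definition madd := MPrimRec (MProj 0) (MComp MSucc [MProj 1]).
Lemma eval_madd x y : eval madd [x; y] (x + y).
Proof.
  induction x as [|x IH]; [constructor; mproj|].
  econstructor; [exact IH|]. eapply eval_comp1; [mproj|]. constructor.
Qed.

Definition mpred := MPrimRec MZero (MProj 0).
Lemma eval_mpred x : eval mpred [x] (pred x).
Proof.
  induction x as [|x IH]; [repeat constructor|].
  econstructor; [exact IH|]. mproj.
Qed.

(** Truncated subtraction with its arguments exchanged, because primitive recursion runs on the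
    first one. *)
Definition msubr := MPrimRec (MProj 0) (MComp mpred [MProj 1]).
Lemma eval_msubr x y : eval msubr [x; y] (y - x).
Proof.
  induction x as [|x IH]; [rewrite Nat.sub_0_r; constructor; mproj|].
  replace (y - S x) with (pred (y - x)) by lia.
  econstructor; [exact IH|]. eapply eval_comp1; [mproj|]. apply eval_mpred.
Qed.

Definition mtri := MPrimRec MZero (MComp madd [MProj 1; MComp MSucc [MProj 0]]).
Lemma eval_mtri x : eval mtri [x] (tri x).
Proof.
  induction x as [|x IH]; [repeat constructor|].
  cbn [tri]. econstructor; [exact IH|].
  eapply eval_comp2; [mproj| |apply eval_madd].
  eapply eval_comp1; [mproj|constructor].
Qed.

(** In the successor case the arguments are the predecessor, the previous result, [a] and [b],
    whence [MProj 3]. *)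
Definition msel := MPrimRec (MProj 0) (MProj 3).
Lemma eval_msel n a b : eval msel [n; a; b] (match n with 0 => a | _ => b end).
Proof.
  induction n as [|n IH]; [constructor; mproj|].
  econstructor; [exact IH|]. mproj.
Qed.

Lemma eval_comp3 f g h i v a b c y :
  eval g v a -> eval h v b -> eval i v c -> eval f [a; b; c] y ->
  eval (MComp f [g; h; i]) v y.
Proof. intros. econstructor; [|eassumption]. repeat (constructor; [assumption|]). constructor. Qed.

(** The comparison in [sroot] is tested by the vanishing of a truncated difference; [MProj 0] is the
    predecessor and [MProj 1] the root found for it. *)
Definition msroot :=
  MPrimRec MZero
    (MComp msel [MComp msubr [MComp MSucc [MProj 0]; MComp mtri [MComp MSucc [MProj 1]]];
                 MComp MSucc [MProj 1]; MProj 1]).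
Lemma eval_msroot x : eval msroot [x] (sroot x).
Proof.
  induction x as [|x IH]; [repeat constructor|].
  econstructor; [exact IH|].
  assert (H1 : eval (MComp MSucc [MProj 0]) [x; sroot x] (S x))
    by (eapply eval_comp1; [mproj|constructor]).
  assert (H2 : eval (MComp MSucc [MProj 1]) [x; sroot x] (S (sroot x)))
    by (eapply eval_comp1; [mproj|constructor]).
  replace (sroot (S x)) with
    (match tri (S (sroot x)) - S x with 0 => S (sroot x) | _ => sroot x end).
  - eapply eval_comp3; [|exact H2|mproj|apply eval_msel].
    eapply eval_comp2; [exact H1| |apply eval_msubr].
    eapply eval_comp1; [exact H2|apply eval_mtri].
  - cbn [sroot]. destruct (Nat.leb_spec (tri (S (sroot x))) (S x));
      destruct (tri (S (sroot x)) - S x) eqn:E; lia.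
Qed.

Definition mpair := MComp madd [MComp mtri [madd]; MProj 1].
Lemma eval_mpair x y : eval mpair [x; y] (cpair x y).
Proof.
  rewrite cpair_tri. eapply eval_comp2; [|mproj|apply eval_madd].
  eapply eval_comp1; [apply eval_madd|apply eval_mtri].
Qed.

Definition msnd := MComp msubr [MComp mtri [msroot]; MProj 0].
Lemma eval_msnd x : eval msnd [x] (psnd x).
Proof.
  eapply eval_comp2; [|mproj|apply eval_msubr].
  eapply eval_comp1; [apply eval_msroot|apply eval_mtri].
Qed.

Definition mfst := MComp msubr [msnd; msroot].
Lemma eval_mfst x : eval mfst [x] (pfst x).
Proof. eapply eval_comp2; [apply eval_msnd|apply eval_msroot|apply eval_msubr]. Qed.

Definition mdist := MComp madd [msubr; MComp msubr [MProj 1; MProj 0]].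
Lemma eval_mdist x y : eval mdist [x; y] ((y - x) + (x - y)).
Proof.
  eapply eval_comp2; [apply eval_msubr| |apply eval_madd].
  eapply eval_comp2; [mproj|mproj|apply eval_msubr].
Qed.

Fixpoint cmp (e : exp) : mu :=
  match e with
  | EVar i => MProj i
  | EZero => MZero
  | ESucc e => MComp MSucc [cmp e]
  | EPair a b => MComp mpair [cmp a; cmp b]
  | EFst a => MComp mfst [cmp a]
  | ESnd a => MComp msnd [cmp a]
  | EIf a b c d => MComp msel [MComp mdist [cmp a; cmp b]; cmp c; cmp d]
  | EIter b n x => MComp (MPrimRec (MProj 0) (MComp (cmp b) [MProj 1])) [cmp n; cmp x]
  end.

Lemma eval_cmp e : forall v, bnd (length v) e -> eval (cmp e) v (den e v).
Proof.
  induction e; simpl; intros v Hb.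
  - now apply eval_proj.
  - constructor.
  - eapply eval_comp1; [auto|constructor].
  - eapply eval_comp2; [apply IHe1|apply IHe2|apply eval_mpair]; tauto.
  - eapply eval_comp1; [auto|apply eval_mfst].
  - eapply eval_comp1; [auto|apply eval_msnd].
  - destruct Hb as (? & ? & ? & ?).
    replace (if den e1 v =? den e2 v then den e3 v else den e4 v) with
      (match (den e2 v - den e1 v) + (den e1 v - den e2 v) with 0 => den e3 v | _ => den e4 v end).
    + eapply eval_comp3; [|auto|auto|apply eval_msel].
      eapply eval_comp2; [auto|auto|apply eval_mdist].
    + destruct (Nat.eqb_spec (den e1 v) (den e2 v));
        destruct (den e2 v - den e1 v + (den e1 v - den e2 v)) eqn:E; lia.
  - destruct Hb as (Hb & ? & ?).
    eapply eval_comp2; [auto|auto|].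
    induction (den e2 v) as [|n IH]; [constructor; mproj|].
    econstructor; [exact IH|].
    eapply eval_comp1; [mproj|]. apply IHe1. exact Hb.
Qed.

(** * Horn clauses and the search for derivations *)

Inductive pat : Type :=
| PV : nat -> pat
| PZ : pat
| PS : pat -> pat
| PP : pat -> pat -> pat.

Fixpoint ev (l : list nat) (p : pat) : nat :=
  match p with
  | PV i => nth i l 0
  | PZ => 0
  | PS p => S (ev l p)
  | PP p q => cpair (ev l p) (ev l q)
  end.

Record clause := Clause { c_tag : nat; c_head : pat; c_body : list (nat * pat) }.

Inductive holds (P : list clause) : nat -> nat -> Prop :=
| h_clause c l : In c P ->
    (forall t p, In (t, p) (c_body c) -> holds P t (ev l p)) ->
    holds P (c_tag c) (ev l (c_head c)).

(** The empty list has code 0, which is also [cpair 0 0]: a code reads as a list padded with zeros,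
    in agreement with the default of [nth] in [ev]. *)
Fixpoint enc_list (l : list nat) : nat :=
  match l with [] => 0 | x :: l => cpair x (enc_list l) end.

Fixpoint env_nth (e : exp) (i : nat) : exp :=
  match i with 0 => EFst e | S i => env_nth (ESnd e) i end.

Fixpoint pexp (e : exp) (p : pat) : exp :=
  match p with
  | PV i => env_nth e i
  | PZ => EZero
  | PS p => ESucc (pexp e p)
  | PP p q => EPair (pexp e p) (pexp e q)
  end.

(** Every number decodes to a valuation, so soundness of the search needs no assumption on the
    guessed numbers. *)
Fixpoint dec_list (n : nat) (c : nat) : list nat :=
  match n with 0 => [] | S n => pfst c :: dec_list n (psnd c) end.

Fixpoint pvars (p : pat) : nat :=
  match p with PV i => S i | PZ => 0 | PS p => pvars p | PP p q => Nat.max (pvars p) (pvars q) end.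

Lemma den_env_nth i : forall e v n, i < n -> den (env_nth e i) v = nth i (dec_list n (den e v)) 0.
Proof.
  induction i; intros e v [|n] H; try lia; simpl; [reflexivity|].
  rewrite (IHi _ _ n); [reflexivity|lia].
Qed.

Lemma den_pexp e p v n : pvars p <= n -> den (pexp e p) v = ev (dec_list n (den e v)) p.
Proof.
  induction p; simpl; intros H; auto.
  - apply den_env_nth; lia.
  - rewrite IHp1, IHp2; lia.
Qed.

Lemma cpair00 : cpair 0 0 = 0.
Proof. reflexivity. Qed.

Lemma dec_list_nth i : forall n l, i < n -> nth i (dec_list n (enc_list l)) 0 = nth i l 0.
Proof.
  induction i; intros [|n] l H; try lia; destruct l; simpl.
  - rewrite <- cpair00. apply pfst_cpair.
  - apply pfst_cpair.
  - replace (psnd 0) with (enc_list []) by reflexivity. rewrite IHi by lia. now destruct i.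
  - rewrite psnd_cpair. apply IHi. lia.
Qed.

Lemma ev_dec_list n l p : pvars p <= n -> ev (dec_list n (enc_list l)) p = ev l p.
Proof.
  induction p; simpl; intros H; auto.
  - apply dec_list_nth; lia.
  - rewrite IHp1, IHp2; lia.
Qed.

(* A goal is pushed as [S goal] so that the empty stack is coded by 0 only. *)
Definition push (t a r : nat) : nat := cpair (S (cpair t a)) r.

Fixpoint econst (n : nat) : exp := match n with 0 => EZero | S n => ESucc (econst n) end.

Lemma den_econst n v : den (econst n) v = n.
Proof. induction n; simpl; congruence. Qed.

Fixpoint epushes (E : exp) (b : list (nat * pat)) (r : exp) : exp :=
  match b with
  | [] => r
  | (t, p) :: b => EPair (ESucc (EPair (econst t) (pexp E p))) (epushes E b r)
  end.

(* State: <<<index of the clause, valuation>, remaining choices>, goal stack>. *)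
Definition eIdx := EFst (EFst (EFst (EVar 0))).
Definition eEnv := ESnd (EFst (EFst (EVar 0))).
Definition eRest := ESnd (EFst (EVar 0)).
Definition eStack := ESnd (EVar 0).

(** The guess is accepted only if the head of the chosen clause, under the guessed valuation, is the
    goal on top. Otherwise the guess is dropped and the stack stays as it is. On the empty stack
    [EFst] yields 0, which is not a successor, so no clause fires. *)
Fixpoint estep (P : list clause) (i : nat) : exp :=
  match P with
  | [] => EPair eRest eStack
  | c :: P =>
      EIf (EPair eIdx (EFst eStack))
          (EPair (econst i) (ESucc (EPair (econst (c_tag c)) (pexp eEnv (c_head c)))))
          (EPair eRest (epushes eEnv (c_body c) (ESnd eStack)))
          (estep P (S i))
  end.

Lemma bnd_env_nth k i : forall e, bnd k e -> bnd k (env_nth e i).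
Proof. induction i; simpl; auto. Qed.
Lemma bnd_pexp k e p : bnd k e -> bnd k (pexp e p).
Proof. intros; induction p; simpl; auto using bnd_env_nth. Qed.
Lemma bnd_econst k n : bnd k (econst n).
Proof. induction n; simpl; auto. Qed.
Lemma bnd_epushes k E b r : bnd k E -> bnd k r -> bnd k (epushes E b r).
Proof. intros; induction b as [|[]]; simpl; auto 7 using bnd_pexp, bnd_econst. Qed.
Lemma bnd_estep P : forall i, bnd 1 (estep P i).
Proof.
  induction P; intros i; simpl; [lia|].
  repeat split; try lia; auto using bnd_econst.
  - apply bnd_pexp; simpl; lia.
  - apply bnd_epushes; simpl; lia.
Qed.

Inductive all_hold (P : list clause) : nat -> Prop :=
| ah_nil : all_hold P 0
| ah_cons t a r : holds P t a -> all_hold P r -> all_hold P (push t a r).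

Lemma push_inj t a r t' a' r' : push t a r = push t' a' r' -> t = t' /\ a = a' /\ r = r'.
Proof.
  unfold push. intros H. apply cpair_inj in H as [H ?]. injection H as H.
  apply cpair_inj in H. tauto.
Qed.

Lemma pfst_push t a r : pfst (push t a r) = S (cpair t a).
Proof. apply pfst_cpair. Qed.
Lemma psnd_push t a r : psnd (push t a r) = r.
Proof. apply psnd_cpair. Qed.

Lemma all_hold_push P t a r : all_hold P (push t a r) -> holds P t a /\ all_hold P r.
Proof.
  intros H. inversion H as [E|t' a' r' Hh Hr E].
  - unfold push in E. rewrite <- cpair00 in E. apply cpair_inj in E. lia.
  - apply push_inj in E as (-> & -> & ->). auto.
Qed.

Lemma den_epushes E v r : forall b n,
  (forall t p, In (t, p) b -> pvars p <= n) ->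
  den (epushes E b r) v =
  fold_right (fun g acc => push (fst g) (ev (dec_list n (den E v)) (snd g)) acc) (den r v) b.
Proof.
  induction b as [|[t p] b IH]; simpl; intros n H; auto.
  unfold push. rewrite (IH n) by eauto. rewrite den_econst, (den_pexp _ _ _ n) by eauto. reflexivity.
Qed.

Definition cvars (c : clause) : nat :=
  Nat.max (pvars (c_head c)) (list_max (map (fun g => pvars (snd g)) (c_body c))).

Lemma cvars_body c t p : In (t, p) (c_body c) -> pvars p <= cvars c.
Proof.
  intros H. unfold cvars.
  assert (pvars p <= list_max (map (fun g => pvars (snd g)) (c_body c))); [|lia].
  assert (F := proj1 (list_max_le (map (fun g => pvars (snd g)) (c_body c)) _) (le_n _)).
  rewrite Forall_forall in F. apply F, in_map_iff. exists (t, p); auto.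
Qed.

(** Truth travels backwards: an accepted step replaces a goal by premises that imply it, and a
    rejected one changes no goal. Hence a run that empties the stack validates the initial goal. *)
Lemma estep_sound P0 P i s : incl P P0 ->
  all_hold P0 (psnd (den (estep P i) [s])) -> all_hold P0 (psnd s).
Proof.
  revert i; induction P as [|c P IH]; intros i HP; cbn [estep den].
  - rewrite psnd_cpair. auto.
  - destruct (Nat.eqb_spec (cpair (den eIdx [s]) (pfst (den eStack [s])))
       (cpair (den (econst i) [s]) (S (cpair (den (econst (c_tag c)) [s]) (den (pexp eEnv (c_head c)) [s])))))
      as [E|E].
    + rewrite psnd_cpair, (den_epushes _ _ _ _ (cvars c)) by apply cvars_body.
      apply cpair_inj in E as [_ E]. rewrite den_econst in E.
      rewrite (den_pexp _ _ _ (cvars c)) in E by (unfold cvars; lia).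
      set (l := dec_list _ _) in *.
      cbn [den]. set (r := psnd (den eStack [s])). intros H.
      assert (Hb : (forall t p, In (t, p) (c_body c) -> holds P0 t (ev l p)) /\ all_hold P0 r).
      { induction (c_body c) as [|[t p] b IHb]; simpl in *; [tauto|].
        apply all_hold_push in H as [H1 H2]. destruct (IHb H2) as [H3 H4].
        split; auto. intros t' p' [[= -> ->]|]; auto. }
      destruct Hb as [Hb Hr].
      change (psnd s) with (den eStack [s]).
      rewrite <- (cpair_surj (den eStack [s])). fold r. rewrite E.
      apply ah_cons; auto. apply h_clause; auto. apply HP; left; auto.
    + apply IH. intros x Hx. apply HP. now right.
Qed.

Lemma den_if_neq a b c d v : den a v <> den b v -> den (EIf a b c d) v = den d v.
Proof. intros H. cbn [den]. now apply Nat.eqb_neq in H as ->. Qed.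

Lemma estep_hit P : forall k i c l w r, nth_error P k = Some c ->
  den (estep P i) [cpair (cpair (cpair (i + k) (enc_list l)) w) (push (c_tag c) (ev l (c_head c)) r)] =
  cpair w (fold_right (fun g acc => push (fst g) (ev l (snd g)) acc) r (c_body c)).
Proof.
  induction P as [|c0 P IH]; intros [|k] i c l w r Hk; try discriminate.
  - injection Hk as ->. cbn [estep den].
    rewrite (den_epushes _ _ _ _ (cvars c)) by apply cvars_body.
    rewrite (den_pexp _ _ _ (cvars c)) by (unfold cvars; lia).
    rewrite !den_econst.
    cbn [eIdx eEnv eStack eRest den nth].
    repeat rewrite ?pfst_cpair, ?psnd_cpair, ?pfst_push, ?psnd_push.
    rewrite ev_dec_list by (unfold cvars; lia). rewrite Nat.add_0_r, Nat.eqb_refl.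
    f_equal.
    assert (Hb : forall t p, In (t, p) (c_body c) -> pvars p <= cvars c) by apply cvars_body.
    induction (c_body c) as [|[t p] b IHb]; simpl in *; auto.
    rewrite IHb by eauto. rewrite ev_dec_list by eauto. reflexivity.
  - cbn [estep]. rewrite den_if_neq.
    + replace (i + S k) with (S i + k) by lia. apply IH. exact Hk.
    + cbn [den eIdx nth]. rewrite !pfst_cpair, den_econst. intros E. apply cpair_inj in E. lia.
Qed.

Definition stepf (P : list clause) (s : nat) : nat := den (estep P 0) [s].

(** Stated for all remaining choices [w] and all remaining goals [r], so that the runs for the
    premises of a clause can be chained; the choices are assembled from the last premise to the
    first. *)
Lemma stepf_complete P t a : holds P t a ->
  forall w r, exists n w', Nat.iter n (stepf P) (cpair w' (push t a r)) = cpair w r.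
Proof.
  induction 1 as [c l Hc Hb IH]. intros w r.
  assert (Hg : exists n w', Nat.iter n (stepf P)
    (cpair w' (fold_right (fun g acc => push (fst g) (ev l (snd g)) acc) r (c_body c))) = cpair w r).
  { clear Hb. induction (c_body c) as [|[t p] b IHb]; simpl.
    - exists 0, w. reflexivity.
    - destruct IHb as (n1 & w1 & E1); [intros; apply IH; now right|].
      destruct (IH t p (or_introl eq_refl) w1
        (fold_right (fun g acc => push (fst g) (ev l (snd g)) acc) r b)) as (n2 & w2 & E2).
      exists (n1 + n2), w2. rewrite Nat.iter_add, E2. exact E1. }
  destruct Hg as (n & w' & E). apply In_nth_error in Hc as [k Hk].
  (* The index [k] of the clause and its valuation are put in front of the choices [w'] that serve
     the body. *)
  exists (n + 1), (cpair (cpair k (enc_list l)) w').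
  rewrite Nat.iter_add. cbn [Nat.iter nat_rect]. unfold stepf at 2.
  pose proof (estep_hit P k 0 c l w' r Hk) as Hs. cbn [Nat.add] in Hs.
  unfold Nat.iter in *. rewrite Hs. exact E.
Qed.

Lemma stepf_sound P n : forall s, all_hold P (psnd (Nat.iter n (stepf P) s)) -> all_hold P (psnd s).
Proof.
  induction n; intros s H; auto.
  rewrite Nat.iter_succ in H. apply IHn.
  eapply estep_sound; [apply incl_refl|exact H].
Qed.

(* Witness <y, <number of steps, choices>> for the input [c]. *)
Definition etest (P : list clause) (q : nat) : exp :=
  ESnd (EIter (estep P 0) (EFst (ESnd (EVar 0)))
     (EPair (ESnd (ESnd (EVar 0)))
        (EPair (ESucc (EPair (econst q) (EPair (EVar 1) (EFst (EVar 0))))) EZero))).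

Definition compute (P : list clause) (q : nat) : mu := MComp mfst [MMin (cmp (etest P q))].

Lemma least_witness (Q : nat -> bool) n : Q n = true ->
  exists m, Q m = true /\ forall k, k < m -> Q k = false.
Proof.
  induction n as [n IH] using lt_wf_ind. intros Hn.
  destruct (existsb Q (seq 0 n)) eqn:E.
  - apply existsb_exists in E as (m & Hm & HQ). apply in_seq in Hm. apply (IH m); auto; lia.
  - exists n. split; auto. intros k Hk. destruct (Q k) eqn:Ek; auto.
    rewrite <- E. symmetry. apply existsb_exists. exists k. split; auto. apply in_seq; lia.
Qed.

(** The minimisation may stop at a witness other than the one coming from the known derivation;
    soundness makes it a derivation too, and uniqueness of the answer forces its first component to
    be [y]. *)
Theorem compute_correct P q c y :
  holds P q (cpair c y) ->
  (forall y', holds P q (cpair c y') -> y' = y) ->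
  eval (compute P q) [c] y.
Proof.
  intros Hy Hu.
  assert (He : forall w, eval (cmp (etest P q)) [w; c] (den (etest P q) [w; c])).
  { intros w. apply eval_cmp. simpl. repeat split; try lia; auto using bnd_estep, bnd_econst. }
  assert (Hd : forall w, den (etest P q) [w; c] =
     psnd (Nat.iter (pfst (psnd w)) (stepf P)
       (cpair (psnd (psnd w)) (push q (cpair c (pfst w)) 0)))).
  { intros w. cbn [etest den nth]. rewrite den_econst. reflexivity. }
  destruct (stepf_complete P q _ Hy 0 0) as (n & w & E).
  destruct (least_witness (fun w => den (etest P q) [w; c] =? 0) (cpair y (cpair n w)))
    as (m & Hm & Hl).
  { rewrite Hd, !psnd_cpair, !pfst_cpair, E, psnd_cpair. apply Nat.eqb_refl. }
  apply Nat.eqb_eq in Hm.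
  eapply eval_comp1.
  - apply e_min with (n := m).
    + rewrite <- Hm. apply He.
    + intros k Hk. specialize (Hl k Hk). apply Nat.eqb_neq in Hl.
      specialize (He k). destruct (den (etest P q) [k; c]) as [|j]; [lia|]. exists j; exact He.
  - replace y with (pfst m); [apply eval_mfst|].
    apply Hu. rewrite Hd in Hm.
    assert (A : all_hold P (psnd (cpair (psnd (psnd m)) (push q (cpair c (pfst m)) 0)))).
    { apply (stepf_sound P (pfst (psnd m))). rewrite Hm. constructor. }
    rewrite psnd_cpair in A. now apply all_hold_push in A.
Qed.

(** * Confluence of beta and beta-eta reduction *)

Definition upr (f : nat -> nat) (i : nat) : nat := match i with 0 => 0 | S i => S (f i) end.

Fixpoint ren (f : nat -> nat) (t : lterm) : lterm :=
  match t with
  | LV i => LV (f i)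
  | LLam b => LLam (ren (upr f) b)
  | LApp a b => LApp (ren f a) (ren f b)
  end.

Definition ups (s : nat -> lterm) (i : nat) : lterm :=
  match i with 0 => LV 0 | S i => ren S (s i) end.

(** Simultaneous substitutions compose pointwise, which the single-index [subst k] does not;
    [subst_0] and [liftn_1_0] translate the given reduction rules. *)
Fixpoint inst (s : nat -> lterm) (t : lterm) : lterm :=
  match t with
  | LV i => s i
  | LLam b => LLam (inst (ups s) b)
  | LApp a b => LApp (inst s a) (inst s b)
  end.

Definition scons (u : lterm) (s : nat -> lterm) (i : nat) : lterm :=
  match i with 0 => u | S i => s i end.

Lemma upr_ext f g : (forall i, f i = g i) -> forall i, upr f i = upr g i.
Proof. intros H [|i]; simpl; auto. Qed.

Lemma ren_ext t : forall f g, (forall i, f i = g i) -> ren f t = ren g t.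
Proof. induction t; simpl; intros; f_equal; auto using upr_ext. Qed.

Lemma ups_ext s s' : (forall i, s i = s' i) -> forall i, ups s i = ups s' i.
Proof. intros H [|i]; simpl; congruence. Qed.

Lemma inst_ext t : forall s s', (forall i, s i = s' i) -> inst s t = inst s' t.
Proof. induction t; simpl; intros; f_equal; auto using ups_ext. Qed.

Lemma inst_LV t : forall s, (forall i, s i = LV i) -> inst s t = t.
Proof.
  induction t; simpl; intros; f_equal; auto.
  apply IHt. intros [|i]; simpl; auto. now rewrite H.
Qed.

Lemma ren_as_inst t : forall f, ren f t = inst (fun i => LV (f i)) t.
Proof.
  induction t; simpl; intros; f_equal; auto.
  rewrite IHt. apply inst_ext. intros [|i]; reflexivity.
Qed.

Lemma inst_ren t : forall s f, inst s (ren f t) = inst (fun i => s (f i)) t.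
Proof.
  induction t; simpl; intros; f_equal; auto.
  rewrite IHt. apply inst_ext. intros [|i]; reflexivity.
Qed.

Lemma ren_ren t f g : ren f (ren g t) = ren (fun i => f (g i)) t.
Proof. rewrite (ren_as_inst (ren g t)), inst_ren. symmetry. apply ren_as_inst. Qed.

Lemma ren_id t f : (forall i, f i = i) -> ren f t = t.
Proof. intros H. rewrite ren_as_inst. apply inst_LV. intros; now rewrite H. Qed.

Lemma ren_inst t : forall f s, ren f (inst s t) = inst (fun i => ren f (s i)) t.
Proof.
  induction t; simpl; intros; f_equal; auto.
  rewrite IHt. apply inst_ext. intros [|i]; simpl; auto.
  rewrite !ren_ren. now apply ren_ext.
Qed.

Lemma inst_inst t : forall s s', inst s (inst s' t) = inst (fun i => inst s (s' i)) t.
Proof.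
  induction t; simpl; intros; f_equal; auto.
  rewrite IHt. apply inst_ext. intros [|i]; simpl; auto.
  rewrite inst_ren, ren_inst. now apply inst_ext.
Qed.

Definition sb (u b : lterm) : lterm := inst (scons u LV) b.

Lemma inst_sb s u b : inst s (sb u b) = sb (inst s u) (inst (ups s) b).
Proof.
  unfold sb. rewrite !inst_inst. apply inst_ext. intros [|i]; simpl; auto.
  rewrite inst_ren. symmetry. apply inst_LV. reflexivity.
Qed.

Lemma ren_sb f u b : ren f (sb u b) = sb (ren f u) (ren (upr f) b).
Proof.
  rewrite !ren_as_inst, inst_sb. unfold sb. rewrite !inst_inst.
  apply inst_ext. intros [|i]; simpl; auto.
Qed.

Lemma sb_ren_S u t : sb u (ren S t) = t.
Proof. unfold sb. rewrite inst_ren. apply inst_LV. reflexivity. Qed.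

Lemma sb_0_ren t : sb (LV 0) (ren (upr S) t) = t.
Proof. unfold sb. rewrite inst_ren. apply inst_LV. intros [|i]; reflexivity. Qed.

Lemma liftn_ren n t : forall k, liftn n k t = ren (fun i => if i <? k then i else i + n) t.
Proof.
  induction t; intros k; simpl.
  - destruct (n0 <? k); reflexivity.
  - rewrite IHt. f_equal. apply ren_ext. intros [|i]; simpl; auto.
    change (S i <? S k) with (i <? k). destruct (i <? k); reflexivity.
  - now rewrite IHt1, IHt2.
Qed.

Lemma liftn_1_0 t : liftn 1 0 t = ren S t.
Proof. rewrite liftn_ren. apply ren_ext. intros; simpl; lia. Qed.

Lemma subst_inst u t : forall k, subst k u t =
  inst (fun i => if i <? k then LV i else if i =? k then liftn k 0 u else LV (pred i)) t.
Proof.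
  induction t; intros k; simpl; [reflexivity| |now rewrite IHt1, IHt2].
  rewrite IHt. f_equal. apply inst_ext. intros [|i]; simpl; auto.
  change (S i <? S k) with (i <? k).
  destruct (Nat.ltb_spec i k); auto. destruct (Nat.eqb_spec i k); simpl.
  - rewrite !liftn_ren, ren_ren. apply ren_ext. intros j; simpl. lia.
  - f_equal. lia.
Qed.

Lemma subst_0 u t : subst 0 u t = sb u t.
Proof.
  rewrite subst_inst. apply inst_ext. intros [|i]; simpl; auto.
  rewrite liftn_ren. apply ren_id. intros; simpl; lia.
Qed.

(* [step b e]: one contraction, of beta-redexes if [b] and of eta-redexes if [e]. *)
Inductive step (b e : bool) : lterm -> lterm -> Prop :=
| s_beta t u : b = true -> step b e (LApp (LLam t) u) (sb u t)
| s_eta t : e = true -> step b e (LLam (LApp (ren S t) (LV 0))) t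
| s_lam t t' : step b e t t' -> step b e (LLam t) (LLam t')
| s_appl t t' u : step b e t t' -> step b e (LApp t u) (LApp t' u)
| s_appr t u u' : step b e u u' -> step b e (LApp t u) (LApp t u').

Lemma beta_step_iff t t' : beta_step t t' <-> step true false t t'.
Proof.
  split; induction 1; try (constructor; auto; fail).
  - rewrite subst_0. now constructor.
  - rewrite <- subst_0. constructor.
  - discriminate.
Qed.

Lemma betaeta_step_iff t t' : betaeta_step t t' <-> step true true t t'.
Proof.
  split; induction 1; try (constructor; auto; fail).
  - rewrite subst_0. now constructor.
  - rewrite liftn_1_0. now constructor.
  - rewrite <- subst_0. constructor.
  - rewrite <- liftn_1_0. constructor.
Qed.

#[local] Notation star := (clos_refl_trans_1n _).

Lemma star_trans {A} (R : A -> A -> Prop) a b c : star R a b -> star R b c -> star R a c.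
Proof. induction 1; auto. intros. econstructor; eauto. Qed.

Lemma star_one {A} (R : A -> A -> Prop) a b : R a b -> star R a b.
Proof. intros. econstructor; [eassumption|constructor]. Qed.

Lemma star_map {A B} (R : A -> A -> Prop) (Q : B -> B -> Prop) f :
  (forall a b, R a b -> star Q (f a) (f b)) -> forall a b, star R a b -> star Q (f a) (f b).
Proof. intros H; induction 1; [constructor|]. eapply star_trans; eauto. Qed.

Lemma star_sub {A} (R Q : A -> A -> Prop) :
  (forall a b, R a b -> star Q a b) -> forall a b, star R a b -> star Q a b.
Proof. intros H. apply (star_map R Q (fun x => x)), H. Qed.

Definition commute {A} (R Q : A -> A -> Prop) : Prop :=
  forall a b c, R a b -> Q a c -> exists d, Q b d /\ R c d.

Lemma commute_sym {A} (R Q : A -> A -> Prop) : commute R Q -> commute Q R.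
Proof. intros H a b c H1 H2. destruct (H a c b H2 H1) as (d & ? & ?). eauto. Qed.

Lemma commute_star_r {A} (R Q : A -> A -> Prop) : commute R Q -> commute R (star Q).
Proof.
  intros H a b c HR HQ. revert b HR. induction HQ as [a|a a' c Ha _ IH]; intros b HR.
  - exists b. split; [constructor|exact HR].
  - destruct (H _ _ _ HR Ha) as (d & H1 & H2). destruct (IH _ H2) as (d' & H3 & H4).
    exists d'. split; [econstructor; eauto|exact H4].
Qed.

Lemma commute_star {A} (R Q : A -> A -> Prop) : commute R Q -> commute (star R) (star Q).
Proof.
  intros H. apply commute_sym, commute_star_r, commute_sym, commute_star_r, H.
Qed.

(** Hindley's asymmetric criterion: [Q]-steps may be multiplied, the [R]-step may not. It fits [R]
    beta and [Q] eta, since contracting a beta-redex can copy an eta-redex but not conversely. *)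
Lemma commute_strip {A} (R Q : A -> A -> Prop) :
  (forall a b c, R a b -> Q a c -> exists d, star Q b d /\ (c = d \/ R c d)) ->
  commute (star R) (star Q).
Proof.
  intros H.
  assert (H1 : forall a c, star Q a c -> forall b, R a b ->
            exists d, star Q b d /\ (c = d \/ R c d)).
  { induction 1 as [a|a a' c Ha Hc IH]; intros b Hb.
    - exists b. split; [constructor|auto].
    - destruct (H _ _ _ Hb Ha) as (d & H2 & [->|H3]).
      + exists c. split; auto. eapply star_trans; eauto.
      + destruct (IH _ H3) as (d' & H4 & H5). exists d'. split; auto.
        eapply star_trans; eauto. }
  intros a b c Hb Hc. revert c Hc. induction Hb as [a|a a' b Ha _ IH]; intros c Hc.
  - exists c. split; [auto|constructor].
  - destruct (H1 _ _ Hc _ Ha) as (d & H2 & [->|H3]).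
    + apply IH; auto.
    + destruct (IH _ H2) as (d' & H4 & H5). exists d'. split; auto. econstructor; eauto.
Qed.

Lemma star_lam b e t t' : star (step b e) t t' -> star (step b e) (LLam t) (LLam t').
Proof. apply (star_map _ _ LLam). intros. apply star_one. now constructor. Qed.

Lemma star_app b e t t' u u' : star (step b e) t t' -> star (step b e) u u' ->
  star (step b e) (LApp t u) (LApp t' u').
Proof.
  intros H1 H2. apply star_trans with (LApp t' u).
  - revert H1. apply (star_map _ _ (fun x => LApp x u)). intros. apply star_one. now constructor.
  - revert H2. apply (star_map _ _ (LApp t')). intros. apply star_one. now constructor.
Qed.

Lemma inst_ups_ren_S s t : inst (ups s) (ren S t) = ren S (inst s t).
Proof. rewrite inst_ren, ren_inst. now apply inst_ext. Qed.

Lemma step_inst b e t t' : step b e t t' -> forall s, step b e (inst s t) (inst s t').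
Proof.
  induction 1; intros s; simpl; try (constructor; auto; fail).
  - rewrite inst_sb. now constructor.
  - rewrite inst_ups_ren_S. now constructor.
Qed.

Lemma step_ren b e t t' f : step b e t t' -> step b e (ren f t) (ren f t').
Proof. rewrite !ren_as_inst. intros; now apply step_inst. Qed.

Lemma star_inst_pt b e t : forall s s', (forall i, star (step b e) (s i) (s' i)) ->
  star (step b e) (inst s t) (inst s' t).
Proof.
  induction t; simpl; intros s s' H; auto using star_app.
  apply star_lam, IHt. intros [|i]; simpl; [constructor|].
  apply (star_map (step b e) _ (ren S)); auto. intros; now apply star_one, step_ren.
Qed.

Lemma star_inst b e t t' s : star (step b e) t t' -> star (step b e) (inst s t) (inst s t').
Proof. apply (star_map _ _ (inst s)). intros. now apply star_one, step_inst. Qed.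

Fixpoint free (k : nat) (t : lterm) : Prop :=
  match t with
  | LV i => i = k
  | LLam b => free (S k) b
  | LApp a b => free k a \/ free k b
  end.

Lemma free_dec t : forall k, {free k t} + {~ free k t}.
Proof.
  induction t; intros k; simpl; auto.
  - apply Nat.eq_dec.
  - destruct (IHt1 k), (IHt2 k); tauto.
Qed.

Lemma free_ren t : forall k f, free k t -> free (f k) (ren f t).
Proof.
  induction t; simpl; intros k f H.
  - congruence.
  - apply (IHt (S k) (upr f)); auto.
  - destruct H; auto.
Qed.

Lemma free_ren_inv t : forall k f, free k (ren f t) -> exists i, k = f i /\ free i t.
Proof.
  induction t; simpl; intros k f H; [eauto| |].
  - destruct (IHt _ _ H) as ([|i] & E & Hi); simpl in E; [discriminate|].
    injection E as E. eauto.
  - destruct H as [H|H]; [destruct (IHt1 _ _ H)|destruct (IHt2 _ _ H)]; firstorder.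
Qed.

Lemma ren_free_ext t : forall f g, (forall i, free i t -> f i = g i) -> ren f t = ren g t.
Proof.
  induction t; simpl; intros f g H; f_equal; auto.
  apply IHt. intros [|i] Hi; simpl; auto.
Qed.

Lemma not_free_0 t : ~ free 0 t -> t = ren S (ren pred t).
Proof.
  intros H. rewrite ren_ren. transitivity (ren (fun i => i) t); [symmetry; now apply ren_id|].
  apply ren_free_ext. intros [|i] Hi; [tauto|reflexivity].
Qed.

Lemma free_0_ren_S t : ~ free 0 (ren S t).
Proof. intros H. apply free_ren_inv in H as (i & E & _). discriminate. Qed.

Lemma ren_S_inj t u : ren S t = ren S u -> t = u.
Proof. intros H. rewrite <- (sb_ren_S (LV 0) t), H. apply sb_ren_S. Qed.

(** The renaming may identify variables. An eta-redex is still reflected, because under a binder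
    [upr f] sends only 0 to 0. [WN_app_var] relies on this generality. *)
Lemma step_ren_inv b e t : forall f x, step b e (ren f t) x ->
  exists t', x = ren f t' /\ step b e t t'.
Proof.
  induction t as [i|t IH|t1 IH1 t2 IH2]; simpl; intros f x H; inversion H; subst.
  - destruct t as [|?|q [j| |]]; try discriminate. simpl in *.
    destruct j; [|discriminate]. injection H0 as Hq.
    assert (Hn : ~ free 0 q).
    { intros F. apply (free_ren _ _ (upr f)) in F. rewrite <- Hq in F. revert F. apply free_0_ren_S. }
    apply not_free_0 in Hn. rewrite Hn in Hq |- *.
    exists (ren pred q). split.
    + apply ren_S_inj. rewrite Hq, !ren_ren. now apply ren_ext.
    + now constructor.
  - apply IH in H1 as (t'' & -> & ?). exists (LLam t''). split; [auto|now constructor].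
  - destruct t1; try discriminate. injection H0 as ->.
    exists (sb t2 t1). rewrite ren_sb. split; auto. now constructor.
  - apply IH1 in H3 as (t'' & -> & ?). exists (LApp t'' t2). split; [auto|now constructor].
  - apply IH2 in H3 as (t'' & -> & ?). exists (LApp t1 t''). split; [auto|now constructor].
Qed.

(** * Commutation of beta and eta reductions *)

Inductive par : lterm -> lterm -> Prop :=
| p_var i : par (LV i) (LV i)
| p_lam t t' : par t t' -> par (LLam t) (LLam t')
| p_app t t' u u' : par t t' -> par u u' -> par (LApp t u) (LApp t' u')
| p_beta t t' u u' : par t t' -> par u u' -> par (LApp (LLam t) u) (sb u' t').

Lemma par_refl t : par t t.
Proof. induction t; constructor; auto. Qed.

Lemma par_ren t t' : par t t' -> forall f, par (ren f t) (ren f t').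
Proof.
  induction 1; intros f; simpl; try (constructor; auto; fail).
  rewrite ren_sb. now constructor.
Qed.

Lemma par_inst t t' : par t t' -> forall s s', (forall i, par (s i) (s' i)) ->
  par (inst s t) (inst s' t').
Proof.
  assert (U : forall s s', (forall i, par (s i) (s' i)) -> forall i, par (ups s i) (ups s' i)).
  { intros s s' H [|i]; simpl; [constructor|]. now apply par_ren. }
  induction 1; intros s s' Hs; simpl; try (constructor; auto; fail); auto.
  rewrite inst_sb. constructor; auto.
Qed.

Lemma par_sb t t' u u' : par t t' -> par u u' -> par (sb u t) (sb u' t').
Proof. intros. apply par_inst; auto. intros [|i]; simpl; auto using par_refl. Qed.

Fixpoint dev (t : lterm) : lterm :=
  match t with
  | LV i => LV i
  | LLam b => LLam (dev b)
  | LApp a u =>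
      match a with
      | LLam b => sb (dev u) (dev b)
      | _ => LApp (dev a) (dev u)
      end
  end.

(** Takahashi's argument: every parallel reduct of [t] reaches the complete development [dev t],
    which therefore closes all diamonds at [t]. *)
Lemma par_dev t : forall t', par t t' -> par t' (dev t).
Proof.
  induction t; intros t' H; inversion H; subst; simpl; try (constructor; auto; fail).
  - destruct t1; try (constructor; auto; fail).
    inversion H2; subst. constructor; auto.
    specialize (IHt1 _ H2). simpl in IHt1. now inversion IHt1.
  - apply par_sb; auto.
    specialize (IHt1 _ (p_lam _ _ H2)). simpl in IHt1. now inversion IHt1.
Qed.

Lemma commute_beta : commute (star (step true false)) (star (step true false)).
Proof.
  assert (H : commute (star par) (star par)).
  { apply commute_star. intros a b c H1 H2. exists (dev a). split; now apply par_dev. }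
  assert (E1 : forall a b, star par a b -> star (step true false) a b).
  { apply star_sub. induction 1; auto using star_lam, star_app; [constructor|].
    eapply star_trans; [apply star_app; [apply star_lam|]; eassumption|].
    apply star_one. now constructor. }
  assert (E2 : forall a b, star (step true false) a b -> star par a b).
  { apply star_sub. intros a b Hab. apply star_one.
    induction Hab; try discriminate; constructor; auto using par_refl. }
  intros a b c H1 H2. destruct (H a b c) as (d & ? & ?); auto. exists d; auto.
Qed.

(** Eta-contraction never copies a redex, so two diverging steps meet again after at most one step
    on each side. *)
Lemma commute_eta : commute (star (step false true)) (star (step false true)).
Proof.
  apply commute_strip. intros a b c H. revert c.
  assert (R : forall a b, step false true a b -> forall c, step false true a c ->
     exists d, (b = d \/ step false true b d) /\ (c = d \/ step false true c d)).
  { clear. induction 1 as [| | t t' H IH | t t' u H IH | t u u' H IH]; intros c Hc; try discriminate.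
    - inversion Hc; subst.
      + match goal with E : ren S _ = ren S _ |- _ => apply ren_S_inj in E as -> end. eauto.
      + match goal with Hs : step _ _ (LApp _ (LV 0)) _ |- _ => inversion Hs end; subst; try discriminate.
        * match goal with Hs : step _ _ (ren S _) _ |- _ => apply step_ren_inv in Hs as (t'' & -> & Hs) end. exists t''. split; auto.
          right. now constructor.
        * match goal with Hs : step _ _ (LV 0) _ |- _ => inversion Hs end.
    - inversion Hc; subst.
      + inversion H; subst; try discriminate.
        * match goal with Hs : step _ _ (ren S _) _ |- _ => apply step_ren_inv in Hs as (t'' & -> & Hs) end. exists t''. split; auto.
          right. now constructor.
        * match goal with Hs : step _ _ (LV 0) _ |- _ => inversion Hs end.
      + edestruct IH as (d & D1 & D2); [eassumption|]. exists (LLam d).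
        split; [destruct D1|destruct D2]; subst; auto; right; now constructor.
    - inversion Hc; subst; try discriminate.
      + edestruct IH as (d & D1 & D2); [eassumption|]. exists (LApp d u).
        split; [destruct D1|destruct D2]; subst; auto; right; now constructor.
      + exists (LApp t' u'). split; right; now constructor.
    - inversion Hc; subst; try discriminate.
      + exists (LApp t' u'). split; right; now constructor.
      + edestruct IH as (d & D1 & D2); [eassumption|]. exists (LApp t d).
        split; [destruct D1|destruct D2]; subst; auto; right; now constructor. }
  intros c Hc. destruct (R _ _ H _ Hc) as (d & [->|D1] & D2).
  - exists d. split; [constructor|auto].
  - exists d. split; [now apply star_one|auto].
Qed.

Lemma commute_beta_eta : commute (star (step true false)) (star (step false true)).
Proof.
  apply commute_strip. intros a b c H. revert c.
  induction H as [t u _| | t t' H IH | t t' u H IH | t u u' H IH]; intros c Hc; try discriminate.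
  - inversion Hc; subst; try discriminate.
    + inversion H2; subst.
      (* First critical pair: the function part of the beta-redex is itself an eta-redex, and both
         contractions give [LApp t' u]. *)
      * exists (LApp t' u). split; auto. unfold sb. simpl. fold (sb u (ren S t')).
        rewrite sb_ren_S. constructor.
      * exists (sb u t'0). split; [now apply star_inst, star_one|]. right. now constructor.
    (* The argument may occur many times in the body, so one eta-step becomes several. *)
    + exists (sb u' t). split; [|right; now constructor].
      apply star_inst_pt. intros [|i]; simpl; [now apply star_one|constructor].
  - inversion Hc; subst.
    + inversion H; subst; try discriminate.
      (* Second critical pair: the eta-redex abstracts a beta-redex applied to [LV 0]; both
         contractions give [LLam c]. *)
      * destruct c; try discriminate. injection H0 as ->.
        exists (LLam c). split; auto. rewrite sb_0_ren. constructor.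
      * match goal with Hs : step _ _ (ren S _) _ |- _ => apply step_ren_inv in Hs as (t'' & -> & Hs) end. exists t''. split; auto.
        apply star_one. now constructor.
      * match goal with Hs : step _ _ (LV 0) _ |- _ => inversion Hs end.
    + edestruct IH as (d & D1 & D2); [eassumption|]. exists (LLam d). split; [now apply star_lam|].
      destruct D2; subst; auto; right; now constructor.
  - inversion Hc; subst; try discriminate.
    + edestruct IH as (d & D1 & D2); [eassumption|]. exists (LApp d u).
      split; [apply star_app; auto; constructor|].
      destruct D2; subst; auto; right; now constructor.
    + exists (LApp t' u'). split; [apply star_one|right]; now constructor.
  - inversion Hc; subst; try discriminate.
    + exists (LApp t' u'). split; [apply star_one|right]; now constructor.
    + edestruct IH as (d & D1 & D2); [eassumption|]. exists (LApp t d).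
      split; [apply star_app; auto; constructor|].
      destruct D2; subst; auto; right; now constructor.
Qed.

(** Hindley-Rosen: a single [T]-step is a whole beta-reduction or a whole eta-reduction, and the
    three commutations give [T] the diamond property. *)
Theorem confluence e : commute (star (step true e)) (star (step true e)).
Proof.
  destruct e; [|exact commute_beta].
  set (T := fun a b => star (step true false) a b \/ star (step false true) a b).
  assert (H : commute (star T) (star T)).
  { apply commute_star. intros a b c [H1|H1] [H2|H2].
    - destruct (commute_beta _ _ _ H1 H2) as (d & ? & ?). exists d; split; now left.
    - destruct (commute_beta_eta _ _ _ H1 H2) as (d & ? & ?). exists d; split; [now right|now left].
    - destruct (commute_sym _ _ commute_beta_eta _ _ _ H1 H2) as (d & ? & ?).
      exists d; split; [now left|now right].
    - destruct (commute_eta _ _ _ H1 H2) as (d & ? & ?). exists d; split; now right. }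
  assert (E1 : forall a b, star T a b -> star (step true true) a b).
  { apply star_sub. intros a b [Hab|Hab]; revert Hab; apply star_sub; intros a' b' Hs;
      apply star_one; induction Hs; try discriminate; constructor; auto. }
  assert (E2 : forall a b, star (step true true) a b -> star T a b).
  { apply star_sub. intros a b Hab. apply star_one.
    induction Hab as [| |? ? ? IH|? ? ? ? IH|? ? ? ? IH].
    - left. apply star_one. now constructor.
    - right. apply star_one. now constructor.
    - destruct IH; [left|right]; now apply star_lam.
    - destruct IH; [left|right]; apply star_app; auto; constructor.
    - destruct IH; [left|right]; apply star_app; auto; constructor. }
  intros a b c H1 H2. destruct (H a b c) as (d & ? & ?); auto. exists d; auto.
Qed.

#[local] Notation conv e := (clos_refl_sym_trans lterm (step true e)).

Lemma convR_Beta t u : convR Beta t u <-> conv false t u.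
Proof.
  simpl; split; induction 1; eauto using clos_refl_sym_trans;
  constructor; now apply beta_step_iff.
Qed.

Lemma convR_BetaEta t u : convR BetaEta t u <-> conv true t u.
Proof.
  simpl; split; induction 1; eauto using clos_refl_sym_trans;
  constructor; now apply betaeta_step_iff.
Qed.

Lemma star_conv e t u : star (step true e) t u -> conv e t u.
Proof.
  induction 1; [apply rst_refl|]. eapply rst_trans; [apply rst_step|]; eauto.
Qed.

Lemma church_rosser e t u : conv e t u ->
  exists v, star (step true e) t v /\ star (step true e) u v.
Proof.
  induction 1 as [t u H|t|t u _ (v & ? & ?)|t u w _ (v1 & H1 & H2) _ (v2 & H3 & H4)].
  - exists u. split; [now apply star_one|constructor].
  - exists t. split; constructor.
  - eauto.
  - destruct (confluence e _ _ _ H2 H3) as (v & ? & ?).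
    exists v. split; eapply star_trans; eauto.
Qed.

Definition normal (e : bool) (t : lterm) : Prop := forall t', ~ step true e t t'.

Lemma normal_star e t u : normal e t -> star (step true e) t u -> u = t.
Proof. intros H Hs. inversion Hs; subst; auto. now apply H in H0. Qed.

Lemma conv_normal e t n : normal e n -> conv e t n -> star (step true e) t n.
Proof.
  intros Hn H. apply church_rosser in H as (v & H1 & H2).
  now apply normal_star in H2 as ->.
Qed.

Lemma normal_unique e m n : normal e m -> normal e n -> conv e m n -> m = n.
Proof.
  intros Hm Hn H. apply conv_normal in H; auto. apply normal_star in H; auto.
Qed.

Lemma conv_inst e t u s : conv e t u -> conv e (inst s t) (inst s u).
Proof.
  induction 1; eauto using clos_refl_sym_trans, step_inst.
Qed.

Lemma conv_app e t t' u u' : conv e t t' -> conv e u u' -> conv e (LApp t u) (LApp t' u').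
Proof.
  intros H1 H2. apply rst_trans with (LApp t' u).
  - clear H2. induction H1; eauto using clos_refl_sym_trans, step.
  - clear H1. induction H2; eauto using clos_refl_sym_trans, step.
Qed.

Lemma conv_beta e t u : conv e (LApp (LLam t) u) (sb u t).
Proof. apply rst_step. now constructor. Qed.

(** * Inversion of subtyping *)

Fixpoint comps (s : ty) : list ty :=
  match s with TCap a b => comps a ++ comps b | _ => [s] end.

Lemma leT_wf th s t : leT th s t -> wf_ty th s /\ wf_ty th t.
Proof. induction 1; simpl in *; tauto. Qed.

Lemma leT_cap th s a b : leT th s (TCap a b) <-> leT th s a /\ leT th s b.
Proof.
  split.
  - intros H. destruct (leT_wf _ _ _ H) as [_ [Ha Hb]].
    split; eapply le_trans; eauto; now constructor.
  - intros []. now constructor.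
Qed.

(** No rule creates an atom on the right, nor an arrow when [th_arr] is false; such a component is
    handed down from the left-hand side unchanged, and transitivity merely composes inclusions. *)
Lemma leT_comps th s t : leT th s t -> forall u, In u (comps t) ->
  match u with TAtom _ => True | TArr _ _ => th_arr th = false | _ => False end ->
  In u (comps s).
Proof.
  induction 1 as [| | |r s t H1 IH1 H2 IH2| | |? Ho Ha|? ? ? Ha|? ? ? ? Ha];
    intros u Hu Hl; simpl in *; auto using in_or_app.
  - apply in_app_or in Hu as [|]; auto.
  - destruct Hu as [<-|[]]. contradiction.
  - destruct Hu as [<-|[]]. congruence.
  - destruct Hu as [<-|[]]. congruence.
  - destruct Hu as [<-|[]]. congruence.
Qed.

Lemma leT_in_comps th s : wf_ty th s -> forall u, In u (comps s) -> leT th s u.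
Proof.
  induction s; simpl; intros Hw u Hu;
    try (destruct Hu as [<-|[]]; now constructor).
  apply in_app_or in Hu as [Hu|Hu]; [eapply le_trans; [|apply IHs1]|eapply le_trans; [|apply IHs2]];
    try tauto; now constructor.
Qed.

Lemma wf_comps th s : wf_ty th s -> forall u, In u (comps s) -> wf_ty th u.
Proof. intros Hw u Hu. eapply leT_wf, leT_in_comps; eauto. Qed.

Inductive capin (L : ty -> Prop) : ty -> Prop :=
| ci_in s : L s -> capin L s
| ci_cap s t : capin L s -> capin L t -> capin L (TCap s t).

(* "Some finite intersection of members of [L] is below [t]", the empty intersection
   being [TOm] when it is available. *)
Definition LE (th : theory) (L : ty -> Prop) (t : ty) : Prop :=
  (th_om th = true /\ leT th TOm t) \/ exists s, capin L s /\ leT th s t.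

Lemma capin_mono (L L' : ty -> Prop) s : (forall x, L x -> L' x) -> capin L s -> capin L' s.
Proof. intros H; induction 1; [apply ci_in|apply ci_cap]; auto. Qed.

Lemma LE_mono th (L L' : ty -> Prop) t : (forall x, L x -> L' x) -> LE th L t -> LE th L' t.
Proof. intros H [|(s & ? & ?)]; [now left|right; eauto using capin_mono]. Qed.

Lemma LE_in th (L : ty -> Prop) t : wf_ty th t -> L t -> LE th L t.
Proof. intros Hw H. right. exists t. split; now constructor. Qed.

Lemma LE_le th L s t : LE th L s -> leT th s t -> LE th L t.
Proof. intros [[]|(u & ? & ?)] Hst; [left|right]; eauto using le_trans. Qed.

Lemma LE_cap th L s t : LE th L s -> LE th L t -> LE th L (TCap s t).
Proof.
  intros [[Ho Hs]|(u & Hu & Hs)] [[Ho' Ht]|(v & Hv & Ht)].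
  - left. auto using le_glb.
  (* The witness for [t] lies below [TOm], hence also below [s]. *)
  - right. exists v. split; auto. apply le_glb; auto.
    eapply le_trans; [|exact Hs]. apply le_omtop; auto. now apply leT_wf in Ht.
  - right. exists u. split; auto. apply le_glb; auto.
    eapply le_trans; [|exact Ht]. apply le_omtop; auto. now apply leT_wf in Hs.
  - right. exists (TCap u v). split; [now apply ci_cap|].
    destruct (leT_wf _ _ _ Hs), (leT_wf _ _ _ Ht).
    apply le_glb; eapply le_trans; eauto; now constructor.
Qed.

Lemma LE_cut th (L L' : ty -> Prop) t : (forall x, L' x -> LE th L x) -> LE th L' t -> LE th L t.
Proof.
  intros H [?|(s & Hs & Hst)]; [now left|].
  apply LE_le with s; auto. clear Hst. induction Hs; auto using LE_cap.
Qed.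

Definition targets (th : theory) (s a b : ty) : Prop :=
  exists a', In (TArr a' b) (comps s) /\ leT th a a'.

(** The classical inversion property of this subtyping relation, stated for every arrow component of
    [t] at once so that the induction passes through intersections and transitivity. *)
Lemma leT_arr_inv th s t : leT th s t -> forall a b, In (TArr a b) (comps t) ->
  th_arr th = true -> LE th (targets th s a) b.
Proof.
  induction 1 as [s Hw|s t Hs Ht|s t Hs Ht|r s t H1 IH1 H2 IH2|s t r H1 IH1 H2 IH2
                 |s Ho Hs|s Ho Ha Hs|s t r Ha Hs Ht Hr|s1 s2 t1 t2 Ha H1 IH1 H2 IH2];
    intros a b Hin Harr; simpl in Hin.
  - pose proof (wf_comps _ _ Hw _ Hin) as [Wa Wb].
    apply LE_in; auto. exists a. split; auto. now constructor.
  - pose proof (wf_comps _ _ Hs _ Hin) as [Wa Wb].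
    apply LE_in; auto. exists a. split; [simpl; auto using in_or_app|now constructor].
  - pose proof (wf_comps _ _ Ht _ Hin) as [Wa Wb].
    apply LE_in; auto. exists a. split; [simpl; auto using in_or_app|now constructor].
  - apply in_app_or in Hin as [|]; auto.
  (* A target [x] found in the middle type comes from a source [a'] above [a]. It is covered by the
     targets of [s] at [a'], and these are targets at [a] as well. *)
  - apply LE_cut with (targets th t a); auto.
    intros x (a' & Hin' & Hle). apply LE_mono with (targets th s a'); auto.
    intros y (a'' & Hin'' & Hle'). exists a''. eauto using le_trans.
  - destruct Hin as [|[]]. discriminate.
  - destruct Hin as [[= <- <-]|[]]. left. split; auto. now constructor.
  - destruct Hin as [[= <- <-]|[]]. right. exists (TCap t r).
    split; [|apply le_refl; simpl; auto].
    apply ci_cap; apply ci_in; exists s; simpl; split; auto using le_refl.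
  - destruct Hin as [[= <- <-]|[]]. right. exists t1. split; auto.
    constructor. exists s1. simpl; auto.
Qed.

(** The rule for arrows into an intersection merges the arrows [TArr a y]; when the intersection is
    empty, [TOm] below [TArr a TOm] takes its place. *)
Lemma LE_arr_intro th L a b : th_arr th = true -> wf_ty th a ->
  LE th (fun y => LE th L (TArr a y)) b -> LE th L (TArr a b).
Proof.
  intros Ha Wa [[Ho Hb]|(s & Hs & Hb)].
  - left. split; auto. apply le_trans with (TArr a TOm); [now constructor|].
    apply le_arr; auto using le_refl.
  - apply LE_le with (TArr a s); [|apply le_arr; auto using le_refl].
    clear Hb. induction Hs as [|s t Hs IHs Ht IHt]; auto.
    assert (W : forall x, LE th L (TArr a x) -> wf_ty th x).
    { intros x [[_ Hx]|(u & _ & Hx)]; apply leT_wf in Hx; simpl in Hx; tauto. }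
    eapply LE_le; [exact (LE_cap _ _ _ _ IHs IHt)|]. apply le_arrcap; auto.
Qed.

Definition mems (L : list ty) (t : ty) : Prop := exists x, In x L /\ In t (comps x).

Lemma capin_comps L s u : capin (fun x => In x L) s -> In u (comps s) -> mems L u.
Proof.
  induction 1; simpl; intros Hu; [exists s; auto|].
  apply in_app_or in Hu as [|]; auto.
Qed.

(** The targets may be several or none, so the algorithm compares a list of types, and not a single
    type, with the right-hand side. *)
Definition targetsL (th : theory) (L : list ty) (a b : ty) : Prop :=
  exists a', mems L (TArr a' b) /\ leT th a a'.

Section ListLE.
Variables (th : theory) (L : list ty).
Hypothesis HL : Forall (wf_ty th) L.

Definition LEl := LE th (fun x => In x L).

Lemma LEl_mem t : wf_ty th t -> mems L t -> LEl t.
Proof.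
  intros Wt (x & Hx & Ht). right. exists x. split; [now constructor|].
  apply leT_in_comps; auto. rewrite Forall_forall in HL. auto.
Qed.

Lemma LEl_leaf t : wf_ty th t ->
  match t with TAtom _ => True | TArr _ _ => th_arr th = false | _ => False end ->
  LEl t <-> mems L t.
Proof.
  intros Wt Ht. split; [|now apply LEl_mem].
  assert (Hc : In t (comps t)) by (destruct t; simpl; auto; contradiction).
  intros [[_ H]|(s & Hs & H)]; pose proof (leT_comps _ _ _ H t Hc Ht) as Hm.
  - destruct Hm as [<-|[]]. contradiction.
  - eapply capin_comps; eauto.
Qed.

Lemma LEl_cap a b : LEl (TCap a b) <-> LEl a /\ LEl b.
Proof.
  split; [|intros []; now apply LE_cap].
  intros [[Ho H]|(s & Hs & H)]; apply leT_cap in H as []; split;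
    ((left; now split) || (right; eauto)).
Qed.

Lemma LEl_om : th_om th = true -> LEl TOm.
Proof. intros Ho. left. split; auto. now apply le_refl. Qed.

Lemma LEl_arr a b : th_arr th = true -> wf_ty th a -> wf_ty th b ->
  LEl (TArr a b) <-> LE th (targetsL th L a) b.
Proof.
  intros Ha Wa Wb. split.
  - intros [[Ho H]|(s & Hs & H)]; pose proof (leT_arr_inv _ _ _ H a b (or_introl eq_refl) Ha) as G;
      (eapply LE_mono; [|exact G]); intros y (a' & Hin & Hle); exists a'; split; auto.
    + destruct Hin as [|[]]. discriminate.
    + eapply capin_comps; eauto.
  - intros H. apply LE_arr_intro; auto. eapply LE_mono; [|exact H].
    intros y (a' & Hm & Hle).
    assert (W : wf_ty th (TArr a' y)).
    { destruct Hm as (x & Hx & Hc). rewrite Forall_forall in HL. apply (wf_comps th x); auto. }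
    apply LE_le with (TArr a' y); [now apply LEl_mem|].
    apply le_arr; auto. apply le_refl, W.
Qed.
End ListLE.

Lemma LEl_single th s t : wf_ty th s -> LEl th [s] t <-> leT th s t.
Proof.
  intros Ws. split.
  - intros [[Ho H]|(u & Hu & H)].
    + eapply le_trans; [|exact H]. now apply le_omtop.
    + eapply le_trans; [|exact H]. clear H.
      induction Hu as [x [<-|[]]|]; [now apply le_refl|now apply le_glb].
  - intros H. right. exists s. split; auto. constructor. now left.
Qed.

(** * Weak normalisation *)

Definition WN (e : bool) (t : lterm) : Prop := exists n, normal e n /\ conv e t n.

Inductive ne (e : bool) : lterm -> Prop :=
| ne_var i : ne e (LV i)
| ne_app a b : ne e a -> normal e b -> ne e (LApp a b).

Lemma ne_normal e t : ne e t -> normal e t.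
Proof.
  induction 1 as [i|a b Ha IH Hb]; intros t' H; inversion H; subst.
  - inversion Ha.
  - eapply IH; eauto.
  - eapply Hb; eauto.
Qed.

(** With eta, abstracting a normal form may create a redex at the root. Its contractum [q] is
    normal: a step of [q] would be, up to renaming, a step inside [n]. *)
Lemma normal_eta_lam e n : normal e n -> exists m, normal e m /\ star (step true e) (LLam n) m.
Proof.
  intros Hn.
  assert (D : (exists q, e = true /\ n = LApp (ren S q) (LV 0)) \/ normal e (LLam n)).
  { assert (C : (exists q, e = true /\ n = LApp (ren S q) (LV 0)) \/
                ~ exists q, e = true /\ n = LApp (ren S q) (LV 0)).
    { destruct e; [|right; intros (? & ? & ?); discriminate].
      destruct n as [| |q [[|i]| |]]; try (right; intros (? & _ & ?); discriminate).
      destruct (free_dec q 0) as [F|F].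
      - right. intros (q' & _ & [= ->]). revert F. apply free_0_ren_S.
      - left. exists (ren pred q). now rewrite <- not_free_0. }
    destruct C as [C|C]; [now left|right].
    intros t H. inversion H; subst; [apply C; eauto|]. eapply Hn; eauto. }
  destruct D as [(q & -> & ->)|D].
  - exists q. split; [|apply star_one; now constructor].
    intros t H. apply (Hn (LApp (ren S t) (LV 0))). apply s_appl. now apply step_ren.
  - exists (LLam n). split; [auto|constructor].
Qed.

Lemma star_ren_inv e f x y : star (step true e) x y -> forall t, x = ren f t ->
  exists t', y = ren f t' /\ star (step true e) t t'.
Proof.
  induction 1 as [x|x y z H _ IH]; intros t ->.
  - exists t. split; [auto|constructor].
  - apply step_ren_inv in H as (t' & -> & H).
    destruct (IH t' eq_refl) as (t'' & -> & ?). exists t''. split; auto. econstructor; eauto.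
Qed.

(** Follow the reduction of [LApp t (LV i)] to its normal form. Either all steps take place in [t],
    or [t] becomes an abstraction that is contracted with a variable; that contraction is only a
    renaming, so the rest of the reduction lifts to the body. *)
Lemma WN_app_var e t i : WN e (LApp t (LV i)) -> WN e t.
Proof.
  intros (n & Hn & H). apply conv_normal in H; auto.
  remember (LApp t (LV i)) as x eqn:Ex. revert t Ex Hn.
  induction H as [x|x y n H Hs IH]; intros t -> Hn.
  - exists t. split; [|apply rst_refl]. intros t' Ht'. apply (Hn (LApp t' (LV i))). now constructor.
  - inversion H; subst.
    + assert (E : sb (LV i) t0 = ren (fun j => match j with 0 => i | S j => j end) t0).
      { rewrite ren_as_inst. apply inst_ext. intros [|j]; reflexivity. }
      destruct (star_ren_inv _ _ _ _ Hs _ E) as (n' & -> & Hs').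
      destruct (normal_eta_lam e n') as (m & Hm & Hs'').
      { intros t' Ht'. eapply Hn, step_ren, Ht'. }
      exists m. split; auto. apply star_conv. eapply star_trans; [|exact Hs'']. now apply star_lam.
    + destruct (IH t' eq_refl Hn) as (m & Hm & Hc). exists m. split; auto.
      eapply rst_trans; [apply rst_step|]; eauto.
    + match goal with Hv : step _ _ (LV _) _ |- _ => inversion Hv end.
Qed.

(* Every set is closed under conversion, as rule (cap-I) requires; this is why the model
   uses weak rather than strong normalisation. *)
Fixpoint interp (e : bool) (s : ty) (t : lterm) : Prop :=
  match s with
  | TAtom _ | TOm => WN e t
  | TArr a b => forall u, interp e a u -> interp e b (LApp t u)
  | TCap a b => interp e a t /\ interp e b t
  end.

Lemma interp_conv e s : forall t u, conv e t u -> interp e s t -> interp e s u.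
Proof.
  assert (W : forall t u, conv e t u -> WN e t -> WN e u).
  { intros t u H (n & Hn & Hc). exists n. split; auto.
    eapply rst_trans; [apply rst_sym|]; eauto. }
  induction s; simpl; intros t u H Ht; eauto.
  - intros v Hv. apply IHs2 with (LApp t v); auto. apply conv_app; auto. apply rst_refl.
  - destruct Ht; eauto.
Qed.

(** The two bounds are proved together: at an arrow, each uses the opposite bound for the domain.
    For the lower bound the argument is first replaced by its normal form, which closure under
    conversion permits. *)
Lemma interp_adequate e s : (forall t, interp e s t -> WN e t) /\ (forall t, ne e t -> interp e s t).
Proof.
  assert (W : forall t, ne e t -> WN e t).
  { intros t H. exists t. split; [now apply ne_normal|apply rst_refl]. }
  induction s as [| |a [IHa1 IHa2] b [IHb1 IHb2]|a [IHa1 IHa2] b [IHb1 IHb2]]; simpl; auto.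
  - split.
    (* The variable 0 need not be fresh for [t]: [WN_app_var] holds for every index. *)
    + intros t H. apply WN_app_var with 0. apply IHb1, H, IHa2. constructor.
    + intros t H u Hu. destruct (IHa1 u Hu) as (n & Hn & Hc).
      apply interp_conv with (LApp t n); [apply conv_app; [apply rst_refl|now apply rst_sym]|].
      apply IHb2. now constructor.
  - split; [intros t []; auto|auto].
Qed.

Lemma interp_le th e s t : th_om th = false -> leT th s t ->
  forall u, interp e s u -> interp e t u.
Proof.
  intros Ho. induction 1; simpl; intros w Hw; try congruence; try tauto; auto.
  split; intros; apply Hw; auto.
Qed.

Definition idx (c : list nat) (x : nat) : nat :=
  match find_idx x c with Some i => i | None => length c + x end.

Lemma idx_cons y c x : idx (y :: c) x = if x =? y then 0 else S (idx c x).
Proof. unfold idx. simpl. destruct (x =? y); auto. destruct (find_idx x c); auto. Qed.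

(** The context only decides which indices the variables receive. As [idx []] is the identity, going
    under a binder [x] amounts to the renaming [idx [x]]. *)
Lemma ess_ren d : forall f c c', (forall x, f (idx c x) = idx c' x) -> ren f (ess c d) = ess c' d.
Proof.
  induction d; simpl; intros f c c' H; auto.
  - specialize (H n). unfold idx in H.
    destruct (find_idx n c), (find_idx n c'); simpl; congruence.
  - f_equal. apply IHd. intros y. rewrite !idx_cons. destruct (y =? n); simpl; auto.
  - f_equal; auto.
Qed.

Lemma ess_single x d : ess [x] d = ren (idx [x]) (essence d).
Proof. symmetry. apply ess_ren. reflexivity. Qed.

(** Fundamental lemma of the model. A free variable named [x] has index [x] in the essence, so a
    valuation of names is directly a substitution. *)
Lemma typ_interp th R e B d s : th_om th = false ->
  (forall t u, convR R t u -> conv e t u) -> typ th R B d s ->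
  forall r, (forall x s, In (x, s) B -> interp e s (r x)) -> interp e s (inst r (essence d)).
Proof.
  intros Ho HR. induction 1; intros r Hr; simpl.
  - congruence.
  - unfold essence. simpl. now apply Hr.
  - intros u Hu. eapply interp_conv; [apply rst_sym, conv_beta|].
    rewrite ess_single.
    unfold sb. rewrite inst_ren, inst_inst. apply IHtyp.
    intros y s0 [[= <- <-]|Hin].
    + rewrite idx_cons, Nat.eqb_refl. exact Hu.
    + apply filter_In in Hin as [Hin Hne]. simpl in Hne.
      rewrite idx_cons. destruct (y =? x); [discriminate|].
      cbn [ups]. rewrite inst_ren, inst_LV; [|reflexivity]. now apply Hr.
  - unfold essence in *. simpl in *. apply IHtyp1; auto.
  - split; [apply IHtyp1; auto|].
    (* The essence of a pair is that of its first component; membership of the second is carried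
       over along the conversion required by the pairing rule. *)
    eapply interp_conv; [apply rst_sym, conv_inst, HR; eassumption|]. apply IHtyp2; auto.
  - apply IHtyp; auto.
  - apply IHtyp; auto.
  - eapply interp_le; [exact Ho|eassumption|]. apply IHtyp; auto.
Qed.

Theorem typ_WN th R e B d s : th_om th = false ->
  (forall t u, convR R t u -> conv e t u) -> typ th R B d s -> WN e (essence d).
Proof.
  intros Ho HR H.
  assert (G : interp e s (inst LV (essence d))).
  { eapply typ_interp; eauto. intros. apply interp_adequate. constructor. }
  rewrite inst_LV in G by reflexivity. now apply interp_adequate in G.
Qed.

(** * Type inference as a Horn program *)

#[local] Opaque cpair.

Fixpoint enc_l (t : lterm) : nat :=
  match t with
  | LV i => cpair 0 i
  | LLam b => cpair 1 (enc_l b)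
  | LApp a b => cpair 2 (cpair (enc_l a) (enc_l b))
  end.

Fixpoint enc_seq (l : list nat) : nat :=
  match l with [] => 0 | x :: l => S (cpair x (enc_seq l)) end.

Fixpoint enc_tys (l : list ty) : nat :=
  match l with [] => 0 | x :: l => S (cpair (enc_ty x) (enc_tys l)) end.

Definition enc_opt (o : option ty) : nat :=
  match o with None => 0 | Some s => S (enc_ty s) end.

Fixpoint lookup (x : nat) (G : basis) : option ty :=
  match G with
  | [] => None
  | (y, s) :: G => if x =? y then Some s else lookup x G
  end.

Ltac inv_code :=
  repeat match goal with
  | H : cpair _ _ = cpair _ _ |- _ => apply cpair_inj in H as [? ?]
  | H : S _ = S _ |- _ => injection H as H
  | H : ?a = ?a |- _ => clear H
  | H : S _ = 0 |- _ => discriminate H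
  | H : 0 = S _ |- _ => discriminate H
  | H : ?x = _ |- _ => is_var x; subst x
  | H : _ = ?x |- _ => is_var x; subst x
  end.

Lemma enc_ty_inj s : forall t, enc_ty s = enc_ty t -> s = t.
Proof.
  induction s; intros [] H; simpl in H; inv_code; try reflexivity; f_equal; auto.
Qed.

Lemma enc_l_inj s : forall t, enc_l s = enc_l t -> s = t.
Proof.
  induction s; intros [] H; simpl in H; inv_code; try reflexivity; f_equal; auto.
Qed.

Fixpoint pk (n : nat) : pat := match n with 0 => PZ | S n => PS (pk n) end.

#[local] Notation "p ;; q" := (PP p q) (at level 60, right associativity).
#[local] Notation "g :- b" := (Clause (fst g) (snd g) b) (at level 90, no associativity).
#[local] Notation "# i" := (PV i) (at level 1, i at level 0, format "# i").

#[local] Notation pcons p q := (PS (PP p q)).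
#[local] Notation pAtom n := (PP (pk 0) n).
#[local] Notation pOm := (PP (pk 1) PZ).
#[local] Notation pArr a b := (PP (pk 2) (PP a b)).
#[local] Notation pCap a b := (PP (pk 3) (PP a b)).
#[local] Notation pU a := (PP (pk 0) a).
#[local] Notation pVar a := (PP (pk 1) a).
#[local] Notation pLam x s a := (PP (pk 2) (PP x (PP s a))).
#[local] Notation pApp a b := (PP (pk 3) (PP a b)).
#[local] Notation pPair a b := (PP (pk 4) (PP a b)).
#[local] Notation pPr1 a := (PP (pk 5) a).
#[local] Notation pPr2 a := (PP (pk 6) a).
#[local] Notation pCoe a s := (PP (pk 7) (PP a s)).
#[local] Notation lV i := (PP (pk 0) i).
#[local] Notation lLam b := (PP (pk 1) b).
#[local] Notation lApp a b := (PP (pk 2) (PP a b)).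

#[local] Notation EQ p := (0, p).
#[local] Notation LT p := (1, p).
#[local] Notation ADD p := (2, p).
#[local] Notation LOOK p := (3, p).
#[local] Notation MEM p := (4, p).
#[local] Notation COLL p := (5, p).
#[local] Notation SUB p := (6, p).
#[local] Notation IDX p := (7, p).
#[local] Notation ESS p := (8, p).
#[local] Notation LIFT p := (9, p).
#[local] Notation SUBST p := (10, p).
#[local] Notation STEP p := (11, p).
#[local] Notation FREE p := (12, p).
#[local] Notation NEU p := (13, p).
#[local] Notation NF p := (14, p).
#[local] Notation ETAOK p := (15, p).
#[local] Notation STAR p := (16, p).
#[local] Notation CONV p := (17, p).
#[local] Notation INF p := (18, p).
#[local] Notation TC p := (19, p).
#[local] Notation TR p := (20, p).

(** * The clauses *)

Definition P_EQ := [
  EQ (PZ ;; PZ ;; pk 1) :- [];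
  EQ (PZ ;; PS #0 ;; pk 0) :- [];
  EQ (PS #0 ;; PZ ;; pk 0) :- [];
  EQ (PS #0 ;; PS #1 ;; #2) :- [EQ (#0 ;; #1 ;; #2)] ].

Definition P_LT := [
  LT (#0 ;; PZ ;; pk 0) :- [];
  LT (PZ ;; PS #0 ;; pk 1) :- [];
  LT (PS #0 ;; PS #1 ;; #2) :- [LT (#0 ;; #1 ;; #2)] ].

Definition P_ADD := [
  ADD (PZ ;; #0 ;; #0) :- [];
  ADD (PS #0 ;; #1 ;; PS #2) :- [ADD (#0 ;; #1 ;; #2)] ].

Definition P_LOOK := [
  LOOK (#0 ;; PZ ;; pk 0) :- [];
  LOOK (#0 ;; pcons (#1 ;; #2) #3 ;; PS #2) :- [EQ (#0 ;; #1 ;; pk 1)];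
  LOOK (#0 ;; pcons (#1 ;; #2) #3 ;; #4) :- [EQ (#0 ;; #1 ;; pk 0); LOOK (#0 ;; #3 ;; #4)] ].

Definition P_MEM := [
  MEM (#0 ;; PZ ;; pk 0) :- [];
  MEM (#0 ;; pcons #1 #2 ;; pk 1) :- [EQ (#0 ;; #1 ;; pk 1)];
  MEM (#0 ;; pcons (pCap #1 #2) #3 ;; #4) :- [MEM (#0 ;; pcons #1 (pcons #2 #3) ;; #4)];
  MEM (#0 ;; pcons (pAtom #1) #2 ;; #3) :- [EQ (#0 ;; pAtom #1 ;; pk 0); MEM (#0 ;; #2 ;; #3)];
  MEM (#0 ;; pcons pOm #2 ;; #3) :- [EQ (#0 ;; pOm ;; pk 0); MEM (#0 ;; #2 ;; #3)];
  MEM (#0 ;; pcons (pArr #1 #4) #2 ;; #3) :-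
    [EQ (#0 ;; pArr #1 #4 ;; pk 0); MEM (#0 ;; #2 ;; #3)] ].

(** Computes the list of targets of [targetsL], flattening intersections and calling [SUB] on a
    singleton for each source; mutually recursive with [P_SUB]. *)
Definition P_COLL := [
  COLL (PZ ;; #0 ;; PZ) :- [];
  COLL (pcons (pCap #0 #1) #2 ;; #3 ;; #4) :- [COLL (pcons #0 (pcons #1 #2) ;; #3 ;; #4)];
  COLL (pcons (pArr #0 #1) #2 ;; #3 ;; pcons #1 #4) :-
    [SUB (pcons #3 PZ ;; #0 ;; pk 1); COLL (#2 ;; #3 ;; #4)];
  COLL (pcons (pArr #0 #1) #2 ;; #3 ;; #4) :-
    [SUB (pcons #3 PZ ;; #0 ;; pk 0); COLL (#2 ;; #3 ;; #4)];
  COLL (pcons (pAtom #0) #2 ;; #3 ;; #4) :- [COLL (#2 ;; #3 ;; #4)];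
  COLL (pcons pOm #2 ;; #3 ;; #4) :- [COLL (#2 ;; #3 ;; #4)] ].

Definition P_SUB (th : theory) := [
  SUB (#0 ;; pAtom #1 ;; #2) :- [MEM (pAtom #1 ;; #0 ;; #2)];
  SUB (#0 ;; pOm ;; pk 1) :- [];
  SUB (#0 ;; pCap #1 #2 ;; pk 1) :- [SUB (#0 ;; #1 ;; pk 1); SUB (#0 ;; #2 ;; pk 1)];
  SUB (#0 ;; pCap #1 #2 ;; pk 0) :- [SUB (#0 ;; #1 ;; pk 0)];
  SUB (#0 ;; pCap #1 #2 ;; pk 0) :- [SUB (#0 ;; #2 ;; pk 0)];
  if th_arr th
  then SUB (#0 ;; pArr #1 #2 ;; #3) :- [COLL (#0 ;; #1 ;; #4); SUB (#4 ;; #2 ;; #3)]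
  else SUB (#0 ;; pArr #1 #2 ;; #3) :- [MEM (pArr #1 #2 ;; #0 ;; #3)] ].

Definition P_IDX := [
  IDX (#0 ;; PZ ;; #0) :- [];
  IDX (#0 ;; pcons #1 #2 ;; pk 0) :- [EQ (#0 ;; #1 ;; pk 1)];
  IDX (#0 ;; pcons #1 #2 ;; PS #3) :- [EQ (#0 ;; #1 ;; pk 0); IDX (#0 ;; #2 ;; #3)] ].

Definition P_ESS := [
  ESS (#0 ;; pU #1 ;; #2) :- [ESS (#0 ;; #1 ;; #2)];
  ESS (#0 ;; pVar #1 ;; lV #2) :- [IDX (#1 ;; #0 ;; #2)];
  ESS (#0 ;; pLam #1 #2 #3 ;; lLam #4) :- [ESS (pcons #1 #0 ;; #3 ;; #4)];
  ESS (#0 ;; pApp #1 #2 ;; lApp #3 #4) :- [ESS (#0 ;; #1 ;; #3); ESS (#0 ;; #2 ;; #4)];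
  ESS (#0 ;; pPair #1 #2 ;; #3) :- [ESS (#0 ;; #1 ;; #3)];
  ESS (#0 ;; pPr1 #1 ;; #2) :- [ESS (#0 ;; #1 ;; #2)];
  ESS (#0 ;; pPr2 #1 ;; #2) :- [ESS (#0 ;; #1 ;; #2)];
  ESS (#0 ;; pCoe #1 #2 ;; #3) :- [ESS (#0 ;; #1 ;; #3)] ].

Definition P_LIFT := [
  LIFT (#0 ;; #1 ;; lV #2 ;; lV #2) :- [LT (#2 ;; #1 ;; pk 1)];
  LIFT (#0 ;; #1 ;; lV #2 ;; lV #3) :- [LT (#2 ;; #1 ;; pk 0); ADD (#2 ;; #0 ;; #3)];
  LIFT (#0 ;; #1 ;; lLam #2 ;; lLam #3) :- [LIFT (#0 ;; PS #1 ;; #2 ;; #3)];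
  LIFT (#0 ;; #1 ;; lApp #2 #3 ;; lApp #4 #5) :-
    [LIFT (#0 ;; #1 ;; #2 ;; #4); LIFT (#0 ;; #1 ;; #3 ;; #5)] ].

Definition P_SUBST := [
  SUBST (#0 ;; #1 ;; lV #2 ;; lV #2) :- [LT (#2 ;; #0 ;; pk 1)];
  SUBST (#0 ;; #1 ;; lV #0 ;; #2) :- [LIFT (#0 ;; PZ ;; #1 ;; #2)];
  SUBST (#0 ;; #1 ;; lV (PS #2) ;; lV #2) :- [LT (#0 ;; PS #2 ;; pk 1)];
  SUBST (#0 ;; #1 ;; lLam #2 ;; lLam #3) :- [SUBST (PS #0 ;; #1 ;; #2 ;; #3)];
  SUBST (#0 ;; #1 ;; lApp #2 #3 ;; lApp #4 #5) :-
    [SUBST (#0 ;; #1 ;; #2 ;; #4); SUBST (#0 ;; #1 ;; #3 ;; #5)] ].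

(** For eta, [LIFT] is used backwards: the contractum is guessed and its lift compared with the
    function part. This is why the meaning given to [LIFT] must assert that the guessed number codes
    a term. *)
Definition P_STEP (e : bool) := [
  STEP (lApp (lLam #0) #1 ;; #2) :- [SUBST (PZ ;; #1 ;; #0 ;; #2)];
  STEP (lLam #0 ;; lLam #1) :- [STEP (#0 ;; #1)];
  STEP (lApp #0 #1 ;; lApp #2 #1) :- [STEP (#0 ;; #2)];
  STEP (lApp #0 #1 ;; lApp #0 #2) :- [STEP (#1 ;; #2)] ] ++
  if e then [STEP (lLam (lApp #0 (lV PZ)) ;; #1) :- [LIFT (pk 1 ;; PZ ;; #1 ;; #0)]] else [].

Definition P_FREE := [
  FREE (#0 ;; lV #0) :- [];
  FREE (#0 ;; lLam #1) :- [FREE (PS #0 ;; #1)];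
  FREE (#0 ;; lApp #1 #2) :- [FREE (#0 ;; #1)];
  FREE (#0 ;; lApp #1 #2) :- [FREE (#0 ;; #2)] ].

Definition P_NF := [
  NEU (lV #0) :- [];
  NEU (lApp #0 #1) :- [NEU #0; NF #1];
  NF #0 :- [NEU #0];
  NF (lLam #0) :- [NF #0; ETAOK #0] ].

(** Says positively that the abstraction of the term is not an eta-redex, by listing the other
    shapes of a body; only an application to [LV 0] needs an occurrence of that variable in the
    function part. *)
Definition P_ETAOK (e : bool) :=
  if e then [
    ETAOK (lV #0) :- [];
    ETAOK (lLam #0) :- [];
    ETAOK (lApp #0 (lV (PS #1))) :- [];
    ETAOK (lApp #0 (lLam #1)) :- [];
    ETAOK (lApp #0 (lApp #1 #2)) :- [];
    ETAOK (lApp #0 #1) :- [FREE (PZ ;; #0)] ]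
  else [ETAOK #0 :- []].

Definition P_STAR := [
  STAR (#0 ;; #0) :- [];
  STAR (#0 ;; #1) :- [STEP (#0 ;; #2); STAR (#2 ;; #1)] ].

(** Except for syntactic identity, an answer is derivable only when both terms have normal forms;
    the test is therefore undefined on some inputs, and the inference clauses must not depend on it
    for untypable pairs. *)
Definition P_CONV (R : eqkind) :=
  match R with
  | Syn => [CONV (#0 ;; #1 ;; #2) :- [EQ (#0 ;; #1 ;; #2)]]
  | _ => [CONV (#0 ;; #1 ;; #2) :-
           [STAR (#0 ;; #3); NF #3; STAR (#1 ;; #4); NF #4; EQ (#3 ;; #4 ;; #2)]]
  end.

(* The result is 0 for an untypable term and [S s] for a term of type [s]. *)
Definition P_INF (th : theory) := [
  INF (#0 ;; pU #1 ;; if th_om th then PS pOm else PZ) :- [];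
  INF (#0 ;; pVar #1 ;; #2) :- [LOOK (#1 ;; #0 ;; #2)];
  INF (#0 ;; pLam #1 #2 #3 ;; PZ) :- [INF (pcons (#1 ;; #2) #0 ;; #3 ;; PZ)];
  INF (#0 ;; pLam #1 #2 #3 ;; PS (pArr #2 #4)) :- [INF (pcons (#1 ;; #2) #0 ;; #3 ;; PS #4)];
  INF (#0 ;; pApp #1 #2 ;; PZ) :- [INF (#0 ;; #1 ;; PZ)];
  INF (#0 ;; pApp #1 #2 ;; PZ) :- [INF (#0 ;; #2 ;; PZ)];
  INF (#0 ;; pApp #1 #2 ;; PZ) :- [INF (#0 ;; #1 ;; PS (pAtom #3))];
  INF (#0 ;; pApp #1 #2 ;; PZ) :- [INF (#0 ;; #1 ;; PS pOm)];
  INF (#0 ;; pApp #1 #2 ;; PZ) :- [INF (#0 ;; #1 ;; PS (pCap #3 #4))];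
  INF (#0 ;; pApp #1 #2 ;; PZ) :-
    [INF (#0 ;; #1 ;; PS (pArr #3 #4)); INF (#0 ;; #2 ;; PS #5); EQ (#3 ;; #5 ;; pk 0)];
  INF (#0 ;; pApp #1 #2 ;; PS #4) :-
    [INF (#0 ;; #1 ;; PS (pArr #3 #4)); INF (#0 ;; #2 ;; PS #5); EQ (#3 ;; #5 ;; pk 1)];
  INF (#0 ;; pPair #1 #2 ;; PZ) :- [INF (#0 ;; #1 ;; PZ)];
  INF (#0 ;; pPair #1 #2 ;; PZ) :- [INF (#0 ;; #2 ;; PZ)];
  INF (#0 ;; pPair #1 #2 ;; PZ) :-
    [ESS (PZ ;; #1 ;; #3); ESS (PZ ;; #2 ;; #4); CONV (#3 ;; #4 ;; pk 0)];
  INF (#0 ;; pPair #1 #2 ;; PS (pCap #5 #6)) :-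
    [INF (#0 ;; #1 ;; PS #5); INF (#0 ;; #2 ;; PS #6);
     ESS (PZ ;; #1 ;; #3); ESS (PZ ;; #2 ;; #4); CONV (#3 ;; #4 ;; pk 1)];
  INF (#0 ;; pPr1 #1 ;; PZ) :- [INF (#0 ;; #1 ;; PZ)];
  INF (#0 ;; pPr1 #1 ;; PZ) :- [INF (#0 ;; #1 ;; PS (pAtom #3))];
  INF (#0 ;; pPr1 #1 ;; PZ) :- [INF (#0 ;; #1 ;; PS pOm)];
  INF (#0 ;; pPr1 #1 ;; PZ) :- [INF (#0 ;; #1 ;; PS (pArr #3 #4))];
  INF (#0 ;; pPr1 #1 ;; PS #3) :- [INF (#0 ;; #1 ;; PS (pCap #3 #4))];
  INF (#0 ;; pPr2 #1 ;; PZ) :- [INF (#0 ;; #1 ;; PZ)];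
  INF (#0 ;; pPr2 #1 ;; PZ) :- [INF (#0 ;; #1 ;; PS (pAtom #3))];
  INF (#0 ;; pPr2 #1 ;; PZ) :- [INF (#0 ;; #1 ;; PS pOm)];
  INF (#0 ;; pPr2 #1 ;; PZ) :- [INF (#0 ;; #1 ;; PS (pArr #3 #4))];
  INF (#0 ;; pPr2 #1 ;; PS #4) :- [INF (#0 ;; #1 ;; PS (pCap #3 #4))];
  INF (#0 ;; pCoe #1 #2 ;; PZ) :- [INF (#0 ;; #1 ;; PZ)];
  INF (#0 ;; pCoe #1 #2 ;; PZ) :- [INF (#0 ;; #1 ;; PS #3); SUB (pcons #3 PZ ;; #2 ;; pk 0)];
  INF (#0 ;; pCoe #1 #2 ;; PS #2) :- [INF (#0 ;; #1 ;; PS #3); SUB (pcons #3 PZ ;; #2 ;; pk 1)] ].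

Definition P_ANS := [
  TC ((#0 ;; #1 ;; #2) ;; #3) :- [INF (#0 ;; #1 ;; PS #4); EQ (#4 ;; #2 ;; #3)];
  TC ((#0 ;; #1 ;; #2) ;; PZ) :- [INF (#0 ;; #1 ;; PZ)];
  TR ((#0 ;; #1) ;; #2) :- [INF (#0 ;; #1 ;; #2)] ].

Definition eta_of (R : eqkind) : bool := match R with BetaEta => true | _ => false end.

Definition groups (th : theory) (R : eqkind) : list (list clause) :=
  [P_EQ; P_LT; P_ADD; P_LOOK; P_MEM; P_COLL; P_SUB th; P_IDX; P_ESS; P_LIFT; P_SUBST;
   P_STEP (eta_of R); P_FREE; P_NF; P_ETAOK (eta_of R); P_STAR; P_CONV R; P_INF th; P_ANS].

Definition prog (th : theory) (R : eqkind) : list clause := concat (groups th R).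

(* [G] is an environment whose shadowed declarations have not been removed. *)
Definition Equiv (B G : basis) : Prop :=
  NoDup (map fst B) /\ forall x s, In (x, s) B <-> lookup x G = Some s.

Definition verdict (b : nat) (Q : Prop) : Prop := b = 1 /\ Q \/ b = 0 /\ ~ Q.

Definition inferred (th : theory) (R : eqkind) (B : basis) (d : dterm) (r : nat) : Prop :=
  r = 0 /\ (forall s, ~ typ th R B d s) \/
  exists s, r = S (enc_ty s) /\ wf_ty th s /\ typ th R B d s.

(** A model of the program, not its least one: it constrains only arguments that are well-formed
    codes and is vacuous elsewhere, so soundness is checked clause by clause. Predicates on terms
    also assert that their results are codes, because the search guesses arbitrary numbers. *)
Definition Inv (th : theory) (R : eqkind) (tag a : nat) : Prop :=
  let e := eta_of R in
  match tag with
  | 0 => forall x y b, a = cpair x (cpair y b) -> b = if x =? y then 1 else 0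
  | 1 => forall x y b, a = cpair x (cpair y b) -> b = if x <? y then 1 else 0
  | 2 => forall x y z, a = cpair x (cpair y z) -> z = x + y
  | 3 => forall x G r, a = cpair x (cpair (enc_basis G) r) -> r = enc_opt (lookup x G)
  | 4 => forall t L b, match t with TCap _ _ => False | _ => True end ->
           a = cpair (enc_ty t) (cpair (enc_tys L) b) -> verdict b (mems L t)
  | 5 => forall L s M, Forall (wf_ty th) L -> wf_ty th s ->
           a = cpair (enc_tys L) (cpair (enc_ty s) M) ->
           exists M', M = enc_tys M' /\ Forall (wf_ty th) M' /\
             forall y, In y M' <-> targetsL th L s y
  | 6 => forall L t b, Forall (wf_ty th) L -> wf_ty th t ->
           a = cpair (enc_tys L) (cpair (enc_ty t) b) -> verdict b (LEl th L t)
  | 7 => forall x c i, a = cpair x (cpair (enc_seq c) i) -> i = idx c x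
  | 8 => forall c d t, a = cpair (enc_seq c) (cpair (enc_term d) t) -> t = enc_l (ess c d)
  | 9 => forall n k x y, a = cpair n (cpair k (cpair x y)) ->
           exists t, x = enc_l t /\ y = enc_l (liftn n k t)
  | 10 => forall k u x y, a = cpair k (cpair (enc_l u) (cpair x y)) ->
           exists t, x = enc_l t /\ y = enc_l (subst k u t)
  | 11 => forall t y, a = cpair (enc_l t) y -> exists t', y = enc_l t' /\ step true e t t'
  | 12 => forall k t, a = cpair k (enc_l t) -> free k t
  | 13 => forall t, a = enc_l t -> normal e t /\ match t with LLam _ => False | _ => True end
  | 14 => forall t, a = enc_l t -> normal e t
  | 15 => forall t, a = enc_l t -> e = true -> forall q, t <> LApp (ren S q) (LV 0)
  | 16 => forall t y, a = cpair (enc_l t) y -> exists t', y = enc_l t' /\ star (step true e) t t'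
  | 17 => forall t u b, a = cpair (enc_l t) (cpair (enc_l u) b) -> verdict b (convR R t u)
  | 18 => forall B G d r, Equiv B G -> Forall (fun p => wf_ty th (snd p)) G -> wf_term th d ->
           a = cpair (enc_basis G) (cpair (enc_term d) r) -> inferred th R B d r
  | 19 => forall B d s b, wf_basis th B -> wf_term th d ->
           a = cpair (cpair (enc_basis B) (cpair (enc_term d) (enc_ty s))) b ->
           verdict b (typ th R B d s)
  | 20 => forall B d r, wf_basis th B -> wf_term th d ->
           a = cpair (cpair (enc_basis B) (enc_term d)) r -> inferred th R B d r
  | _ => True
  end.

Fixpoint body_ok (I : nat -> nat -> Prop) (l : list nat) (b : list (nat * pat)) : Prop :=
  match b with [] => True | (t, p) :: b => I t (ev l p) /\ body_ok I l b end.

Definition clause_ok (I : nat -> nat -> Prop) (c : clause) : Prop :=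
  forall l, body_ok I l (c_body c) -> I (c_tag c) (ev l (c_head c)).

Lemma holds_model P (I : nat -> nat -> Prop) :
  Forall (clause_ok I) P -> forall t a, holds P t a -> I t a.
Proof.
  intros H t a Ha. induction Ha as [c l Hc _ IH].
  rewrite Forall_forall in H. apply H; auto.
  induction (c_body c) as [|[t p] b IHb]; simpl; auto.
  split; [apply IH; now left|]. apply IHb. intros. apply IH. now right.
Qed.

Lemma holds_use (P G : list clause) k c l : incl G P -> nth_error G k = Some c ->
  body_ok (holds P) l (c_body c) -> holds P (c_tag c) (ev l (c_head c)).
Proof.
  intros HG Hk Hb. apply h_clause; [apply HG; eapply nth_error_In; eauto|].
  induction (c_body c) as [|[t p] b IHb]; simpl in *; [tauto|].
  intros t' p' [[= <- <-]|]; [tauto|]. apply IHb; tauto.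
Qed.

Lemma Equiv_refl B : NoDup (map fst B) -> Equiv B B.
Proof.
  intros H. split; auto. induction B as [|[y t] B IH]; simpl in *; [split; [tauto|discriminate]|].
  inversion H as [|? ? Hn Hd]; subst. intros x s. destruct (Nat.eqb_spec x y) as [->|Hne].
  - split; [|intros [= ->]; auto]. intros [[= ->]|Hin]; auto.
    destruct Hn. apply in_map_iff. now exists (y, s).
  - rewrite <- IH by auto. split; auto. intros [[= <- <-]|]; tauto.
Qed.

Lemma Equiv_ext B G x s : Equiv B G -> Equiv (ext B x s) ((x, s) :: G).
Proof.
  intros [Hn H]. split.
  - simpl. constructor.
    + intros Hin. apply in_map_iff in Hin as ([y t] & E & Hin). simpl in E. subst.
      apply filter_In in Hin as [_ Hin]. simpl in Hin. now rewrite Nat.eqb_refl in Hin.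
    + clear H. induction B as [|[y t] B IH]; simpl in *; [constructor|].
      inversion Hn; subst. destruct (Nat.eqb_spec y x); simpl; auto.
      constructor; auto. intros Hin. apply H1.
      apply in_map_iff in Hin as (p & E & Hin). apply filter_In in Hin as [Hin _].
      apply in_map_iff. eauto.
  - intros y t. simpl. rewrite filter_In. simpl.
    destruct (Nat.eqb_spec y x) as [->|Hne]; simpl.
    + split; [intros [[= ->]|[_ ?]]; [auto|discriminate]|intros [= ->]; auto].
    + rewrite <- H. split; [intros [[= <- <-]|[]]; tauto|auto].
Qed.

(** Each term constructor has exactly one rule, abstractions and coercions display their types, and
    a basis declares each variable once. *)
Lemma typ_unique th R B d s : typ th R B d s -> NoDup (map fst B) ->
  forall t, typ th R B d t -> s = t.
Proof.
  induction 1; intros Hd t' Ht; inversion Ht; subst; auto;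
    repeat match goal with
    | IH : NoDup _ -> forall t, typ _ _ _ ?d t -> _, H : typ _ _ _ ?d _ |- _ =>
        specialize (IH Hd _ H); try congruence
    end.
  - destruct (Equiv_refl B Hd) as [_ E].
    repeat match goal with H : In _ _ |- _ => apply E in H end. congruence.
  - f_equal. apply IHtyp; auto. eapply Equiv_ext, Equiv_refl; auto.
Qed.

(** * Soundness of the program *)

Ltac prep :=
  let l := fresh "l" in
  intros l; cbn [body_ok c_tag c_head c_body fst snd ev pk Inv]; cbv zeta;
  repeat match goal with |- context [nth ?i l 0] => generalize (nth i l 0); intro end;
  clear l.

Ltac inv_ty :=
  repeat (inv_code;
  match goal with
  | H : cpair _ _ = enc_ty ?x |- _ => destruct x; simpl in H
  | H : cpair _ _ = enc_l ?x |- _ => destruct x; simpl in H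
  | H : cpair _ _ = enc_term ?x |- _ => destruct x; simpl in H
  | H : S _ = enc_tys ?x |- _ => destruct x; simpl in H
  | H : 0 = enc_tys ?x |- _ => destruct x; simpl in H
  | H : S _ = enc_seq ?x |- _ => destruct x; simpl in H
  | H : 0 = enc_seq ?x |- _ => destruct x; simpl in H
  | H : S _ = enc_basis ?x |- _ => destruct x as [|[? ?] ?]; simpl in H
  | H : 0 = enc_basis ?x |- _ => destruct x as [|[? ?] ?]; simpl in H
  | H : enc_ty _ = enc_ty _ |- _ => apply enc_ty_inj in H
  | H : enc_l _ = enc_l _ |- _ => apply enc_l_inj in H
  end); inv_code.

Section Sound.
Variables (th : theory) (R : eqkind).
#[local] Notation I := (Inv th R).
#[local] Notation sound := (Forall (clause_ok I)).

Lemma sound_EQ : sound P_EQ.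
Proof.
  repeat apply Forall_cons; try apply Forall_nil; prep; intros H x y b E; inv_code; auto.
  destruct H as [H _]. rewrite (H _ _ _ eq_refl). reflexivity.
Qed.

Lemma sound_LT : sound P_LT.
Proof.
  repeat apply Forall_cons; try apply Forall_nil; prep; intros H x y b E; inv_code; auto.
  destruct H as [H _]. rewrite (H _ _ _ eq_refl). reflexivity.
Qed.

Lemma sound_ADD : sound P_ADD.
Proof.
  repeat apply Forall_cons; try apply Forall_nil; prep; intros H x y b E; inv_code; auto.
  destruct H as [H _]. rewrite (H _ _ _ eq_refl). reflexivity.
Qed.

Lemma eqb_1 x y : 1 = (if x =? y then 1 else 0) -> x = y.
Proof. destruct (Nat.eqb_spec x y); auto; discriminate. Qed.
Lemma eqb_0 x y : 0 = (if x =? y then 1 else 0) -> x <> y.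
Proof. destruct (Nat.eqb_spec x y); auto; discriminate. Qed.
Lemma ltb_1 x y : 1 = (if x <? y then 1 else 0) -> x < y.
Proof. destruct (Nat.ltb_spec x y); auto; discriminate. Qed.
Lemma ltb_0 x y : 0 = (if x <? y then 1 else 0) -> y <= x.
Proof. destruct (Nat.ltb_spec x y); auto; discriminate. Qed.

Ltac eqs := repeat match goal with
  | H : forall x y b, cpair ?p (cpair ?q ?r) = _ -> b = if x =? y then _ else _ |- _ =>
      specialize (H p q r eq_refl); first [apply eqb_1 in H | apply eqb_0 in H]
  | H : forall x y b, cpair ?p (cpair ?q ?r) = _ -> b = if x <? y then _ else _ |- _ =>
      specialize (H p q r eq_refl); first [apply ltb_1 in H | apply ltb_0 in H]
  end.

Lemma sound_LOOK : sound P_LOOK.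
Proof.
  repeat apply Forall_cons; try apply Forall_nil; prep; intros H x G r E; inv_ty; auto;
    destruct H as [H1 H2]; eqs; subst; simpl.
  - now rewrite Nat.eqb_refl.
  - destruct H2 as [H2 _]. rewrite (H2 _ _ _ eq_refl).
    now apply Nat.eqb_neq in H1 as ->.
Qed.

Lemma sound_IDX : sound P_IDX.
Proof.
  repeat apply Forall_cons; try apply Forall_nil; prep; intros H x G r E; inv_ty; auto;
    destruct H as [H1 H2]; eqs; subst; rewrite idx_cons.
  - now rewrite Nat.eqb_refl.
  - destruct H2 as [H2 _]. rewrite (H2 _ _ _ eq_refl).
    now apply Nat.eqb_neq in H1 as ->.
Qed.

Lemma mems_cons x L t : mems (x :: L) t <-> In t (comps x) \/ mems L t.
Proof.
  split.
  - intros (y & [<-|Hy] & H); [now left|right; exists y; auto].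
  - intros [H|(y & Hy & H)]; [exists x|exists y]; simpl; auto.
Qed.

Lemma verdict_iff b Q Q' : (Q <-> Q') -> verdict b Q -> verdict b Q'.
Proof. unfold verdict. tauto. Qed.

Lemma sound_MEM : sound P_MEM.
Proof.
  repeat apply Forall_cons; try apply Forall_nil; prep; intros H t L b Ht E; inv_ty;
    try destruct H as [H1 H2]; eqs.
  - right. split; auto. intros (y & [] & _).
  - apply enc_ty_inj in H1 as ->. left. split; auto. rewrite mems_cons. left.
    destruct t0; simpl; auto; contradiction.
  - specialize (H1 t (t0_1 :: t0_2 :: L) b Ht eq_refl). revert H1. apply verdict_iff.
    rewrite !mems_cons. simpl. rewrite in_app_iff. tauto.
  - destruct H2 as [H2 _]. specialize (H2 t L b Ht eq_refl). revert H2. apply verdict_iff.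
    rewrite mems_cons. simpl. split; auto. intros [[<-|[]]|]; auto. now destruct H1.
  - destruct H2 as [H2 _]. specialize (H2 t L b Ht eq_refl). revert H2. apply verdict_iff.
    rewrite mems_cons. simpl. split; auto. intros [[<-|[]]|]; auto. now destruct H1.
  - destruct H2 as [H2 _]. specialize (H2 t L b Ht eq_refl). revert H2. apply verdict_iff.
    rewrite mems_cons. simpl. split; auto. intros [[<-|[]]|]; auto. now destruct H1.
Qed.

Lemma targetsL_cons x L s y :
  targetsL th (x :: L) s y <-> (exists a, In (TArr a y) (comps x) /\ leT th s a) \/ targetsL th L s y.
Proof.
  unfold targetsL. split.
  - intros (a & H & Hs). apply mems_cons in H as [|]; eauto.
  - intros [(a & H & Hs)|(a & H & Hs)]; exists a; rewrite mems_cons; auto.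
Qed.

Lemma verdict_1 Q : verdict 1 Q -> Q.
Proof. intros [[]|[]]; [auto|discriminate]. Qed.
Lemma verdict_0 Q : verdict 0 Q -> ~ Q.
Proof. intros [[]|[]]; [discriminate|auto]. Qed.

Lemma sound_COLL : sound P_COLL.
Proof.
  repeat apply Forall_cons; try apply Forall_nil; prep; intros H L s M HL Hs E; inv_ty;
    try destruct H as [H1 H2]; try (inversion HL as [|? ? Hx HL']; subst).
  - exists []. split; [auto|]. split; [auto|]. intros y. split; [intros []|intros (a & (x & [] & _) & _)].
  - destruct Hx as [Hx1 Hx2].
    destruct (H1 (t1 :: t2 :: L) s M) as (M' & -> & HM & HE); auto.
    exists M'. repeat split; auto; intros Hy.
    + apply HE in Hy. rewrite !targetsL_cons in *. simpl.
      destruct Hy as [(a & ? & ?)|[(a & ? & ?)|]]; auto; left; exists a; rewrite in_app_iff; auto.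
    + apply HE. rewrite !targetsL_cons in *. simpl in Hy.
      destruct Hy as [(a & Hy & ?)|]; auto. apply in_app_iff in Hy as []; eauto.
  - destruct Hx as [Hx1 Hx2]. destruct H2 as [H2 _].
    specialize (H1 [s] t1 1 (Forall_cons _ Hs (Forall_nil _)) Hx1 eq_refl).
    apply verdict_1 in H1. apply (LEl_single th s t1 Hs) in H1.
    destruct (H2 L s _ HL' Hs eq_refl) as (M' & -> & HM & HE).
    exists (t2 :: M'). repeat split; auto.
    + intros [<-|Hy]; apply targetsL_cons; [left; exists t1; simpl; auto|right; now apply HE].
    + intros Hy. apply targetsL_cons in Hy as [(a & [[= <- <-]|[]] & _)|Hy]; simpl; auto.
      right. now apply HE.
  - destruct Hx as [Hx1 Hx2]. destruct H2 as [H2 _].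
    specialize (H1 [s] t1 0 (Forall_cons _ Hs (Forall_nil _)) Hx1 eq_refl).
    apply verdict_0 in H1. rewrite (LEl_single th s t1 Hs) in H1.
    destruct (H2 L s _ HL' Hs eq_refl) as (M' & -> & HM & HE).
    exists M'. repeat split; auto; intros Hy.
    + apply targetsL_cons. right. now apply HE.
    + apply HE. apply targetsL_cons in Hy as [(a & [[= <- <-]|[]] & ?)|Hy]; simpl; tauto.
  - destruct (H1 L s _ HL' Hs eq_refl) as (M' & -> & HM & HE).
    exists M'. repeat split; auto; intros Hy.
    + apply targetsL_cons. right. now apply HE.
    + apply HE. apply targetsL_cons in Hy as [(a & [|[]] & ?)|Hy]; auto; discriminate.
  - destruct (H1 L s _ HL' Hs eq_refl) as (M' & -> & HM & HE).
    exists M'. repeat split; auto; intros Hy.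
    + apply targetsL_cons. right. now apply HE.
    + apply HE. apply targetsL_cons in Hy as [(a & [|[]] & ?)|Hy]; auto; discriminate.
Qed.

Lemma sound_SUB : sound (P_SUB th).
Proof.
  repeat apply Forall_cons; try apply Forall_nil.
  - prep. intros [H1 _] L t b HL Ht E; inv_ty.
    specialize (H1 (TAtom _) L b Logic.I eq_refl). revert H1. apply verdict_iff.
    symmetry. now apply LEl_leaf.
  - prep. intros _ L t b HL Ht E; inv_ty. left. split; auto. now apply LEl_om.
  - prep. intros (H1 & H2 & _) L t b HL Ht E; inv_ty. destruct Ht as [Ht1 Ht2].
    specialize (H1 L t1 1 HL Ht1 eq_refl). specialize (H2 L t2 1 HL Ht2 eq_refl).
    apply verdict_1 in H1, H2. left. split; auto. now apply LEl_cap.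
  - prep. intros (H1 & _) L t b HL Ht E; inv_ty. destruct Ht as [Ht1 Ht2].
    specialize (H1 L t1 0 HL Ht1 eq_refl).
    apply verdict_0 in H1. right. split; auto. rewrite LEl_cap. tauto.
  - prep. intros (H1 & _) L t b HL Ht E; inv_ty. destruct Ht as [Ht1 Ht2].
    specialize (H1 L t2 0 HL Ht2 eq_refl).
    apply verdict_0 in H1. right. split; auto. rewrite LEl_cap. tauto.
  - destruct (th_arr th) eqn:Harr.
    + prep. intros (H1 & H2 & _) L t b HL Ht E; inv_ty. destruct Ht as [Ht1 Ht2].
      destruct (H1 L t1 _ HL Ht1 eq_refl) as (M & -> & HM & HE).
      specialize (H2 M t2 b HM Ht2 eq_refl). revert H2. apply verdict_iff.
      rewrite LEl_arr by auto. split; apply LE_mono; apply HE.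
    + prep. intros [H1 _] L t b HL Ht E; inv_ty.
      specialize (H1 (TArr t1 t2) L b Logic.I eq_refl). revert H1. apply verdict_iff.
      symmetry. now apply LEl_leaf.
Qed.

Lemma sound_ESS : sound P_ESS.
Proof.
  repeat apply Forall_cons; try apply Forall_nil; prep; intros H c d t E; inv_ty; simpl;
    try destruct H as [H1 H2];
    try (now apply H1).
  - rewrite (H1 _ _ _ eq_refl). unfold idx.
    match goal with |- context [find_idx ?x c] => now destruct (find_idx x c) end.
  - rewrite (H1 (_ :: c) _ _ eq_refl). reflexivity.
  - rewrite (H1 _ _ _ eq_refl). destruct H2 as [H2 _]. rewrite (H2 _ _ _ eq_refl). reflexivity.
Qed.

Lemma sound_LIFT : sound P_LIFT.
Proof.
  repeat apply Forall_cons; try apply Forall_nil; prep; intros H nn k x y E; inv_code;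
    destruct H as [H1 H2]; eqs.
  - eexists (LV _). split; [reflexivity|]. simpl. now apply Nat.ltb_lt in H1 as ->.
  - destruct H2 as [H2 _]. rewrite (H2 _ _ _ eq_refl).
    eexists (LV _). split; [reflexivity|]. simpl. now apply Nat.ltb_ge in H1 as ->.
  - destruct (H1 _ _ _ _ eq_refl) as (t & -> & ->). exists (LLam t). auto.
  - destruct (H1 _ _ _ _ eq_refl) as (t & -> & ->). destruct H2 as [H2 _].
    destruct (H2 _ _ _ _ eq_refl) as (t' & -> & ->). exists (LApp t t'). auto.
Qed.

Lemma sound_SUBST : sound P_SUBST.
Proof.
  repeat apply Forall_cons; try apply Forall_nil; prep; intros H k u x y E; inv_code;
    destruct H as [H1 H2]; eqs.
  - eexists (LV _). split; [reflexivity|]. simpl. now apply Nat.ltb_lt in H1 as ->.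
  - destruct (H1 _ _ _ _ eq_refl) as (t & Et & ->). apply enc_l_inj in Et as <-.
    exists (LV k). split; [reflexivity|]. cbn [subst]. now rewrite Nat.ltb_irrefl, Nat.eqb_refl.
  - eexists (LV (S _)). split; [reflexivity|]. cbn [subst].
    match goal with H1 : k < ?i |- _ =>
      destruct (Nat.ltb_spec i k); [lia|]; destruct (Nat.eqb_spec i k); [lia|reflexivity] end.
  - destruct (H1 _ _ _ _ eq_refl) as (t & -> & ->). exists (LLam t). auto.
  - destruct (H1 _ _ _ _ eq_refl) as (t & -> & ->). destruct H2 as [H2 _].
    destruct (H2 _ _ _ _ eq_refl) as (t' & -> & ->). exists (LApp t t'). auto.
Qed.

Lemma sound_STEP : sound (P_STEP (eta_of R)).
Proof.
  apply Forall_app. split.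
  - repeat apply Forall_cons; try apply Forall_nil; prep; intros [H _] t y E; inv_ty.
    + destruct (H _ _ _ _ eq_refl) as (t & Et & ->). apply enc_l_inj in Et as <-.
      rewrite subst_0. eexists. split; [reflexivity|]. now constructor.
    + destruct (H _ _ eq_refl) as (t' & -> & Hs). exists (LLam t'). split; [reflexivity|now constructor].
    + destruct (H _ _ eq_refl) as (t' & -> & Hs). eexists (LApp t' _). split; [reflexivity|now constructor].
    + destruct (H _ _ eq_refl) as (t' & -> & Hs). eexists (LApp _ t'). split; [reflexivity|now constructor].
  - destruct (eta_of R) eqn:He; [|constructor].
    repeat apply Forall_cons; try apply Forall_nil; prep; intros [H _] t y E; inv_ty.
    destruct (H _ _ _ _ eq_refl) as (t & -> & Et). apply enc_l_inj in Et as ->.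
    exists t. split; auto. rewrite liftn_1_0, He. now constructor.
Qed.

Lemma sound_FREE : sound P_FREE.
Proof.
  repeat apply Forall_cons; try apply Forall_nil; prep; intros H k t E; inv_ty; simpl; auto;
    destruct H as [H _]; auto.
Qed.

Lemma sound_NF : sound P_NF.
Proof.
  repeat apply Forall_cons; try apply Forall_nil; prep; intros H t E; inv_ty; auto.
  - split; auto. intros t' H'. inversion H'.
  - destruct H as (H1 & H2 & _). destruct (H1 _ eq_refl) as [N1 N2]. specialize (H2 _ eq_refl).
    split; auto. intros t' H'. inversion H'; subst; [contradiction|eapply N1; eauto|eapply H2; eauto].
  - apply H. auto.
  - destruct H as (H1 & H2 & _). specialize (H1 _ eq_refl). specialize (H2 _ eq_refl).
    intros t' H'. inversion H'; subst; [|eapply H1; eauto].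
    eapply H2; eauto.
Qed.

Lemma sound_ETAOK : sound (P_ETAOK (eta_of R)).
Proof.
  unfold P_ETAOK. destruct (eta_of R) eqn:He;
  repeat apply Forall_cons; try apply Forall_nil; prep; intros H t E He' q; inv_ty; try congruence.
  intros [= -> ->]. destruct H as [H _].
  apply (free_0_ren_S q). now apply H.
Qed.

Lemma sound_STAR : sound P_STAR.
Proof.
  repeat apply Forall_cons; try apply Forall_nil; prep; intros H t y E; inv_ty.
  - exists t. split; [auto|constructor].
  - destruct H as (H1 & H2 & _). destruct (H1 _ _ eq_refl) as (t' & -> & Hs).
    destruct (H2 _ _ eq_refl) as (u & -> & Hs'). exists u. split; auto. econstructor; eauto.
Qed.

Lemma convR_conv t u : R <> Syn -> convR R t u <-> conv (eta_of R) t u.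
Proof. destruct R; intros; [congruence|apply convR_Beta|apply convR_BetaEta]. Qed.

Lemma sound_CONV : sound (P_CONV R).
Proof.
  assert (D : R = Syn \/ R <> Syn) by (destruct R; auto; right; discriminate).
  destruct D as [D|D].
  - rewrite D. repeat apply Forall_cons; try apply Forall_nil; prep.
    intros [H _] t u b E; inv_code. rewrite (H _ _ _ eq_refl). unfold verdict. simpl.
    destruct (Nat.eqb_spec (enc_l t) (enc_l u)) as [E|E].
    + left. apply enc_l_inj in E. auto.
    + right. split; auto. congruence.
  (* The two non-syntactic relations share this clause; they differ only through [eta_of R] in the
     clauses for steps and normal forms. *)
  - replace (P_CONV R) with (P_CONV Beta) by (destruct R; auto; congruence).
    repeat apply Forall_cons; try apply Forall_nil; prep.
    intros (H1 & H2 & H3 & H4 & H5 & _) t u b E; inv_code.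
    destruct (H1 _ _ eq_refl) as (m & -> & Hm), (H3 _ _ eq_refl) as (n & -> & Hn).
    specialize (H2 _ eq_refl). specialize (H4 _ eq_refl).
    rewrite (H5 _ _ _ eq_refl).
    apply star_conv in Hm, Hn.
    assert (C : convR R t u <-> m = n).
    { rewrite convR_conv by auto. split.
      - intros Hc. apply (normal_unique (eta_of R)); auto.
        apply rst_trans with t; [now apply rst_sym|]. apply rst_trans with u; auto.
      - intros ->. apply rst_trans with n; auto. now apply rst_sym. }
    destruct (Nat.eqb_spec (enc_l m) (enc_l n)) as [E|E].
    + left. apply enc_l_inj in E. tauto.
    + right. split; auto. rewrite C. congruence.
Qed.

Lemma inferred_0 B d : inferred th R B d 0 -> forall s, ~ typ th R B d s.
Proof. intros [[_ H]|(s & E & _)]; [exact H|discriminate]. Qed.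

Lemma inferred_S B d r : inferred th R B d (S r) ->
  exists s, r = enc_ty s /\ wf_ty th s /\ typ th R B d s.
Proof. intros [[E _]|(s & E & ?)]; [discriminate|]. injection E as ->. eauto. Qed.

Lemma wf_lookup G x s : Forall (fun p => wf_ty th (snd p)) G -> lookup x G = Some s -> wf_ty th s.
Proof.
  induction 1 as [|[y t] G H _ IH]; simpl; [discriminate|].
  destruct (x =? y); auto. intros [= ->]; auto.
Qed.

Ltac prem H B G d :=
  let E := fresh in
  match goal with HB : Equiv B G, HG : Forall _ G, Hd : wf_term th d |- _ =>
    pose proof (H B G d _ HB HG Hd eq_refl) as E; clear H;
    first [ pose proof (inferred_0 _ _ E) as H
          | let s := fresh "s" in let Es := fresh "Es" in let Ws := fresh "Ws" in
            destruct (inferred_S _ _ _ E) as (s & Es & Ws & H) ]; clear E end.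

Ltac noty :=
  let s := fresh in let Hs := fresh in
  left; split; [reflexivity|]; intros s Hs; inversion Hs; subst.

Ltac uniq HB :=
  repeat match goal with
  | H : typ _ _ ?B ?d ?s, H' : typ _ _ ?B ?d ?t |- _ =>
    lazymatch s with t => fail | _ => idtac end;
    let E := fresh in
    pose proof (typ_unique _ _ _ _ _ H (proj1 HB) _ H') as E;
    first [discriminate E | injection E as ? ?; subst | subst];
    clear H'
  end.

(** For the negative clauses, uniqueness of types is decisive: the type inferred for a subterm is
    its only one, so a wrong shape or a mismatch refutes every derivation. *)
Lemma sound_INF : sound (P_INF th).
Proof.
  repeat apply Forall_cons; try apply Forall_nil;
    [destruct (th_om th) eqn:Ho|..];
    prep; intros H B G d r HB HG Hd E; inv_ty; cbn [wf_term] in Hd; try destruct Hd as [Hd1 Hd2].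
  all: try (destruct H as [H1 H2]).
  - right. exists TOm. repeat split; auto. now constructor.
  - noty. congruence.
  - rewrite (H1 _ _ _ eq_refl). match goal with |- context [lookup ?x G] => destruct (lookup x G) as [s|] eqn:El end; simpl.
    + right. exists s. repeat split; [eapply wf_lookup; eauto|]. constructor. now apply HB.
    + noty. match goal with Hi : In _ B |- _ => apply HB in Hi end. congruence.
  - pose proof (H1 _ ((_, _) :: G) _ _ (Equiv_ext _ _ _ _ HB) (Forall_cons (_, _) Hd1 HG) Hd2 eq_refl) as H.
    pose proof (inferred_0 _ _ H) as H3. noty. eapply H3; eauto.
  - pose proof (H1 _ ((_, _) :: G) _ _ (Equiv_ext _ _ _ _ HB) (Forall_cons (_, _) Hd1 HG) Hd2 eq_refl) as H.
    destruct (inferred_S _ _ _ H) as (s & -> & Ws & Hs).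
    right. exists (TArr t s). simpl. repeat split; auto. now constructor.
  - prem H1 B G d1. noty. eapply H1; eauto.
  - prem H1 B G d2. noty. eapply H1; eauto.
  - prem H1 B G d1. inv_ty. noty. uniq HB.
  - prem H1 B G d1. inv_ty. noty. uniq HB.
  - prem H1 B G d1. inv_ty. noty. uniq HB.
  - destruct H2 as (H2 & H3 & _). prem H1 B G d1. prem H2 B G d2. eqs. inv_ty. noty. uniq HB. congruence.
  - destruct H2 as (H2 & H3 & _). prem H1 B G d1. prem H2 B G d2. eqs. inv_ty.
    right. exists s2. destruct Ws. repeat split; auto. eapply t_app; eauto.
  - prem H1 B G d1. noty. eapply H1; eauto.
  - prem H1 B G d2. noty. eapply H1; eauto.
  - destruct H2 as (H2 & H3 & _).
    pose proof (H1 [] d1 _ eq_refl) as E1. pose proof (H2 [] d2 _ eq_refl) as E2. subst.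
    specialize (H3 _ _ _ eq_refl). apply verdict_0 in H3. noty. contradiction.
  - destruct H2 as (H2 & H3 & H4 & H5 & _). prem H1 B G d1. prem H2 B G d2.
    pose proof (H3 [] d1 _ eq_refl) as E1. pose proof (H4 [] d2 _ eq_refl) as E2. subst.
    specialize (H5 _ _ _ eq_refl). apply verdict_1 in H5.
    right. exists (TCap s s0). simpl. repeat split; auto. now constructor.
  - prem H1 B G d. noty. eapply H1; eauto.
  - prem H1 B G d. inv_ty. noty. uniq HB.
  - prem H1 B G d. inv_ty. noty. uniq HB.
  - prem H1 B G d. inv_ty. noty. uniq HB.
  - prem H1 B G d. inv_ty. right. exists s1. destruct Ws. repeat split; auto. econstructor; eauto.
  - prem H1 B G d. noty. eapply H1; eauto.
  - prem H1 B G d. inv_ty. noty. uniq HB.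
  - prem H1 B G d. inv_ty. noty. uniq HB.
  - prem H1 B G d. inv_ty. noty. uniq HB.
  - prem H1 B G d. inv_ty. right. exists s2. destruct Ws. repeat split; auto. econstructor; eauto.
  - prem H1 B G d. noty. eapply H1; eauto.
  - destruct H2 as (H2 & _). prem H1 B G d. subst.
    specialize (H2 [s] _ 0 (Forall_cons _ Ws (Forall_nil _)) Hd2 eq_refl).
    apply verdict_0 in H2. rewrite LEl_single in H2 by auto. noty. uniq HB. contradiction.
  - destruct H2 as (H2 & _). prem H1 B G d. subst.
    specialize (H2 [s] _ 1 (Forall_cons _ Ws (Forall_nil _)) Hd2 eq_refl).
    apply verdict_1 in H2. rewrite LEl_single in H2 by auto.
    right. eexists. repeat split; eauto. econstructor; eauto.
Qed.

Lemma sound_ANS : sound P_ANS.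
Proof.
  repeat apply Forall_cons; try apply Forall_nil; prep.
  - intros (H1 & H2 & _) B d s b [Hn HB] Hd E. inv_code.
    pose proof (inferred_S _ _ _ (H1 B B d _ (Equiv_refl B Hn) HB Hd eq_refl)) as (s' & -> & Ws & Hs).
    rewrite (H2 _ _ _ eq_refl). destruct (Nat.eqb_spec (enc_ty s') (enc_ty s)) as [E|E].
    + apply enc_ty_inj in E as <-. now left.
    + right. split; auto. intros Hs'. apply E. now rewrite (typ_unique _ _ _ _ _ Hs Hn _ Hs').
  - intros (H1 & _) B d s b [Hn HB] Hd E. inv_code. right. split; auto.
    apply (inferred_0 _ _ (H1 B B d _ (Equiv_refl B Hn) HB Hd eq_refl)).
  - intros (H1 & _) B d b [Hn HB] Hd E. inv_code.
    apply (H1 B B d _ (Equiv_refl B Hn) HB Hd eq_refl).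
Qed.

Theorem prog_sound tag a : holds (prog th R) tag a -> I tag a.
Proof.
  apply holds_model. apply Forall_concat.
  repeat first [apply Forall_nil | apply Forall_cons;
  [first [apply sound_EQ|apply sound_LT|apply sound_ADD|apply sound_LOOK|apply sound_MEM
        |apply sound_COLL|apply sound_SUB|apply sound_IDX|apply sound_ESS|apply sound_LIFT
        |apply sound_SUBST|apply sound_STEP|apply sound_FREE|apply sound_NF|apply sound_ETAOK
        |apply sound_STAR|apply sound_CONV|apply sound_INF|apply sound_ANS]|]].
Qed.
End Sound.

(** * Totality of the program *)

Section Complete.
Variables (th : theory) (R : eqkind).
#[local] Notation P := (prog th R).
#[local] Notation H := (holds P).

Lemma group_incl G : In G (groups th R) -> incl G P.
Proof. intros HG c Hc. apply in_concat. eauto. Qed.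

Lemma clause_use G k c l : In G (groups th R) -> nth_error G k = Some c ->
  body_ok H l (c_body c) -> H (c_tag c) (ev l (c_head c)).
Proof. intros HG. apply holds_use, group_incl, HG. Qed.

Ltac in_groups := unfold groups; simpl; repeat (first [left; reflexivity | right]).

(** Applies clause number [k], counted from 0, of the group [G] under the valuation [l]; entries for
    variables absent from the clause are fillers. *)
Ltac rule G k l :=
  refine (clause_use G k _ l _ eq_refl _); [in_groups|];
  cbn [body_ok c_body fst snd ev pk nth]; repeat apply conj; try exact Logic.I.

Lemma holds_EQ x : forall y, H 0 (cpair x (cpair y (if x =? y then 1 else 0))).
Proof.
  induction x as [|x IH]; intros [|y]; simpl.
  - rule P_EQ 0 (@nil nat).
  - rule P_EQ 1 [y].
  - rule P_EQ 2 [x].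
  - rule P_EQ 3 [x; y; if x =? y then 1 else 0]. apply IH.
Qed.

Lemma holds_EQ_1 x : H 0 (cpair x (cpair x 1)).
Proof. pose proof (holds_EQ x x) as E. now rewrite Nat.eqb_refl in E. Qed.
Lemma holds_EQ_0 x y : x <> y -> H 0 (cpair x (cpair y 0)).
Proof. intros D. apply Nat.eqb_neq in D. pose proof (holds_EQ x y) as E. now rewrite D in E. Qed.

Lemma holds_LT y : forall x, H 1 (cpair x (cpair y (if x <? y then 1 else 0))).
Proof.
  induction y as [|y IH]; intros [|x].
  - rule P_LT 0 [0].
  - rule P_LT 0 [S x].
  - rule P_LT 1 [y].
  - change (S x <? S y) with (x <? y).
    rule P_LT 2 [x; y; if x <? y then 1 else 0]. apply IH.
Qed.

Lemma holds_LT_1 x y : x < y -> H 1 (cpair x (cpair y 1)).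
Proof. intros D. apply Nat.ltb_lt in D. pose proof (holds_LT y x) as E. now rewrite D in E. Qed.
Lemma holds_LT_0 x y : y <= x -> H 1 (cpair x (cpair y 0)).
Proof. intros D. apply Nat.ltb_ge in D. pose proof (holds_LT y x) as E. now rewrite D in E. Qed.

Lemma holds_ADD x y : H 2 (cpair x (cpair y (x + y))).
Proof.
  induction x as [|x IH]; simpl.
  - rule P_ADD 0 [y].
  - rule P_ADD 1 [x; y; x + y]. apply IH.
Qed.

Lemma holds_LOOK x G : H 3 (cpair x (cpair (enc_basis G) (enc_opt (lookup x G)))).
Proof.
  induction G as [|[y s] G IH]; simpl.
  - rule P_LOOK 0 [x].
  - destruct (Nat.eqb_spec x y) as [<-|D].
    + rule P_LOOK 1 [x; x; enc_ty s; enc_basis G]. apply holds_EQ_1.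
    + rule P_LOOK 2 [x; y; enc_ty s; enc_basis G; enc_opt (lookup x G)]; [now apply holds_EQ_0|exact IH].
Qed.

Lemma holds_IDX x c : H 7 (cpair x (cpair (enc_seq c) (idx c x))).
Proof.
  induction c as [|y c IH].
  - rule P_IDX 0 [x].
  - rewrite idx_cons. simpl. destruct (Nat.eqb_spec x y) as [<-|D].
    + rule P_IDX 1 [x; x; enc_seq c]. apply holds_EQ_1.
    + rule P_IDX 2 [x; y; enc_seq c; idx c x]; [now apply holds_EQ_0|exact IH].
Qed.

Lemma holds_ESS d : forall c, H 8 (cpair (enc_seq c) (cpair (enc_term d) (enc_l (ess c d)))).
Proof.
  induction d as [d IH|x|x s d IH|a IHa b IHb|a IHa b IHb|d IH|d IH|d IH s]; intros c; cbn [enc_term].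
  - rule P_ESS 0 [enc_seq c; enc_term d; enc_l (ess c d)]. apply IH.
  - replace (ess c (Var x)) with (LV (idx c x)) by (unfold idx; simpl; now destruct (find_idx x c)).
    rule P_ESS 1 [enc_seq c; x; idx c x]. apply holds_IDX.
  - rule P_ESS 2 [enc_seq c; x; enc_ty s; enc_term d; enc_l (ess (x :: c) d)]. apply (IH (x :: c)).
  - rule P_ESS 3 [enc_seq c; enc_term a; enc_term b; enc_l (ess c a); enc_l (ess c b)]; auto.
  - rule P_ESS 4 [enc_seq c; enc_term a; enc_term b; enc_l (ess c a)]. auto.
  - rule P_ESS 5 [enc_seq c; enc_term d; enc_l (ess c d)]. apply IH.
  - rule P_ESS 6 [enc_seq c; enc_term d; enc_l (ess c d)]. apply IH.
  - rule P_ESS 7 [enc_seq c; enc_term d; enc_ty s; enc_l (ess c d)]. apply IH.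
Qed.

Lemma holds_LIFT n t : forall k, H 9 (cpair n (cpair k (cpair (enc_l t) (enc_l (liftn n k t))))).
Proof.
  induction t as [i|t IH|t IHt u IHu]; intros k; simpl.
  - destruct (Nat.ltb_spec i k).
    + rule P_LIFT 0 [n; k; i]. now apply holds_LT_1.
    + rule P_LIFT 1 [n; k; i; i + n]; [now apply holds_LT_0|apply holds_ADD].
  - rule P_LIFT 2 [n; k; enc_l t; enc_l (liftn n (S k) t)]. apply IH.
  - rule P_LIFT 3 [n; k; enc_l t; enc_l u; enc_l (liftn n k t); enc_l (liftn n k u)]; auto.
Qed.

Lemma holds_SUBST u t : forall k, H 10 (cpair k (cpair (enc_l u) (cpair (enc_l t) (enc_l (subst k u t))))).
Proof.
  induction t as [i|t IH|t IHt t' IHt']; intros k; simpl.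
  - destruct (Nat.ltb_spec i k); [|destruct (Nat.eqb_spec i k) as [->|]].
    + rule P_SUBST 0 [k; enc_l u; i]. now apply holds_LT_1.
    + rule P_SUBST 1 [k; enc_l u; enc_l (liftn k 0 u)]. apply holds_LIFT.
    + destruct i as [|i]; [lia|]. rule P_SUBST 2 [k; enc_l u; i]. apply holds_LT_1. lia.
  - rule P_SUBST 3 [k; enc_l u; enc_l t; enc_l (subst (S k) u t)]. apply IH.
  - rule P_SUBST 4 [k; enc_l u; enc_l t; enc_l t'; enc_l (subst k u t); enc_l (subst k u t')]; auto.
Qed.

Lemma holds_STEP t t' : step true (eta_of R) t t' -> H 11 (cpair (enc_l t) (enc_l t')).
Proof.
  induction 1 as [t u _|t He|t t' _ IH|t t' u _ IH|t u u' _ IH]; simpl.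
  - rule (P_STEP (eta_of R)) 0 [enc_l t; enc_l u; enc_l (sb u t)].
    rewrite <- subst_0. apply holds_SUBST.
  - assert (E : nth_error (P_STEP (eta_of R)) 4 = nth_error (P_STEP true) 4) by now rewrite He.
    refine (clause_use (P_STEP (eta_of R)) 4 _ [enc_l (ren S t); enc_l t] _ E _); [in_groups|].
    cbn. split; auto. rewrite <- liftn_1_0. apply holds_LIFT.
  - rule (P_STEP (eta_of R)) 1 [enc_l t; enc_l t']. exact IH.
  - rule (P_STEP (eta_of R)) 2 [enc_l t; enc_l u; enc_l t']. exact IH.
  - rule (P_STEP (eta_of R)) 3 [enc_l t; enc_l u; enc_l u']. exact IH.
Qed.

Lemma holds_STAR t t' : star (step true (eta_of R)) t t' -> H 16 (cpair (enc_l t) (enc_l t')).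
Proof.
  induction 1 as [t|t u t' Hs _ IH].
  - rule P_STAR 0 [enc_l t].
  - rule P_STAR 1 [enc_l t; enc_l t'; enc_l u]; [now apply holds_STEP|exact IH].
Qed.

Lemma holds_FREE t : forall k, free k t -> H 12 (cpair k (enc_l t)).
Proof.
  induction t as [i|t IH|t IHt u IHu]; intros k; simpl.
  - intros ->. rule P_FREE 0 [k].
  - intros F. rule P_FREE 1 [k; enc_l t]. now apply IH.
  - intros [F|F].
    + rule P_FREE 2 [k; enc_l t; enc_l u]. auto.
    + rule P_FREE 3 [k; enc_l t; enc_l u]. auto.
Qed.

Lemma holds_ETAOK t : normal (eta_of R) (LLam t) -> H 15 (enc_l t).
Proof.
  intros Hn. destruct (eta_of R) eqn:He.
  - assert (U : forall k c l, nth_error (P_ETAOK true) k = Some c ->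
        body_ok H l (c_body c) -> H (c_tag c) (ev l (c_head c))).
    { intros k c l E. rewrite <- He in E. apply (clause_use (P_ETAOK (eta_of R)) k); [in_groups|exact E]. }
    destruct t as [i|t|t [[|i]|u|u v]]; simpl.
    + apply (U 0 _ [i] eq_refl). exact Logic.I.
    + apply (U 1 _ [enc_l t] eq_refl). exact Logic.I.
    (* If 0 were not free in [t], the abstraction would be an eta-redex, against its normality. *)
    + apply (U 5 _ [enc_l t; cpair 0 0] eq_refl). cbn. split; auto. apply holds_FREE.
      destruct (free_dec t 0) as [F|F]; auto. exfalso.
      apply (Hn (ren pred t)). rewrite (not_free_0 t F) at 1. now constructor.
    + apply (U 2 _ [enc_l t; i] eq_refl). exact Logic.I.
    + apply (U 3 _ [enc_l t; enc_l u] eq_refl). exact Logic.I.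
    + apply (U 4 _ [enc_l t; enc_l u; enc_l v] eq_refl). exact Logic.I.
  - assert (E : nth_error (P_ETAOK (eta_of R)) 0 = nth_error (P_ETAOK false) 0) by now rewrite He.
    refine (clause_use (P_ETAOK (eta_of R)) 0 _ [enc_l t] _ E _); [in_groups|exact Logic.I].
Qed.

(** The second conjunct strengthens the induction: the function part of a normal application is
    normal and not an abstraction, so it must be derived as neutral. *)
Lemma holds_NF t : normal (eta_of R) t ->
  H 14 (enc_l t) /\ match t with LLam _ => True | _ => H 13 (enc_l t) end.
Proof.
  induction t as [i|t IH|t IHt u IHu]; intros Hn.
  - assert (A : H 13 (enc_l (LV i))) by rule P_NF 0 [i].
    split; auto. rule P_NF 2 [enc_l (LV i)]. exact A.
  - split; auto. rule P_NF 3 [enc_l t]; [|now apply holds_ETAOK].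
    apply IH. intros t' Ht'. apply (Hn (LLam t')). now constructor.
  - assert (A : H 13 (enc_l (LApp t u))).
    { rule P_NF 1 [enc_l t; enc_l u].
      - destruct IHt as [_ A].
        + intros t' Ht'. apply (Hn (LApp t' u)). now constructor.
        + destruct t; auto. exfalso. apply (Hn (sb u t)). now constructor.
      - apply IHu. intros u' Hu'. apply (Hn (LApp t u')). now constructor. }
    split; auto. rule P_NF 2 [enc_l (LApp t u)]. exact A.
Qed.

Lemma holds_CONV t u : R = Syn \/ (WN (eta_of R) t /\ WN (eta_of R) u) ->
  exists b, H 17 (cpair (enc_l t) (cpair (enc_l u) b)).
Proof.
  intros D. assert (C : R = Syn \/ P_CONV R = P_CONV Beta) by (destruct R; auto).
  destruct C as [C|C].
  - exists (if enc_l t =? enc_l u then 1 else 0).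
    assert (E : nth_error (P_CONV R) 0 = nth_error (P_CONV Syn) 0) by now rewrite C.
    refine (clause_use (P_CONV R) 0 _ [enc_l t; enc_l u; _] _ E _); [in_groups|].
    split; [apply holds_EQ|exact Logic.I].
  - destruct D as [D|[(m & Hm & Hc) (n & Hn & Hd)]]; [rewrite D in C; discriminate|].
    exists (if enc_l m =? enc_l n then 1 else 0).
    assert (E : nth_error (P_CONV R) 0 = nth_error (P_CONV Beta) 0) by now rewrite C.
    refine (clause_use (P_CONV R) 0 _ [enc_l t; enc_l u; _; enc_l m; enc_l n] _ E _); [in_groups|].
    cbn. repeat split; try apply holds_NF; auto using holds_EQ; apply holds_STAR; now apply conv_normal.
Qed.

(** Splitting an intersection into two list entries must lower the measure; hence the successor at
    each node and a plain sum over the list. *)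
Fixpoint tsize (s : ty) : nat :=
  match s with TArr a b | TCap a b => S (tsize a + tsize b) | _ => 1 end.
Fixpoint lsize (L : list ty) : nat :=
  match L with [] => 0 | s :: L => tsize s + lsize L end.

Lemma holds_MEM t n : forall L, lsize L <= n ->
  exists b, H 4 (cpair (enc_ty t) (cpair (enc_tys L) b)).
Proof.
  induction n as [n IH] using lt_wf_ind. intros [|s L] Hn.
  - exists 0. rule P_MEM 0 [enc_ty t].
  - assert (C : (exists a b, s = TCap a b) \/ forall a b, s <> TCap a b)
      by (destruct s; eauto; right; discriminate).
    destruct C as [(a & b & ->)|C].
    + simpl in Hn. destruct (IH (lsize (a :: b :: L))) with (L := a :: b :: L) as [r Hr]; simpl; try lia.
      exists r. rule P_MEM 2 [enc_ty t; enc_ty a; enc_ty b; enc_tys L; r]. exact Hr.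
    + destruct (Nat.eq_dec (enc_ty t) (enc_ty s)) as [E|E].
      * exists 1. rule P_MEM 1 [enc_ty t; enc_ty s; enc_tys L]. rewrite E. apply holds_EQ_1.
      * assert (0 < tsize s) by (destruct s; simpl; lia).
        simpl in Hn. destruct (IH (lsize L)) with (L := L) as [r Hr]; try lia.
        apply holds_EQ_0 in E.
        exists r. destruct s as [i| |a b|a b]; [| | |now destruct (C a b)].
        -- rule P_MEM 3 [enc_ty t; i; enc_tys L; r]; auto.
        -- rule P_MEM 4 [enc_ty t; 0; enc_tys L; r]; auto.
        -- rule P_MEM 5 [enc_ty t; enc_ty a; enc_tys L; r; enc_ty b]; auto.
Qed.

(** At an arrow the list of targets is no larger than [L], and [b] is smaller than the arrow. A
    query of [a] against a source [c] is smaller too, since [c] is a proper part of [L]. *)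
Lemma holds_SUB n : forall L t, Forall (wf_ty th) L -> wf_ty th t -> lsize L + tsize t <= n ->
  exists b, H 6 (cpair (enc_tys L) (cpair (enc_ty t) b)).
Proof.
  induction n as [n IH] using lt_wf_ind. intros L t HL Ht Hn.
  destruct t as [i| |a b|a b]; simpl in Hn.
  - destruct (holds_MEM (TAtom i) _ L (le_n _)) as [r Hr]. exists r.
    rule (P_SUB th) 0 [enc_tys L; i; r]. exact Hr.
  - exists 1. rule (P_SUB th) 1 [enc_tys L].
  - destruct (th_arr th) eqn:Ha.
    + destruct Ht as [Hta Htb].
      (* An inner induction on [m] for [COLL]; the bound by [lsize L] keeps its calls to [SUB] below
         the outer measure. *)
      assert (HC : forall m L', Forall (wf_ty th) L' -> lsize L' <= m -> lsize L' <= lsize L ->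
        exists M, H 5 (cpair (enc_tys L') (cpair (enc_ty a) (enc_tys M))) /\
          Forall (wf_ty th) M /\ lsize M <= lsize L').
      { induction m as [m IHm] using lt_wf_ind. intros [|s L'] HL' Hm HLL; simpl in *.
        - exists []. repeat split; auto. rule P_COLL 0 [enc_ty a].
        - inversion HL' as [|? ? Hs HL'']; subst.
          assert (0 < tsize s) by (destruct s; simpl; lia).
          destruct s as [i| |c d|c d]; simpl in *.
          + destruct (IHm (lsize L')) with (L' := L') as (M & HM & WM & SM); try lia; auto.
            exists M. repeat split; auto; try lia.
            rule P_COLL 4 [i; 0; enc_tys L'; enc_ty a; enc_tys M]. exact HM.
          + destruct (IHm (lsize L')) with (L' := L') as (M & HM & WM & SM); try lia; auto.
            exists M. repeat split; auto; try lia.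
            rule P_COLL 5 [0; 0; enc_tys L'; enc_ty a; enc_tys M]. exact HM.
          + destruct (IHm (lsize L')) with (L' := L') as (M & HM & WM & SM); try lia; auto.
            destruct Hs as [Hc Hd].
            assert (Wa : Forall (wf_ty th) [a]) by auto.
            destruct (IH (tsize a + tsize c)) with (L := [a]) (t := c) as [r Hr]; simpl; auto; try lia.
            (* Soundness is what tells that the answer [r] is 1 or 0, and thus which clause
               applies. *)
            pose proof (prog_sound _ _ _ _ Hr [a] c r Wa Hc eq_refl) as [[-> _]|[-> _]].
            * exists (d :: M). repeat split; auto; try (simpl; lia).
              rule P_COLL 2 [enc_ty c; enc_ty d; enc_tys L'; enc_ty a; enc_tys M]; auto.
            * exists M. repeat split; auto; try lia.
              rule P_COLL 3 [enc_ty c; enc_ty d; enc_tys L'; enc_ty a; enc_tys M]; auto.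
          + destruct Hs as [Hc Hd].
            destruct (IHm (lsize (c :: d :: L'))) with (L' := c :: d :: L')
              as (M & HM & WM & SM); simpl; try lia; auto.
            exists M. simpl in SM. repeat split; auto; try lia.
            rule P_COLL 1 [enc_ty c; enc_ty d; enc_tys L'; enc_ty a; enc_tys M]. exact HM. }
      destruct (HC _ L HL (le_n _) (le_n _)) as (M & HM & WM & SM).
      destruct (IH (lsize M + tsize b)) with (L := M) (t := b) as [r Hr]; auto; try lia.
      exists r.
      assert (E : nth_error (P_SUB th) 5 = nth_error (P_SUB BCD) 5) by (simpl; now rewrite Ha).
      refine (clause_use (P_SUB th) 5 _ [enc_tys L; enc_ty a; enc_ty b; r; enc_tys M] _ E _); [in_groups|].
      cbn. auto.
    + destruct (holds_MEM (TArr a b) _ L (le_n _)) as [r Hr]. exists r.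
      assert (E : nth_error (P_SUB th) 5 = nth_error (P_SUB CD) 5) by (simpl; now rewrite Ha).
      refine (clause_use (P_SUB th) 5 _ [enc_tys L; enc_ty a; enc_ty b; r] _ E _); [in_groups|].
      cbn. auto.
  - destruct Ht as [Hta Htb].
    destruct (IH (lsize L + tsize a)) with (L := L) (t := a) as [r Hr]; auto; try lia.
    destruct (IH (lsize L + tsize b)) with (L := L) (t := b) as [r' Hr']; auto; try lia.
    pose proof (prog_sound _ _ _ _ Hr L a r HL Hta eq_refl) as [[-> _]|[-> _]];
    [pose proof (prog_sound _ _ _ _ Hr' L b r' HL Htb eq_refl) as [[-> _]|[-> _]]|].
    + exists 1. rule (P_SUB th) 2 [enc_tys L; enc_ty a; enc_ty b]; auto.
    + exists 0. rule (P_SUB th) 4 [enc_tys L; enc_ty a; enc_ty b]; auto.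
    + exists 0. rule (P_SUB th) 3 [enc_tys L; enc_ty a; enc_ty b]; auto.
Qed.

Hypothesis HR : R = Syn \/ th_om th = false.

Lemma typ_WN_R B d s : R <> Syn -> typ th R B d s -> WN (eta_of R) (essence d).
Proof.
  intros D. destruct HR as [?|Ho]; [contradiction|].
  apply typ_WN; auto. intros t u. now apply convR_conv.
Qed.

(** Only the existence of some answer is at stake, correctness being settled by [prog_sound], which
    also supplies the case distinctions on the answers for subterms. *)
Lemma holds_INF d : forall B G, Equiv B G -> Forall (fun p => wf_ty th (snd p)) G -> wf_term th d ->
  exists r, H 18 (cpair (enc_basis G) (cpair (enc_term d) r)).
Proof.
  induction d as [d IH|x|x s d IH|a IHa b IHb|a IHa b IHb|d IH|d IH|d IH s];
    intros B G HB HG Hd; cbn [enc_term]; set (g := enc_basis G).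
  - exists (if th_om th then S (cpair 1 0) else 0).
    replace (if th_om th then S (cpair 1 0) else 0)
      with (ev [g; enc_term d] (if th_om th then PS pOm else PZ)) by (destruct (th_om th); reflexivity).
    rule (P_INF th) 0 [g; enc_term d].
  - exists (enc_opt (lookup x G)). rule (P_INF th) 1 [g; x; enc_opt (lookup x G)]. apply holds_LOOK.
  - destruct Hd as [Hs Hd].
    destruct (IH _ _ (Equiv_ext _ _ x s HB) (Forall_cons (x, s) Hs HG) Hd) as [[|r] Hr].
    + exists 0. rule (P_INF th) 2 [g; x; enc_ty s; enc_term d]. exact Hr.
    + exists (S (cpair 2 (cpair (enc_ty s) r))).
      rule (P_INF th) 3 [g; x; enc_ty s; enc_term d; r]. exact Hr.
  - destruct Hd as [Ha Hb].
    destruct (IHa B G HB HG Ha) as [r Hr], (IHb B G HB HG Hb) as [r' Hr'].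
    destruct r' as [|r'].
    { exists 0. rule (P_INF th) 5 [g; enc_term a; enc_term b]. exact Hr'. }
    pose proof (prog_sound _ _ _ _ Hr B G a r HB HG Ha eq_refl) as [[-> _]|(s & -> & Ws & Hs)].
    { exists 0. rule (P_INF th) 4 [g; enc_term a; enc_term b]. exact Hr. }
    destruct s as [i| |s t|s t]; simpl in Hr.
    + exists 0. rule (P_INF th) 6 [g; enc_term a; enc_term b; i]. exact Hr.
    + exists 0. rule (P_INF th) 7 [g; enc_term a; enc_term b]. exact Hr.
    + destruct (Nat.eq_dec (enc_ty s) r') as [<-|E].
      * exists (S (enc_ty t)).
        rule (P_INF th) 10 [g; enc_term a; enc_term b; enc_ty s; enc_ty t; enc_ty s]; auto.
        apply holds_EQ_1.
      * exists 0.
        rule (P_INF th) 9 [g; enc_term a; enc_term b; enc_ty s; enc_ty t; r']; auto.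
        now apply holds_EQ_0.
    + exists 0. rule (P_INF th) 8 [g; enc_term a; enc_term b; enc_ty s; enc_ty t]. exact Hr.
  - destruct Hd as [Ha Hb].
    destruct (IHa B G HB HG Ha) as [r Hr], (IHb B G HB HG Hb) as [r' Hr'].
    pose proof (prog_sound _ _ _ _ Hr B G a r HB HG Ha eq_refl) as [[-> _]|(s & -> & Ws & Hs)].
    { exists 0. rule (P_INF th) 11 [g; enc_term a; enc_term b]. exact Hr. }
    pose proof (prog_sound _ _ _ _ Hr' B G b r' HB HG Hb eq_refl) as [[-> _]|(t & -> & Wt & Ht)].
    { exists 0. rule (P_INF th) 12 [g; enc_term a; enc_term b]. exact Hr'. }
    (* Both components are typable at this point, so their essences have normal forms unless [R] is
       syntactic identity. *)
    destruct (holds_CONV (essence a) (essence b)) as [v Hv].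
    { destruct R eqn:E; auto; rewrite <- E in *; right; split; eapply typ_WN_R; eauto;
        rewrite E; discriminate. }
    pose proof (holds_ESS a []) as Ea. pose proof (holds_ESS b []) as Eb.
    pose proof (prog_sound _ _ _ _ Hv _ _ v eq_refl) as [[-> _]|[-> _]].
    + exists (S (cpair 3 (cpair (enc_ty s) (enc_ty t)))).
      rule (P_INF th) 14 [g; enc_term a; enc_term b; enc_l (essence a); enc_l (essence b); enc_ty s; enc_ty t];
        auto.
    + exists 0. rule (P_INF th) 13 [g; enc_term a; enc_term b; enc_l (essence a); enc_l (essence b)]; auto.
  - destruct (IH B G HB HG Hd) as [r Hr].
    pose proof (prog_sound _ _ _ _ Hr B G d r HB HG Hd eq_refl) as [[-> _]|(s & -> & Ws & Hs)].
    { exists 0. rule (P_INF th) 15 [g; enc_term d]. exact Hr. }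
    destruct s as [i| |s t|s t]; simpl in Hr.
    + exists 0. rule (P_INF th) 16 [g; enc_term d; 0; i]. exact Hr.
    + exists 0. rule (P_INF th) 17 [g; enc_term d]. exact Hr.
    + exists 0. rule (P_INF th) 18 [g; enc_term d; 0; enc_ty s; enc_ty t]. exact Hr.
    + exists (S (enc_ty s)). rule (P_INF th) 19 [g; enc_term d; 0; enc_ty s; enc_ty t]. exact Hr.
  - destruct (IH B G HB HG Hd) as [r Hr].
    pose proof (prog_sound _ _ _ _ Hr B G d r HB HG Hd eq_refl) as [[-> _]|(s & -> & Ws & Hs)].
    { exists 0. rule (P_INF th) 20 [g; enc_term d]. exact Hr. }
    destruct s as [i| |s t|s t]; simpl in Hr.
    + exists 0. rule (P_INF th) 21 [g; enc_term d; 0; i]. exact Hr.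
    + exists 0. rule (P_INF th) 22 [g; enc_term d]. exact Hr.
    + exists 0. rule (P_INF th) 23 [g; enc_term d; 0; enc_ty s; enc_ty t]. exact Hr.
    + exists (S (enc_ty t)). rule (P_INF th) 24 [g; enc_term d; 0; enc_ty s; enc_ty t]. exact Hr.
  - destruct Hd as [Hd Hs].
    destruct (IH B G HB HG Hd) as [r Hr].
    pose proof (prog_sound _ _ _ _ Hr B G d r HB HG Hd eq_refl) as [[-> _]|(t & -> & Wt & Ht)].
    { exists 0. rule (P_INF th) 25 [g; enc_term d; enc_ty s]. exact Hr. }
    assert (Wl : Forall (wf_ty th) [t]) by auto.
    destruct (holds_SUB _ [t] s Wl Hs (le_n _)) as [v Hv].
    pose proof (prog_sound _ _ _ _ Hv [t] s v Wl Hs eq_refl) as [[-> _]|[-> _]].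
    + exists (S (enc_ty s)). rule (P_INF th) 27 [g; enc_term d; enc_ty s; enc_ty t]; auto.
    + exists 0. rule (P_INF th) 26 [g; enc_term d; enc_ty s; enc_ty t]; auto.
Qed.

Lemma verdict_unique b c Q : verdict b Q -> verdict c Q -> b = c.
Proof. intros [[]|[]] [[]|[]]; congruence || contradiction. Qed.

Lemma inferred_unique B d r r' : NoDup (map fst B) ->
  inferred th R B d r -> inferred th R B d r' -> r = r'.
Proof.
  intros Hn [[-> A]|(s & -> & _ & A)] [[-> A']|(s' & -> & _ & A')]; auto.
  - now apply A in A'.
  - now apply A' in A.
  - now rewrite (typ_unique _ _ _ _ _ A Hn _ A').
Qed.

Theorem TC_dec : TC_decidable th R.
Proof.
  exists (compute P 19). intros B d s HB Hd Hs c.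
  destruct (holds_INF d B B (Equiv_refl B (proj1 HB)) (proj2 HB) Hd) as [r Hr].
  assert (A : exists b, H 19 (cpair c b)).
  { destruct r as [|r].
    - exists 0. rule P_ANS 1 [enc_basis B; enc_term d; enc_ty s]. exact Hr.
    - exists (if r =? enc_ty s then 1 else 0).
      rule P_ANS 0 [enc_basis B; enc_term d; enc_ty s; if r =? enc_ty s then 1 else 0; r];
        [exact Hr|apply holds_EQ]. }
  destruct A as [b Hb].
  pose proof (prog_sound _ _ _ _ Hb B d s b HB Hd eq_refl) as V.
  assert (E : eval (compute P 19) [c] b).
  { apply compute_correct; auto. intros b' Hb'. eapply verdict_unique; [|exact V].
    exact (prog_sound _ _ _ _ Hb' B d s b' HB Hd eq_refl). }
  destruct V as [[-> V]|[-> V]]; split; auto; contradiction.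
Qed.

Theorem TR_dec : TR_decidable th R.
Proof.
  exists (compute P 20). intros B d HB Hd c.
  destruct (holds_INF d B B (Equiv_refl B (proj1 HB)) (proj2 HB) Hd) as [r Hr].
  assert (Hq : H 20 (cpair c r)) by (rule P_ANS 2 [enc_basis B; enc_term d; r]; exact Hr).
  pose proof (prog_sound _ _ _ _ Hq B d r HB Hd eq_refl) as V.
  assert (E : eval (compute P 20) [c] r).
  { apply compute_correct; auto. intros r' Hr'.
    eapply inferred_unique; [exact (proj1 HB)| |exact V].
    exact (prog_sound _ _ _ _ Hr' B d r' HB Hd eq_refl). }
  destruct V as [[-> V]|(s & -> & _ & V)]; split; auto.
  - intros (s & Hs). now apply V in Hs.
  - intros A. now apply A in V.
  - eauto.
Qed.
End Complete.

Theorem decidable_systems th R : R = Syn \/ th_om th = false -> decidable_sys th R.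
Proof. split; [now apply TC_dec|now apply TR_dec]. Qed.

(** * Lambda-definability and undecidability *)

#[local] Instance conv_equiv e : Equivalence (conv e).
Proof.
  split; [exact (rst_refl _ _)|exact (rst_sym _ _)|exact (rst_trans _ _)].
Qed.

(** Rewriting inside applications suffices: the computations with encoded functions never reduce
    under a binder. *)
#[local] Instance conv_app_proper e : Proper (conv e ==> conv e ==> conv e) LApp.
Proof. intros t t' Ht u u' Hu. now apply conv_app. Qed.

Fixpoint cl (n : nat) (t : lterm) : Prop :=
  match t with
  | LV i => i < n
  | LLam b => cl (S n) b
  | LApp a b => cl n a /\ cl n b
  end.

Lemma cl_mono t : forall n m, n <= m -> cl n t -> cl m t.
Proof.
  induction t; simpl; intros n' m Hnm H.
  - lia.
  - revert H. apply IHt. lia.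
  - destruct H. eauto.
Qed.

Lemma cl0 t n : cl 0 t -> cl n t.
Proof. apply cl_mono. lia. Qed.

Lemma cl_inst t : forall n s, cl n t -> (forall i, i < n -> s i = LV i) -> inst s t = t.
Proof.
  induction t; simpl; intros n' s H Hs.
  - now apply Hs.
  - f_equal. apply (IHt (S n')); auto. intros [|i] Hi; simpl; auto. rewrite Hs; [reflexivity|lia].
  - f_equal; [apply (IHt1 n')|apply (IHt2 n')]; tauto.
Qed.

Lemma cl_inst0 t s : cl 0 t -> inst s t = t.
Proof. intros H. apply (cl_inst t 0); auto. intros; lia. Qed.

Lemma cl_ren0 t f : cl 0 t -> ren f t = t.
Proof. intros H. rewrite ren_as_inst. now apply cl_inst0. Qed.

(* Scott numerals and Scott lists; [num 0] is also the empty list. *)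
Fixpoint num (n : nat) : lterm :=
  match n with
  | 0 => LLam (LLam (LV 1))
  | S n => LLam (LLam (LApp (LV 0) (num n)))
  end.

(** No lifting of [a] and [l]: they are meant to be closed. *)
Definition lcons (a l : lterm) : lterm := LLam (LLam (LApp (LApp (LV 0) a) l)).

Fixpoint lvec (v : list nat) : lterm :=
  match v with [] => num 0 | x :: v => lcons (num x) (lvec v) end.

Definition tsucc : lterm := LLam (LLam (LLam (LApp (LV 0) (LV 2)))).
Definition tcons : lterm := LLam (LLam (LLam (LLam (LApp (LApp (LV 0) (LV 3)) (LV 2))))).
(** Half of Curry's fixed-point combinator applied to [F], which is closed and hence not lifted. *)
Definition thalf (F : lterm) : lterm := LLam (LApp F (LApp (LV 0) (LV 0))).
Definition tfix (F : lterm) : lterm := LApp (thalf F) (thalf F).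

Lemma cl_num n : cl 0 (num n).
Proof. induction n; simpl; repeat split; try lia. now apply (cl0 (num n) 2). Qed.

Lemma cl_lcons a l : cl 0 a -> cl 0 l -> cl 0 (lcons a l).
Proof. intros. simpl. repeat split; try lia; now apply cl0. Qed.

Lemma cl_lvec v : cl 0 (lvec v).
Proof.
  induction v; [apply cl_num|]. apply cl_lcons; auto using cl_num.
Qed.

Lemma cl_tfix F : cl 0 F -> cl 0 (tfix F).
Proof. intros H. simpl. repeat split; try lia; now apply cl0. Qed.

Ltac closed_rw := repeat match goal with
  | |- context [inst ?s ?t] => rewrite (cl_inst0 t s) by auto using cl_num, cl_lvec, cl_tfix, cl_lcons
  | |- context [ren ?f ?t] => rewrite (cl_ren0 t f) by auto using cl_num, cl_lvec, cl_tfix, cl_lcons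
  end.
Ltac bstep := rewrite conv_beta; unfold sb; cbn [inst ups scons ren]; closed_rw.

Lemma num_0_case e a b : conv e (LApp (LApp (num 0) a) b) a.
Proof.
  cbn [num]. bstep. rewrite conv_beta. unfold sb. cbn [inst ups scons ren].
  rewrite inst_ren, inst_LV; reflexivity.
Qed.

Lemma num_S_case e n a b : conv e (LApp (LApp (num (S n)) a) b) (LApp b (num n)).
Proof. cbn [num]. bstep. bstep. reflexivity. Qed.

Lemma lcons_case e a l x y : cl 0 a -> cl 0 l ->
  conv e (LApp (LApp (lcons a l) x) y) (LApp (LApp y a) l).
Proof. intros. unfold lcons. bstep. bstep. reflexivity. Qed.

Lemma tsucc_num e n : conv e (LApp tsucc (num n)) (num (S n)).
Proof. unfold tsucc. bstep. reflexivity. Qed.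

Lemma tcons_lcons e a l : cl 0 a -> cl 0 l -> conv e (LApp (LApp tcons a) l) (lcons a l).
Proof. intros. unfold tcons. bstep. bstep. reflexivity. Qed.

Lemma tfix_unfold e F : cl 0 F -> conv e (tfix F) (LApp F (tfix F)).
Proof.
  intros. unfold tfix at 1. unfold thalf at 1. bstep. reflexivity.
Qed.

(** With names: [fun r v => v 0 (fun n w => n (F w) (fun m => G (m :: r (m :: w) :: w)))]. The list
    is opened first, then its head [n]. *)
Definition prim_body (F G : lterm) : lterm :=
  LLam (LLam (LApp (LApp (LV 0) (num 0)) (LLam (LLam
    (LApp (LApp (LV 1) (LApp F (LV 0)))
      (LLam (LApp G (LApp (LApp tcons (LV 0))
        (LApp (LApp tcons (LApp (LV 4) (LApp (LApp tcons (LV 0)) (LV 1)))) (LV 1)))))))))).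

(** With names: [fun r v n => F (n :: v) n (fun _ => r v (S n))]. A zero value returns [n]; any
    other value continues the search. *)
Definition min_body (F : lterm) : lterm :=
  LLam (LLam (LLam (LApp (LApp (LApp F (LApp (LApp tcons (LV 0)) (LV 1))) (LV 0))
    (LLam (LApp (LApp (LV 3) (LV 2)) (LApp tsucc (LV 1))))))).

Fixpoint tproj (i : nat) : lterm :=
  match i with
  | 0 => LLam (LApp (LApp (LV 0) (num 0)) (LLam (LLam (LV 1))))
  | S i => LLam (LApp (tproj i) (LApp (LApp (LV 0) (num 0)) (LLam (LLam (LV 0)))))
  end.

Fixpoint mterm (f : mu) : lterm :=
  match f with
  | MZero => LLam (num 0)
  | MSucc => LLam (LApp (LApp (LV 0) (num 0)) (LLam (LLam (LApp tsucc (LV 1)))))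
  | MProj i => tproj i
  | MComp f gs =>
      LLam (LApp (mterm f) (LApp
        ((fix go gs := match gs with
          | [] => LLam (num 0)
          | g :: gs => LLam (LApp (LApp tcons (LApp (mterm g) (LV 0))) (LApp (go gs) (LV 0)))
          end) gs) (LV 0)))
  | MPrimRec f g => tfix (prim_body (mterm f) (mterm g))
  | MMin f => LLam (LApp (LApp (tfix (min_body (mterm f))) (LV 0)) (num 0))
  end.

Fixpoint mterms (gs : list mu) : lterm :=
  match gs with
  | [] => LLam (num 0)
  | g :: gs => LLam (LApp (LApp tcons (LApp (mterm g) (LV 0))) (LApp (mterms gs) (LV 0)))
  end.

Lemma mterm_comp f gs : mterm (MComp f gs) = LLam (LApp (mterm f) (LApp (mterms gs) (LV 0))).
Proof. reflexivity. Qed.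

Section MuInd.
Variable Q : mu -> Prop.
Hypothesis q_zero : Q MZero.
Hypothesis q_succ : Q MSucc.
Hypothesis q_proj : forall i, Q (MProj i).
Hypothesis q_comp : forall f gs, Q f -> Forall Q gs -> Q (MComp f gs).
Hypothesis q_prim : forall f g, Q f -> Q g -> Q (MPrimRec f g).
Hypothesis q_min : forall f, Q f -> Q (MMin f).

Fixpoint mu_nested_ind (f : mu) : Q f :=
  match f with
  | MZero => q_zero
  | MSucc => q_succ
  | MProj i => q_proj i
  | MComp f gs => q_comp f gs (mu_nested_ind f)
      ((fix go gs : Forall Q gs := match gs with
        | [] => Forall_nil Q
        | g :: gs => Forall_cons g (mu_nested_ind g) (go gs)
        end) gs)
  | MPrimRec f g => q_prim f g (mu_nested_ind f) (mu_nested_ind g)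
  | MMin f => q_min f (mu_nested_ind f)
  end.
End MuInd.

Lemma cl_prim_body F G : cl 0 F -> cl 0 G -> cl 0 (prim_body F G).
Proof. intros; simpl; repeat split; try lia; now apply cl0. Qed.

Lemma cl_min_body F : cl 0 F -> cl 0 (min_body F).
Proof. intros; simpl; repeat split; try lia; now apply cl0. Qed.

Lemma cl_tproj i : cl 0 (tproj i).
Proof. induction i; simpl; repeat split; try lia. now apply cl0. Qed.

Lemma cl_mterm f : cl 0 (mterm f).
Proof.
  induction f using mu_nested_ind.
  - simpl; lia.
  - simpl; lia.
  - apply cl_tproj.
  - rewrite mterm_comp. simpl. repeat split; try lia; apply cl0; auto.
    induction H as [|g gs Hg _ IH]; simpl; repeat split; try lia; now apply cl0.
  - apply cl_tfix. now apply cl_prim_body.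
  - assert (C : cl 0 (tfix (min_body (mterm f)))) by now apply cl_tfix, cl_min_body.
    apply (cl0 _ 1) in C. cbn [mterm cl]. split; [split; [exact C|lia]|apply cl0, cl_num].
Qed.

Lemma cl_mterms gs : cl 0 (mterms gs).
Proof. induction gs; simpl; repeat split; try lia; apply cl0; auto using cl_mterm. Qed.

Lemma prim_unfold e F G v : cl 0 F -> cl 0 G -> cl 0 v ->
  let r := tfix (prim_body F G) in
  conv e (LApp r v)
    (LApp (LApp v (num 0)) (LLam (LLam
    (LApp (LApp (LV 1) (LApp F (LV 0)))
      (LLam (LApp G (LApp (LApp tcons (LV 0))
        (LApp (LApp tcons (LApp r (LApp (LApp tcons (LV 0)) (LV 1)))) (LV 1))))))))).
Proof.
  intros HF HG Hv r. unfold r at 1.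
  pose proof (cl_prim_body F G HF HG) as HB. pose proof (cl_tfix _ HB) as HR.
  rewrite tfix_unfold by auto. fold r. unfold prim_body. unfold r in *.
  (* The fixed point is made abstract so that simplification does not unfold it again; only its
     closedness is used. *)
  set (q := tfix (prim_body F G)) in *. clearbody q.
  assert (cl 0 tcons) by (simpl; lia).
  bstep. bstep. reflexivity.
Qed.

Lemma min_unfold e F v n : cl 0 F -> cl 0 v ->
  let r := tfix (min_body F) in
  conv e (LApp (LApp r v) (num n))
    (LApp (LApp (LApp F (LApp (LApp tcons (num n)) v)) (num n))
      (LLam (LApp (LApp r v) (LApp tsucc (num n))))).
Proof.
  intros HF Hv r. unfold r at 1.
  pose proof (cl_min_body F HF) as HB. pose proof (cl_tfix _ HB) as HR.
  rewrite tfix_unfold by auto. fold r. unfold min_body. unfold r in *.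
  set (q := tfix (min_body F)) in *. clearbody q.
  assert (cl 0 tcons) by (simpl; lia). assert (cl 0 tsucc) by (simpl; lia).
  bstep. bstep. bstep. reflexivity.
Qed.

(** Divergence need not be reflected: an assumed decision procedure converges on the relevant
    codes. *)
Definition represents (e : bool) (f : mu) : Prop :=
  forall v y, eval f v y -> conv e (LApp (mterm f) (lvec v)) (num y).

Lemma represents_prim e f g : represents e f -> represents e g -> represents e (MPrimRec f g).
Proof.
  intros Hf Hg v y Hv.
  pose proof (cl_mterm f) as Cf. pose proof (cl_mterm g) as Cg.
  pose proof (cl_tfix _ (cl_prim_body _ _ Cf Cg)) as CR.
  assert (Ct : cl 0 tcons) by (simpl; lia).
  assert (Hn : exists n w, v = n :: w) by (inversion Hv; eauto).
  destruct Hn as (n & w & ->). revert y Hv. cbn [mterm].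
  induction n as [|n IH]; intros y Hv; inversion Hv; subst; cbn [lvec];
    rewrite prim_unfold by (auto; apply (cl_lvec (_ :: w)));
    rewrite lcons_case by auto using cl_num, cl_lvec;
    set (rr := tfix (prim_body (mterm f) (mterm g))) in *; clearbody rr;
    bstep; bstep.
  - rewrite num_0_case. now apply Hf.
  - rewrite num_S_case. bstep.
    rewrite (tcons_lcons _ (num n) (lvec w)) by auto using cl_num, cl_lvec.
    match goal with Hr : eval (MPrimRec f g) (n :: w) _ |- _ => rewrite (IH _ Hr) end.
    rewrite (tcons_lcons _ (num _) (lvec w)) by auto using cl_num, cl_lvec.
    rewrite tcons_lcons by (auto using cl_num; apply (cl_lvec (_ :: w))).
    match goal with Hr : eval g (?a :: ?b :: ?c) _ |- _ => apply (Hg _ _ Hr) end.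
Qed.

Lemma represents_min e f : represents e f -> represents e (MMin f).
Proof.
  intros Hf v y Hv. inversion Hv as [| | | | | |f' v' n H0 Hlt]; subst.
  pose proof (cl_mterm f) as Cf.
  pose proof (cl_tfix _ (cl_min_body _ Cf)) as CR.
  cbn [mterm]. bstep.
  (* Induction on the distance [k] from the current candidate [m] to the least zero [y]. *)
  assert (G : forall k m, m + k = y ->
    conv e (LApp (LApp (tfix (min_body (mterm f))) (lvec v)) (num m)) (num y)).
  { induction k as [|k IH]; intros m Hm;
      rewrite min_unfold by auto using cl_lvec;
      rewrite tcons_lcons by auto using cl_num, cl_lvec.
    - rewrite Nat.add_0_r in Hm. subst m.
      rewrite (Hf _ _ H0 : conv e (LApp (mterm f) (lcons (num y) (lvec v))) _).
      apply num_0_case.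
    - destruct (Hlt m) as [j Hj]; [lia|].
      rewrite (Hf _ _ Hj : conv e (LApp (mterm f) (lcons (num m) (lvec v))) _).
      rewrite num_S_case.
      assert (Cs : cl 0 tsucc) by (simpl; lia).
      set (r := tfix (min_body (mterm f))) in *. clearbody r.
      bstep. rewrite tsucc_num. apply IH. lia. }
  apply (G y 0). lia.
Qed.

Lemma represents_proj e i : forall v y, nth_error v i = Some y ->
  conv e (LApp (tproj i) (lvec v)) (num y).
Proof.
  induction i as [|i IH]; intros [|x v] y E; try discriminate; cbn [tproj lvec].
  - injection E as ->. bstep.
    rewrite lcons_case by auto using cl_num, cl_lvec. bstep. bstep. reflexivity.
  - pose proof (cl_tproj i) as Ci. bstep.
    rewrite lcons_case by auto using cl_num, cl_lvec. bstep. bstep. now apply IH.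
Qed.

Theorem mu_representable e f : represents e f.
Proof.
  induction f as [| |i|f gs IHf IHgs|f g IHf IHg|f IHf] using mu_nested_ind.
  - intros v y H. inversion H; subst. cbn [mterm]. bstep. reflexivity.
  - intros v y H. inversion H; subst. cbn [mterm lvec].
    assert (Cs : cl 0 tsucc) by (simpl; lia). bstep.
    rewrite lcons_case by auto using cl_num, cl_lvec. bstep. bstep. apply tsucc_num.
  - intros v y H. inversion H; subst. now apply represents_proj.
  - intros v y H. inversion H as [| | |f' gs' v' ys y' Hgs Hf| | |]; subst.
    rewrite mterm_comp. pose proof (cl_mterm f) as Cf. pose proof (cl_mterms gs) as Cg. bstep.
    assert (G : conv e (LApp (mterms gs) (lvec v)) (lvec ys)).
    { clear Hf H Cg. revert ys Hgs.
      induction IHgs as [|g gs Hg _ IH]; intros ys Hgs; inversion Hgs; subst; cbn [mterms lvec].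
      - bstep. reflexivity.
      - pose proof (cl_mterm g) as Cg. pose proof (cl_mterms gs) as Cgs.
        assert (Ct : cl 0 tcons) by (simpl; lia). bstep.
        match goal with Hr : eval g v _ |- _ => rewrite (Hg _ _ Hr) end.
        rewrite IH by eassumption. apply tcons_lcons; auto using cl_num, cl_lvec. }
    rewrite G. now apply IHf.
  - now apply represents_prim.
  - now apply represents_min.
Qed.

(** Turns a closed pure term into a Delta-term with that essence. A binder at depth [n] is named
    [n], so names do not clash. The annotations only have to be well formed: the result is used
    under [U], where it need not be typable. *)
Fixpoint name (n : nat) (t : lterm) : dterm :=
  match t with
  | LV i => Var (n - S i)
  | LLam b => Lam n TOm (name (S n) b)
  | LApp a b => App (name n a) (name n b)
  end.

Fixpoint downto (n : nat) : list nat := match n with 0 => [] | S n => n :: downto n end.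

Lemma idx_downto n : forall i, i < n -> idx (downto n) (n - S i) = i.
Proof.
  induction n as [|n IH]; intros i Hi; [lia|]. cbn [downto]. rewrite idx_cons.
  destruct i as [|i].
  - rewrite Nat.sub_succ, Nat.sub_0_r, Nat.eqb_refl. reflexivity.
  - destruct (Nat.eqb_spec (S n - S (S i)) n); [lia|]. f_equal. apply IH. lia.
Qed.

Lemma ess_name t : forall n, cl n t -> ess (downto n) (name n t) = t.
Proof.
  induction t as [i|t IH|t IHt u IHu]; intros n H; cbn [name].
  - pose proof (idx_downto n i H) as E. unfold idx in E. cbn [ess].
    destruct (find_idx _ _); congruence.
  - simpl. f_equal. apply (IH (S n) H).
  - simpl. destruct H. f_equal; auto.
Qed.

Lemma wf_name th t : th_om th = true -> forall n, wf_term th (name n t).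
Proof. intros Ho. induction t; simpl; auto. Qed.

(** Unlike [name 0 (num n)], the names do not depend on the depth, so the code of [dnum n] arises by
    iterating one arithmetic operation. *)
Fixpoint dnum (n : nat) : dterm :=
  match n with
  | 0 => Lam 0 TOm (Lam 1 TOm (Var 0))
  | S n => Lam 0 TOm (Lam 1 TOm (App (Var 1) (dnum n)))
  end.

Lemma ess_dnum n : forall c, ess c (dnum n) = num n.
Proof. induction n; intros c; simpl; [reflexivity|]. now rewrite IHn. Qed.

Lemma wf_dnum th n : th_om th = true -> wf_term th (dnum n).
Proof. intros Ho. induction n; simpl; auto. Qed.

(** * The diagonal argument *)

Lemma num_0_neq e : ~ conv e (num 0) (LLam (LLam (LV 0))).
Proof.
  intros H. apply normal_unique in H; [discriminate| |]; intros t Ht.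
  - inversion Ht; subst. inversion H1; subst. inversion H2.
  - inversion Ht; subst. inversion H1; subst. inversion H2.
Qed.

(** A positive answer may be any successor, so that the value 1 of type checking and the code of a
    type returned by reconstruction are both covered. *)
Theorem conversion_undecidable e th (g : mu) : th_om th = true ->
  ~ forall d, wf_term th d -> let n := enc_term d in
      (conv e (LApp (essence d) (num n)) (num 0) -> exists k, eval g [n] (S k)) /\
      (~ conv e (LApp (essence d) (num n)) (num 0) -> eval g [n] 0).
Proof.
  intros Ho Hg.
  set (B := LLam (LLam (LV 0))).
  (* [D] runs [g] on the one-element list holding its argument and inverts the verdict: answer 0
     leads to [num 0], a positive answer to [B], which is a different normal form. *)
  set (D := LLam (LApp (LApp (LApp (mterm g) (LApp (LApp tcons (LV 0)) (num 0))) (num 0)) (LLam B))).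
  assert (HD : cl 0 D).
  { simpl. repeat split; try lia. apply cl0, cl_mterm. }
  pose proof (ess_name D 0 HD) as E. change (essence (name 0 D) = D) in E.
  destruct (Hg (name 0 D) (wf_name th D Ho 0)) as [H1 H2]. rewrite E in *.
  set (n := enc_term (name 0 D)) in *. clearbody n.
  assert (C : forall y, eval g [n] y ->
     conv e (LApp D (num n)) (LApp (LApp (num y) (num 0)) (LLam B))).
  { intros y Hy. pose proof (cl_mterm g) as Cg. assert (Ct : cl 0 tcons) by (simpl; lia).
    assert (CB : cl 0 (LLam B)) by (simpl; lia).
    unfold D. bstep. rewrite tcons_lcons by apply cl_num.
    now rewrite (mu_representable e g _ _ Hy : conv e (LApp (mterm g) (lcons (num n) (num 0))) _). }
  (* No excluded middle is needed. Convertibility would make [g] answer positively and [D] yield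
     [B]; so it fails, [g] answers 0, and [D] yields [num 0] after all. *)
  assert (N : ~ conv e (LApp D (num n)) (num 0)).
  { intros Hc. destruct (H1 Hc) as [k Hk]. apply (num_0_neq e). fold B.
    rewrite <- Hc, (C _ Hk), num_S_case. bstep. reflexivity. }
  apply N. rewrite (C _ (H2 N)). apply num_0_case.
Qed.

#[local] Opaque enc_term enc_ty.

(** The tags 2 and 3 are those of [Lam] and [App]; 0 and 1 are the bound names in the successor case
    of [dnum]. *)
Definition dnum_code : exp :=
  EIter
    (EPair (econst 2) (EPair (econst 0) (EPair (econst (enc_ty TOm))
      (EPair (econst 2) (EPair (econst 1) (EPair (econst (enc_ty TOm))
        (EPair (econst 3) (EPair (econst (enc_term (Var 1))) (EVar 0)))))))))
    (EVar 0) (econst (enc_term (dnum 0))).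

Lemma den_dnum_code n : den dnum_code [n] = enc_term (dnum n).
Proof.
  unfold dnum_code. cbn [den nth]. rewrite !den_econst.
  induction n as [|n IH]; [reflexivity|].
  rewrite Nat.iter_succ, IH, !den_econst. reflexivity.
Qed.

Definition problem (d : dterm) (n : nat) : dterm := Pair (U (App d (dnum n))) (U (dnum 0)).

Definition problem_code : exp :=
  EPair (econst 4) (EPair
    (EPair (econst 0) (EPair (econst 3) (EPair (EVar 0) dnum_code)))
    (econst (enc_term (U (dnum 0))))).

Lemma den_problem_code d : den problem_code [enc_term d] = enc_term (problem d (enc_term d)).
Proof.
  unfold problem_code. cbn [den nth]. rewrite den_dnum_code, !den_econst. reflexivity.
Qed.

Lemma bnd_problem_code : bnd 1 problem_code.
Proof.
  unfold problem_code, dnum_code. cbn [bnd].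
  repeat match goal with
  | |- _ /\ _ => split
  | |- bnd _ (econst _) => apply bnd_econst
  end; exact Nat.lt_0_1.
Qed.

(** A constant [U] has no type but [TOm], so there is one candidate type, and checking and
    reconstruction face the same question. *)
Lemma typ_problem th R d n s : th_om th = true ->
  typ th R [] (problem d n) s <-> s = TCap TOm TOm /\ convR R (LApp (essence d) (num n)) (num 0).
Proof.
  intros Ho.
  assert (E : essence (U (App d (dnum n))) = LApp (essence d) (num n)).
  { unfold essence. cbn [ess]. now rewrite ess_dnum. }
  assert (E0 : essence (U (dnum 0)) = num 0) by reflexivity.
  rewrite <- E, <- E0. split.
  - intros H. inversion H; subst.
    repeat match goal with Hu : typ _ _ _ (U _) _ |- _ => inversion Hu; subst; clear Hu end. auto.
  - intros [-> H]. constructor; auto; now constructor.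
Qed.

Lemma wf_problem th d n : th_om th = true -> wf_term th d -> wf_term th (problem d n).
Proof. intros Ho Hd. simpl. auto using wf_dnum. Qed.

Theorem undecidable_systems th R : th_om th = true -> R <> Syn -> undecidable_sys th R.
Proof.
  intros Ho HR.
  assert (Wb : wf_basis th []) by (split; constructor).
  split.
  - intros [f Hf].
    set (h := EPair EZero (EPair problem_code (econst (enc_ty (TCap TOm TOm))))).
    apply (conversion_undecidable (eta_of R) th (MComp f [cmp h]) Ho).
    intros d Hd n. rewrite <- (convR_conv R) by exact HR.
    assert (Hh : eval (cmp h) [n] (cpair (enc_basis [])
        (cpair (enc_term (problem d n)) (enc_ty (TCap TOm TOm))))).
    { pose proof (eval_cmp h [n]) as A.
      unfold h in A at 3. cbn [den] in A. rewrite den_econst in A.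
      unfold n in A at 3. rewrite den_problem_code in A. apply A.
      unfold h. cbn [bnd]. auto using bnd_problem_code, bnd_econst. }
    destruct (Hf [] (problem d n) (TCap TOm TOm) Wb (wf_problem th d n Ho Hd)) as [F1 F2];
      [simpl; auto|].
    pose proof (typ_problem th R d n (TCap TOm TOm) Ho) as T.
    split; intros H.
    + exists 0. eapply eval_comp1; [exact Hh|]. apply F1, T. auto.
    + eapply eval_comp1; [exact Hh|]. apply F2. intros A. apply T in A. tauto.
  - intros [f Hf].
    set (h := EPair EZero problem_code).
    apply (conversion_undecidable (eta_of R) th (MComp f [cmp h]) Ho).
    intros d Hd n. rewrite <- (convR_conv R) by exact HR.
    assert (Hh : eval (cmp h) [n] (cpair (enc_basis []) (enc_term (problem d n)))).
    { pose proof (eval_cmp h [n]) as A.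
      unfold h in A at 3. cbn [den] in A.
      unfold n in A at 3. rewrite den_problem_code in A. apply A.
      unfold h. cbn [bnd]. auto using bnd_problem_code. }
    destruct (Hf [] (problem d n) Wb (wf_problem th d n Ho Hd)) as [F1 F2].
    split; intros H.
    + destruct F2 as (s & _ & Hs).
      { exists (TCap TOm TOm). apply typ_problem; auto. }
      exists (enc_ty s). eapply eval_comp1; [exact Hh|exact Hs].
    + eapply eval_comp1; [exact Hh|]. apply F1. intros s A. apply typ_problem in A; tauto.
Qed.

Theorem mainTheorem16 :
  decidable_sys CD Syn /\ decidable_sys CDV Syn /\
  decidable_sys CDS Syn /\ decidable_sys BCD Syn /\
  decidable_sys CD Beta /\ decidable_sys CDV Beta /\
  decidable_sys CDV BetaEta /\
  undecidable_sys CDS Beta /\ undecidable_sys BCD Beta /\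
  undecidable_sys BCD BetaEta.
Proof.
  repeat apply conj;
    first [apply decidable_systems; auto; fail | apply undecidable_systems; [reflexivity|discriminate]].
Qed.
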